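(* Let $(M^7,g_M)$ be a 3-Sasakian 7-manifold. Along the rescaled Ricci flow for the family of metrics $g=a^2(\eta_1^2+\eta_2^2)+b^2\eta_3^2+c^2\pi^*g_N$, $a,b,c>0$, on $M$, the 3-Sasakian metric $g_M$ is stable, whereas the squashed Einstein metric $\tilde g_M=\frac15(\eta_1^2+\eta_2^2+\eta_3^2)+\pi^*g_N$ is a saddle point and so unstable.
   Context: 3-Sasakian setting. A complete Riemannian 7-manifold $(M^7,g_M)$ is 3-Sasakian if it has an orthonormal triple of Killing fields $E_1,E_2,E_3$ with $[E_i,E_j]=2E_k$ for cyclic permutations $(i,j,k)$ of $(1,2,3)$, each $E_i$ defining a Sasakian structure. Then there is a locally free $\mathrm{SU}(2)$-action on $M$ with leaf space a 4-dimensional orbifold $N$ carrying an anti-self-dual Einstein metric $g_N$ of scalar curvature 48, and an orbifold Riemannian submersion $\pi:M\to N$. Let $\eta_1,\eta_2,\eta_3$ be the 1-forms dual to $E_1,E_2,E_3$, so $g_M=\eta_1^2+\eta_2^2+\eta_3^2+\pi^*g_N$. There are 2-forms $\omega_1,\omega_2,\omega_3$ on $M$, pullbacks of orthogonal self-dual 2-forms on $N$, with $\omega_i\wedge\omega_j=2\delta_{ij}\pi^*\mathrm{vol}_N$, $d\eta_i=-2\eta_j\wedge\eta_k-2\omega_i$ and $d\omega_i=-2\eta_j\wedge\omega_k+2\eta_k\wedge\omega_j$ for cyclic $(i,j,k)$. Flow. The Ricci flow is $\frac{\partial g}{\partial t}=-2\mathrm{Ric}(g)$. It preserves the family of metrics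 $g=a^2(\eta_1^2+\eta_2^2)+b^2\eta_3^2+c^2\pi^*g_N$ with positive constants $a,b,c$, so within it the flow is given by positive functions $a(t),b(t),c(t)$. The rescaled Ricci flow is the evolution of the scale-invariant quantities $A=a^2/c^2$, $B=b^2/c^2$ as functions of $s$, where $\frac{ds}{dt}=\frac1{c^2}$; it is an autonomous planar ODE system on $\{A,B>0\}$. The metrics $g_M$ and $\tilde g_M$ correspond to the critical points $A=B=1$ and $A=B=1/5$. A critical point is stable if the rescaled flow starting sufficiently near it converges back to it, and is a saddle point if the linearization of the system there has one positive and one negative eigenvalue. *)

(* Defs.v *)
From HB Require Import structures.
From mathcomp Require Import all_boot all_order all_algebra.
From mathcomp Require Import all_classical all_reals all_analysis.

Set Implicit Arguments.
Unset Strict Implicit.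
Unset Printing Implicit Defensive.

Import Order.TTheory GRing.Theory Num.Theory.
Import numFieldNormedType.Exports.

Local Open Scope classical_set_scope.
Local Open Scope ring_scope.

(* k times differentiable on D; D is meant to be open.  Differentiable means
   totally (Frechet) differentiable, so [smooth] is the usual C^infinity. *)
Fixpoint ndifferentiable (R : realType) (V W : normedModType R) (k : nat)
    (D : set V) (f : V -> W) : Prop :=
  if k is k'.+1 then
    (forall x, D x -> differentiable f x) /\
    (forall v, ndifferentiable k' D (fun x => 'D_v f x))
  else True.

Definition smooth (R : realType) (V W : normedModType R) (D : set V)
    (f : V -> W) : Prop :=
  forall k, ndifferentiable k D f.

(* [ch_coord i] and [ch_point i] are mutually inverse homeomorphisms between
   the open set [ch_dom i] and its open image; their values elsewhere are
   irrelevant. *)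
Record atlas (R : realType) (n : nat) (M : topologicalType) := Atlas {
  chart : Type ;
  ch_dom : chart -> set M ;
  ch_coord : chart -> M -> 'rV[R]_n ;
  ch_point : chart -> 'rV[R]_n -> M ;
  ch_cover : forall p, exists i, ch_dom i p ;
  ch_dom_open : forall i, open (ch_dom i) ;
  ch_img_open : forall i, open (ch_coord i @` ch_dom i) ;
  ch_coordK : forall i p, ch_dom i p -> ch_point i (ch_coord i p) = p ;
  ch_coord_continuous : forall i, {within ch_dom i, continuous (ch_coord i)} ;
  ch_point_continuous : forall i,
    {within ch_coord i @` ch_dom i, continuous (ch_point i)} ;
  ch_transition_smooth : forall i j,
    smooth (ch_coord i @` (ch_dom i `&` ch_dom j)) (ch_coord j \o ch_point i)
}.

Definition ch_img (R : realType) (n : nat) (M : topologicalType)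
    (A : atlas R n M) (i : chart A) : set 'rV[R]_n :=
  ch_coord i @` ch_dom i.

Definition transition (R : realType) (n : nat) (M : topologicalType)
    (A : atlas R n M) (i j : chart A) : 'rV[R]_n -> 'rV[R]_n :=
  ch_coord j \o ch_point i.

Definition vector_components (R : realType) (n : nat) (M : topologicalType)
    (A : atlas R n M) : Type :=
  chart A -> 'rV[R]_n -> 'rV[R]_n.

Definition tensor2_components (R : realType) (n : nat) (M : topologicalType)
    (A : atlas R n M) : Type :=
  chart A -> 'rV[R]_n -> 'M[R]_n.

(* Vectors are rows and ['J f x] acts on them from the right:
   ('J f x) k l is the k-th partial derivative of the l-th component of f. *)
Definition vector_field (R : realType) (n : nat) (M : topologicalType)
    (A : atlas R n M) (X : vector_components A) : Prop :=
  (forall i : chart A, smooth (ch_img i) (X i)) /\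
  (forall (i j : chart A) p, ch_dom i p -> ch_dom j p ->
     X j (ch_coord j p) =
     X i (ch_coord i p) *m 'J (transition i j) (ch_coord i p)).

Definition riemannian_metric (R : realType) (n : nat) (M : topologicalType)
    (A : atlas R n M) (g : tensor2_components A) : Prop :=
  [/\ forall i : chart A, smooth (ch_img i) (g i),
      forall (i j : chart A) p, ch_dom i p -> ch_dom j p ->
        g i (ch_coord i p) =
        'J (transition i j) (ch_coord i p) *m g j (ch_coord j p)
          *m ('J (transition i j) (ch_coord i p))^T,
      forall (i : chart A) x, ch_img i x -> (g i x)^T = g i x
    & forall (i : chart A) x, ch_img i x ->
        forall v : 'rV[R]_n, v != 0 -> 0 < (v *m g i x *m v^T) 0 0].

Section LocalRiemannianGeometry.
Variables (R : realType) (n : nat).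
Implicit Types (g : 'rV[R]_n -> 'M[R]_n) (X Y : 'rV[R]_n -> 'rV[R]_n).

Definition partial (k : 'I_n) (f : 'rV[R]_n -> R) (x : 'rV[R]_n) : R :=
  'D_(delta_mx 0 k) f x.

(* Gamma^k_ij *)
Definition christoffel g (k i j : 'I_n) (x : 'rV[R]_n) : R :=
  2^-1 * \sum_l invmx (g x) k l *
    (partial i (fun y => g y j l) x + partial j (fun y => g y i l) x
     - partial l (fun y => g y i j) x).

(* R^l_kij, where R(d_i, d_j) d_k = sum_l R^l_kij d_l and
   R(X, Y) = [nabla_X, nabla_Y] - nabla_[X, Y] *)
Definition riemann g (l k i j : 'I_n) (x : 'rV[R]_n) : R :=
  partial i (christoffel g l j k) x - partial j (christoffel g l i k) x
  + \sum_m (christoffel g l i m x * christoffel g m j k x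
            - christoffel g l j m x * christoffel g m i k x).

(* Ric(Y, Z) is the trace of X |-> R(X, Y) Z *)
Definition ricci g (x : 'rV[R]_n) : 'M[R]_n :=
  \matrix_(j, k) \sum_l riemann g l k l j x.

Definition lie_bracket X Y (x : 'rV[R]_n) : 'rV[R]_n :=
  \row_i \sum_j (X x 0 j * partial j (fun y => Y y 0 i) x
                 - Y x 0 j * partial j (fun y => X y 0 i) x).

Definition lie_derivative_metric X g (x : 'rV[R]_n) : 'M[R]_n :=
  \matrix_(i, j) \sum_k (X x 0 k * partial k (fun y => g y i j) x
                         + g x k j * partial i (fun y => X y 0 k) x
                         + g x i k * partial j (fun y => X y 0 k) x).

(* Row j is nabla_{d_j} X. *)
Definition covariant_derivative g X (x : 'rV[R]_n) : 'M[R]_n :=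
  \matrix_(j, i) (partial j (fun y => X y 0 i) x
                  + \sum_k christoffel g i j k x * X x 0 k).

(* nabla_{d_k} P for an endomorphism field P, row j of P being P(d_j) *)
Definition covariant_derivative_endo g (P : 'rV[R]_n -> 'M[R]_n) (k : 'I_n)
    (x : 'rV[R]_n) : 'M[R]_n :=
  \matrix_(j, i) (partial k (fun y => P y j i) x
                  + \sum_l (christoffel g i k l x * P x j l
                            - christoffel g l k j x * P x l i)).

Definition inner g (x u v : 'rV[R]_n) : R := (u *m g x *m v^T) 0 0.

Definition dual_form g X (x : 'rV[R]_n) : 'rV[R]_n := X x *m g x.

End LocalRiemannianGeometry.

Definition geodesic (R : realType) (n : nat) (M : topologicalType)
    (A : atlas R n M) (g : tensor2_components A) (c : R -> M) : Prop :=
  continuous c /\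
  (forall (i : chart A) t, ch_dom i (c t) ->
     let x := ch_coord i \o c in
     derivable x t 1 /\
     forall k : 'I_n, is_derive t 1 (fun u => (derive1 x u) 0 k)
       (- \sum_l \sum_m christoffel (g i) k l m (x t)
            * (derive1 x t) 0 l * (derive1 x t) 0 m)).

Definition complete_metric (R : realType) (n : nat) (M : topologicalType)
    (A : atlas R n M) (g : tensor2_components A) : Prop :=
  forall (i : chart A) p (v : 'rV[R]_n), ch_dom i p ->
    exists c : R -> M, [/\ geodesic g c, c (0 : R) = p
      & is_derive (0 : R) 1 (ch_coord i \o c) v].

Definition killing_field (R : realType) (n : nat) (M : topologicalType)
    (A : atlas R n M) (g : tensor2_components A) (X : vector_components A) :
    Prop :=
  vector_field X /\
  (forall (i : chart A) x, ch_img i x -> lie_derivative_metric (X i) (g i) x = 0).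

(* A unit Killing field xi defines a Sasakian structure when the field
   Phi(X) = - nabla_X xi satisfies
   (nabla_X Phi)(Y) = g(X, Y) xi - g(xi, Y) X. *)
Definition sasakian (R : realType) (n : nat) (M : topologicalType)
    (A : atlas R n M) (g : tensor2_components A) (xi : vector_components A) :
    Prop :=
  [/\ killing_field g xi,
      forall (i : chart A) x, ch_img i x -> inner (g i) x (xi i x) (xi i x) = 1
    & forall (i : chart A) x, ch_img i x -> forall k j l : 'I_n,
        covariant_derivative_endo (g i)
          (fun y => - covariant_derivative (g i) (xi i) y) k x j l
        = g i x k j * xi i x 0 l
          - dual_form (g i) (xi i) x 0 j * (k == l)%:R].

Definition three_sasakian (R : realType) (n : nat) (M : topologicalType)
    (A : atlas R n M) (g : tensor2_components A)
    (E1 E2 E3 : vector_components A) : Prop :=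
  [/\ [/\ sasakian g E1, sasakian g E2 & sasakian g E3],
      forall (i : chart A) x, ch_img i x ->
        [/\ inner (g i) x (E1 i x) (E2 i x) = 0,
            inner (g i) x (E2 i x) (E3 i x) = 0
          & inner (g i) x (E3 i x) (E1 i x) = 0]
    & forall (i : chart A) x, ch_img i x ->
        [/\ lie_bracket (E1 i) (E2 i) x = 2 *: E3 i x,
            lie_bracket (E2 i) (E3 i) x = 2 *: E1 i x
          & lie_bracket (E3 i) (E1 i) x = 2 *: E2 i x]].

Definition square_form (R : realType) (n : nat) (M : topologicalType)
    (A : atlas R n M) (g : tensor2_components A) (X : vector_components A) :
    tensor2_components A :=
  fun i x => (dual_form (g i) (X i) x)^T *m dual_form (g i) (X i) x.

(* pi^* g_N, read off from g_M = eta_1^2 + eta_2^2 + eta_3^2 + pi^* g_N *)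
Definition transverse_metric (R : realType) (n : nat) (M : topologicalType)
    (A : atlas R n M) (g : tensor2_components A)
    (E1 E2 E3 : vector_components A) : tensor2_components A :=
  fun i x => g i x - (square_form g E1 i x + square_form g E2 i x
                      + square_form g E3 i x).

Definition metric_family (R : realType) (n : nat) (M : topologicalType)
    (A : atlas R n M) (g : tensor2_components A)
    (E1 E2 E3 : vector_components A) (a b c : R) : tensor2_components A :=
  fun i x => a ^+ 2 *: (square_form g E1 i x + square_form g E2 i x)
    + b ^+ 2 *: square_form g E3 i x
    + c ^+ 2 *: transverse_metric g E1 E2 E3 i x.

Definition ricci_flow (R : realType) (n : nat) (M : topologicalType)
    (A : atlas R n M) (J : set R) (g : R -> tensor2_components A) : Prop :=
  forall t (i : chart A) x, J t -> ch_img i x ->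
    is_derive t 1 (fun u => g u i x) (- 2 *: ricci (g t i) x).

(* The point (A, B) = (a^2/c^2, b^2/c^2). *)
Definition ratios (R : realType) (a b c : R) : 'rV[R]_2 :=
  \row_(j < 2) (if j == 0 then a ^+ 2 / c ^+ 2 else b ^+ 2 / c ^+ 2).

Definition quadrant (R : realType) : set ('rV[R]_2) :=
  [set x | 0 < x 0 0 /\ 0 < x 0 1].

(* z = (A, B) as a function of s on the open interval K is obtained from a
   Ricci flow a, b, c on an open interval J by the time change
   ds/dt = 1/c^2. *)
Definition rescaled_ricci_flow (R : realType) (n : nat) (M : topologicalType)
    (A : atlas R n M) (g : tensor2_components A)
    (E1 E2 E3 : vector_components A) (K : set R) (z : R -> 'rV[R]_2) : Prop :=
  exists (J : set R) (a b c s : R -> R),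
    [/\ open J /\ is_interval J,
        forall t, J t -> [/\ 0 < a t, 0 < b t & 0 < c t],
        ricci_flow J (fun t => metric_family g E1 E2 E3 (a t) (b t) (c t)),
        s @` J = K /\ (forall t, J t -> is_derive t 1 s (1 / c t ^+ 2))
      & forall t, J t -> z (s t) = ratios (a t) (b t) (c t)].

(* F is the right-hand side of the autonomous planar system to which the
   rescaled Ricci flow is equivalent. *)
Definition rescaled_flow_system (R : realType) (n : nat) (M : topologicalType)
    (A : atlas R n M) (g : tensor2_components A)
    (E1 E2 E3 : vector_components A) (F : 'rV[R]_2 -> 'rV[R]_2) : Prop :=
  (forall p, quadrant p -> differentiable F p) /\
  (forall (K : set R) (z : R -> 'rV[R]_2), open K -> is_interval K ->
     (rescaled_ricci_flow g E1 E2 E3 K z <->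
      forall s, K s -> quadrant (z s) /\ is_derive s 1 z (F (z s)))).

(* Every rescaled flow starting near p exists for all s > 0 and tends to p;
   the initial value z0 is attained in the limit s -> 0+. *)
Definition stable_point (R : realType) (n : nat) (M : topologicalType)
    (A : atlas R n M) (g : tensor2_components A)
    (E1 E2 E3 : vector_components A) (p : 'rV[R]_2) : Prop :=
  exists2 e : R, 0 < e & forall z0 : 'rV[R]_2, `|z0 - p| < e ->
    let starts_at_z0 (z : R -> 'rV[R]_2) :=
      rescaled_ricci_flow g E1 E2 E3 `]0, +oo[%classic z /\
      z s @[s --> 0^'+] --> z0 in
    (exists z, starts_at_z0 z) /\
    (forall z, starts_at_z0 z -> z s @[s --> +oo] --> p).

Definition saddle_point (R : realType) (F : 'rV[R]_2 -> 'rV[R]_2)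
    (p : 'rV[R]_2) : Prop :=
  F p = 0 /\
  exists l m : R, [/\ 0 < l, m < 0, eigenvalue ('J F p) l
                    & eigenvalue ('J F p) m].

(* Main.v *)
Require Import Defs.
From HB Require Import structures.
From mathcomp Require Import all_boot all_order all_algebra.
From mathcomp Require Import all_classical all_reals all_analysis.
From mathcomp Require Import ring lra.

(** The rescaled flow is first identified with an explicit planar system, and
    the two critical points are then analysed by hand.

    The planar system comes from the Ricci tensor of the family.  A 3-Sasakian
    metric g in dimension n has Ric = (n - 1) g: the difference W between its
    curvature and that of the unit sphere annihilates each Reeb field and
    commutes with each of the three endomorphisms P_a = - nabla xi_a, while the
    quaternionic relation P_3 = P_2 P_1, valid up to terms killed by W, forces
    tr (W P_a) = 0.  By the first Bianchi identity the Ricci contraction rho of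
    W then satisfies P_a rho P_a^T = - rho for a = 1, 2, 3; as P_3 acts like
    the composite of P_1 and P_2, rho is its own opposite and vanishes
    ([weyl_ricci_flat], [three_sasakian_einstein]).  Each metric of the family
    is c g + k_1 eta_1^2 + k_2 eta_2^2 + k_3 eta_3^2 with constant
    coefficients.  Since each xi_a is Killing, its Levi-Civita connection
    differs from that of g by an algebraic expression in the eta_a and P_a, and
    its Ricci tensor is again a combination of g and the eta_a^2
    ([deformed_levi_civita_ricci]).  These computations take place over any
    commutative ring with commuting derivations in which 2 is invertible; they
    apply to the ring of smooth functions on the image of a chart, whose
    evaluations turn the ring identities into the coordinate formulas for the
    Christoffel symbols and curvature ([ev_ricci], [ricci_metric_family]).

    At each point eta_1^2 + eta_2^2, eta_3^2 and pi^* g_N are linearly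
    independent, so the Ricci flow of the family is a differential equation for
    a^2, b^2, c^2 ([ricci_flowE]).  The change of time ds/dt = 1/c^2 turns it
    into the planar system [flow_field]; conversely c, the time t and then a, b
    are recovered from a planar solution by integration ([rescaled_flow_ode],
    [ode_rescaled_flow]).

    Near A = B = 1 put x = A - 1 and y = B/A - 1.  Then x' = - 16 x and
    y' = - 16 y to first order.  Hence x^2 + y^2 has derivative at most
    - (x^2 + y^2) along any solution starting close to the point, and so tends
    to 0 ([decay], [flow_attracted]).  Solutions exist for all s > 0: in the
    unknowns X = x/r, V = y/r with r = exp (- 16 s) the linear part disappears,
    the half line becomes ]0, 1], and the new equation extends regularly to
    [0, 1] with a right-hand side of small Lipschitz constant, so a single
    Picard iteration suffices ([picard], [flow_solution]).

    At A = B = 1/5 the linearization has the eigenvectors (1, 1) and (1, - 2),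
    with eigenvalues 16 and - 208/5.  The diagonal A = B is invariant and
    carries the explicit solutions (1 + k e^(16 s)) / (5 + k e^(16 s)), k > 0,
    which start arbitrarily close to 1/5 and increase away from it
    ([escape_gap], [squashed_unstable]). *)

Set Implicit Arguments.
Unset Strict Implicit.
Unset Printing Implicit Defensive.

Import Order.TTheory GRing.Theory Num.Theory.
Import numFieldNormedType.Exports.

Local Open Scope classical_set_scope.
Local Open Scope ring_scope.

(** * Derivations, connections and curvature *)

Lemma addmxE (K : pzRingType) m p (A B : 'M[K]_(m, p)) i j :
  (A + B) i j = A i j + B i j.
Proof. by rewrite mxE. Qed.

Lemma oppmxE (K : pzRingType) m p (A : 'M[K]_(m, p)) i j : (- A) i j = - A i j.
Proof. by rewrite mxE. Qed.

Lemma scalemxE (K : pzRingType) m p c (A : 'M[K]_(m, p)) i j :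
  (c *: A) i j = c * A i j.
Proof. by rewrite mxE. Qed.

Lemma zeromxE (K : pzRingType) m p i j : (0 : 'M[K]_(m, p)) i j = 0.
Proof. by rewrite mxE. Qed.

Lemma addmxT (K : pzRingType) m p (A B : 'M[K]_(m, p)) :
  (A + B)^T = A^T + B^T.
Proof. exact: linearD. Qed.

Lemma oppmxT (K : pzRingType) m p (A : 'M[K]_(m, p)) : (- A)^T = - A^T.
Proof. exact: linearN. Qed.

(** Products are left opaque, so an identity between linear combinations of
    matrices becomes a ring identity between their entries, with no sum to
    expand. *)
Ltac mx_linear :=
  apply/matrixP => ? ?; rewrite ?(addmxE, oppmxE, scalemxE, zeromxE); ring.

Ltac mx_expand :=
  rewrite ?(mulmxDl, mulmxDr, mulmxBl, mulmxBr, mulmxN, mulNmx, mulmxA,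
    mulmx1, mul1mx, mulmx0, mul0mx, linearZ, scalemxAl).

Section DifferentialRing.
Variables (K : comNzRingType) (n : nat) (d : 'I_n -> {additive K -> K}).
Hypothesis dM : forall k x y, d k (x * y) = d k x * y + x * d k y.
Hypothesis dC : forall j k x, d j (d k x) = d k (d j x).

(** The ring K with its commuting derivations d k stands for the functions on a
    coordinate domain: over it, curvature computations become matrix identities
    without differentiability side conditions.  Vector fields are rows, and
    endomorphisms act on them from the right. *)
Definition dmx m p k (A : 'M[K]_(m, p)) : 'M[K]_(m, p) := map_mx (d k) A.

Lemma dmxD m p k (A B : 'M[K]_(m, p)) : dmx k (A + B) = dmx k A + dmx k B.
Proof. by apply/matrixP => i j; rewrite !mxE raddfD. Qed.

Lemma dmxN m p k (A : 'M[K]_(m, p)) : dmx k (- A) = - dmx k A.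
Proof. by apply/matrixP => i j; rewrite !mxE raddfN. Qed.

Lemma dmxB m p k (A B : 'M[K]_(m, p)) : dmx k (A - B) = dmx k A - dmx k B.
Proof. by rewrite dmxD dmxN. Qed.

Lemma dmx0 m p k : dmx k (0 : 'M[K]_(m, p)) = 0.
Proof. by apply/matrixP => i j; rewrite !mxE raddf0. Qed.

Lemma dmxM m p q k (A : 'M[K]_(m, p)) (B : 'M[K]_(p, q)) :
  dmx k (A *m B) = dmx k A *m B + A *m dmx k B.
Proof.
apply/matrixP => i j; rewrite !mxE raddf_sum -big_split /=.
by apply: eq_bigr => l _; rewrite !mxE dM.
Qed.

Lemma dmxT m p k (A : 'M[K]_(m, p)) : dmx k A^T = (dmx k A)^T.
Proof. by apply/matrixP => i j; rewrite !mxE. Qed.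

Lemma dmxC m p j k (A : 'M[K]_(m, p)) : dmx j (dmx k A) = dmx k (dmx j A).
Proof. by apply/matrixP => i l; rewrite !mxE dC. Qed.

Lemma d1 k : d k 1 = 0.
Proof. by apply: (addrI (d k 1)); rewrite addr0 -{3}[1]mulr1 dM mulr1 mul1r. Qed.

Lemma dmx1 p k : dmx k (1%:M : 'M[K]_p) = 0.
Proof. by apply/matrixP => i j; rewrite !mxE; case: eqP; rewrite /= ?mulr1n ?mulr0n ?raddf0 ?d1. Qed.

Lemma dmx_delta k j : dmx k (delta_mx 0 j : 'rV_n) = 0.
Proof. by apply/matrixP => i l; rewrite !mxE; case: (_ && _); rewrite /= ?raddf0 ?d1. Qed.

Lemma dmxZ m p k c (A : 'M[K]_(m, p)) : dmx k (c *: A) = d k c *: A + c *: dmx k A.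
Proof. by apply/matrixP => i j; rewrite !mxE dM. Qed.

Lemma dmx_row m p k i (A : 'M[K]_(m, p)) : dmx k (row i A) = row i (dmx k A).
Proof. by apply/matrixP => a b; rewrite !mxE. Qed.

Local Notation e_ k := (delta_mx (0 : 'I_1) k : 'rV[K]_n).

Section Connection.
Variable G : 'I_n -> 'M[K]_n.

(** Row j of G k is the covariant derivative of the j-th coordinate field in
    the k-th direction. *)
Definition nabla_vec k (v : 'rV[K]_n) := dmx k v + v *m G k.
Definition nabla_cov k (a : 'rV[K]_n) := dmx k a - a *m (G k)^T.
Definition nabla_end k (P : 'M[K]_n) := dmx k P + P *m G k - G k *m P.

(** Row k is the curvature R(d_i, d_j) applied to the k-th coordinate field. *)
Definition curvature i j : 'M[K]_n :=
  dmx i (G j) - dmx j (G i) + G j *m G i - G i *m G j.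

Definition ricci_of : 'M[K]_n := \matrix_(j, k) \sum_l curvature l j k l.

Lemma nabla_vecM k v P :
  nabla_vec k (v *m P) = nabla_vec k v *m P + v *m nabla_end k P.
Proof.
rewrite /nabla_vec /nabla_end dmxM; mx_expand; mx_linear.
Qed.

Lemma nabla_endD k P Q : nabla_end k (P + Q) = nabla_end k P + nabla_end k Q.
Proof. rewrite /nabla_end dmxD; mx_expand; mx_linear. Qed.

Lemma nabla_endZ k c P : d k c = 0 -> nabla_end k (c *: P) = c *: nabla_end k P.
Proof.
move=> dc; rewrite /nabla_end dmxZ dc scale0r add0r -scalemxAl -scalemxAr.
mx_linear.
Qed.

Lemma nabla_outer k a v :
  nabla_end k (a^T *m v) = (nabla_cov k a)^T *m v + a^T *m nabla_vec k v.
Proof.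
rewrite /nabla_cov /nabla_end /nabla_vec dmxM dmxT addmxT oppmxT trmx_mul trmxK.
mx_expand; mx_linear.
Qed.

Lemma curvatureN i j : curvature j i = - curvature i j.
Proof. rewrite /curvature; mx_linear. Qed.

Hypothesis Gsym : forall i j, row i (G j) = row j (G i).

Lemma delta_G i j : e_ i *m G j = e_ j *m G i.
Proof. by rewrite -!rowE. Qed.

(** The first Bianchi identity: by the symmetry of G every term of the cyclic
    sum occurs with both signs. *)
Lemma row_curvature k i j :
  row k (curvature i j) + row i (curvature j k) + row j (curvature k i) = 0.
Proof.
rewrite !rowE /curvature; mx_expand.
have E a b c : e_ a *m dmx b (G c) = e_ c *m dmx b (G a).
  by rewrite -!rowE -!dmx_row Gsym.
rewrite (delta_G k j) (delta_G k i) (delta_G j i) (E k i j) (E i j k) (E j k i).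
mx_linear.
Qed.

(** The Ricci identity, for an endomorphism field whose covariant derivatives
    are known in closed form; the defining equation of a Sasakian structure
    provides them. *)
Lemma curvature_end P i j (T : 'I_n -> 'M[K]_n) :
  (forall k, nabla_end k P = T k) ->
  P *m curvature i j - curvature i j *m P =
    (dmx i (T j) + T j *m G i - G i *m T j)
    - (dmx j (T i) + T i *m G j - G j *m T i).
Proof.
move=> PT; rewrite -!PT /nabla_end /curvature !(dmxD, dmxN, dmxM).
rewrite (dmxC j i); mx_expand; mx_linear.
Qed.

Lemma curvature_vec v i j (T : 'I_n -> 'rV[K]_n) :
  (forall k, nabla_vec k v = T k) ->
  v *m curvature i j = (dmx i (T j) + T j *m G i) - (dmx j (T i) + T i *m G j).
Proof.
move=> vT; rewrite -!vT /nabla_vec /curvature !(dmxD, dmxN, dmxM).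
rewrite (dmxC j i); mx_expand; mx_linear.
Qed.

Section Metric.
Variables (g gi : 'M[K]_n).
Hypotheses (gT : g^T = g) (ggi : g *m gi = 1%:M).
Hypothesis Gg : forall k, dmx k g = G k *m g + g *m (G k)^T.

Lemma mulmxg_inj m : injective (fun A : 'M[K]_(m, n) => A *m g).
Proof. by move=> A B /(congr1 (mulmx^~ gi)); rewrite /= -!mulmxA ggi !mulmx1. Qed.

Lemma nabla_dual k v : nabla_cov k (v *m g) = nabla_vec k v *m g.
Proof. rewrite /nabla_cov /nabla_vec dmxM Gg; mx_expand; mx_linear. Qed.

Lemma d_inner k u v :
  dmx k (u *m g *m v^T) =
  nabla_vec k u *m g *m v^T + u *m g *m (nabla_vec k v)^T.
Proof.
rewrite /nabla_vec !dmxM dmxT Gg addmxT trmx_mul.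
mx_expand; mx_linear.
Qed.

(** Differentiate the compatibility of G with g once more and use that second
    derivatives of g commute. *)
Lemma curvature_skew i j : curvature i j *m g + (curvature i j *m g)^T = 0.
Proof.
have E := dmxC i j g; move: E.
rewrite !Gg !(dmxD, dmxM) !Gg !dmxT trmx_mul gT /curvature.
rewrite !addmxT !oppmxT !trmx_mul.
mx_expand => E.
apply/matrixP => a b; have := congr1 (fun M : 'M[K]_n => M a b) E.
rewrite /= ?(addmxE, oppmxE, zeromxE) => /eqP; rewrite -subr_eq0 => /eqP <-.
ring.
Qed.

End Metric.
End Connection.
End DifferentialRing.

(** * A three-Sasakian metric is Einstein *)

Section RicciFlat.
Variables (K : comNzRingType) (n : nat) (g gi : 'M[K]_n).
Hypothesis dbl0 : forall x : K, x + x = 0 -> x = 0.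
Hypotheses (gT : g^T = g) (ggi : g *m gi = 1%:M).
Variable W : 'I_n -> 'I_n -> 'M[K]_n.
Hypothesis WN : forall i j, W j i = - W i j.
Hypothesis Wcyc : forall i j k,
  row k (W i j) + row i (W j k) + row j (W k i) = 0.
Hypothesis Wskew : forall i j, W i j *m g + (W i j *m g)^T = 0.

(** The Ricci contraction of W; the hypotheses on W are the symmetries of a
    curvature tensor. *)
Definition trace_form : 'M[K]_n := \matrix_(j, k) \sum_l W l j k l.
Local Notation rho := trace_form.

Lemma dbl0_mx m p (A : 'M[K]_(m, p)) : A + A = 0 -> A = 0.
Proof.
move=> A0; apply/matrixP => i j; rewrite zeromxE; apply: dbl0.
by rewrite -addmxE A0 zeromxE.
Qed.

(** A skew endomorphism is conjugate to the opposite of its transpose. *)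
Lemma skew_tr0 (A : 'M[K]_n) : A *m g + (A *m g)^T = 0 -> \tr A = 0.
Proof.
move=> /eqP; rewrite trmx_mul gT addr_eq0 => /eqP E; apply: dbl0.
have EA : A = - (g *m A^T *m gi) by rewrite -mulNmx -E -mulmxA ggi mulmx1.
by rewrite {1}EA linearN /= mxtrace_mulC mulmxA (mulmx1C ggi) mul1mx mxtrace_tr
  addNr.
Qed.

(** By the Bianchi identity the antisymmetric part of the contraction is the
    trace of a skew endomorphism. *)
Lemma trace_formT : rho^T = rho.
Proof.
apply/matrixP => k j; rewrite !mxE; apply/eqP; rewrite -subr_eq0 -sumrB.
suff -> : \sum_l (W l j k l - W l k j l) = - \tr (W j k).
  by rewrite skew_tr0 // oppr0.
rewrite /mxtrace -sumrN; apply: eq_bigr => l _.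
have /matrixP/(_ 0 l) := Wcyc j k l.
rewrite (WN l k) !mxE => E; apply/eqP; rewrite -subr_eq0 -E; apply/eqP; ring.
Qed.

Section Complex.
Variables (xi : 'rV[K]_n) (P : 'M[K]_n).
Local Notation eta := (xi *m g).
Hypothesis PP : P *m P = eta^T *m xi - 1%:M.
Hypothesis xiW : forall i j, xi *m W i j = 0.
Hypothesis PW : forall i j, P *m W i j = W i j *m P.
Hypothesis trWP : forall i j, \tr (W i j *m P) = 0.

Lemma W_dual i j : W i j *m eta^T = 0.
Proof.
have /eqP := Wskew i j; rewrite addr_eq0 => /eqP E.
by rewrite trmx_mul gT mulmxA E mulNmx trmx_mul gT -!mulmxA -trmx_mul xiW trmx0
  mulmx0 oppr0.
Qed.

(** As W kills xi its range is orthogonal to xi, where P squares to - 1.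
    Inserting P P in the last slot of rho, moving one factor P through W and
    applying the Bianchi identity leaves P rho P^T and the trace of W P, which
    vanishes. *)
Lemma trace_form_complex : P *m rho *m P^T = - rho.
Proof.
apply/matrixP => k j; rewrite oppmxE -{2}trace_formT [rho^T _ _]mxE.
have E1 l : (P *m W l j *m P) k l = - W l j k l.
  by rewrite PW -mulmxA PP mulmxBr mulmxA W_dual mul0mx mulmx1 sub0r oppmxE.
rewrite [rho j k]mxE -sumrN -(eq_bigr _ (fun l _ => E1 l)).
have E2 m l : (W l j *m P) m l = - (W j m *m P) l l + (P *m W l m) j l.
  rewrite PW !mxE -sumrN -big_split /=; apply: eq_bigr => q _.
  have /matrixP/(_ 0 q) := Wcyc j m l; rewrite (WN l m) !mxE => E.
  apply/eqP; rewrite -subr_eq0; apply/eqP.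
  by rewrite -[RHS](mul0r (P q l)) -E; ring.
have E3 l : (P *m W l j *m P) k l =
    \sum_m P k m * (- (W j m *m P) l l + (P *m W l m) j l).
  by rewrite -mulmxA mxE; apply: eq_bigr => m _; rewrite E2.
rewrite (eq_bigr _ (fun l _ => E3 l)) exchange_big /= -mulmxA mxE.
apply: eq_bigr => m _; rewrite -mulr_sumr; congr (_ * _).
rewrite big_split /= sumrN [X in - X](_ : _ = \tr (W j m *m P)) // trWP oppr0.
rewrite add0r mxE; have E4 q : rho m q * P^T q j = \sum_l W l m q l * P j q.
  by rewrite [rho m q]mxE [P^T _ _]mxE mulr_suml.
rewrite (eq_bigr _ (fun q _ => E4 q)) exchange_big /=; apply: eq_bigr => l _; rewrite mxE.
by apply: eq_bigr => q _; rewrite mulrC.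
Qed.

End Complex.
End RicciFlat.

Lemma mx11T (K : pzRingType) (A : 'M[K]_1) : A^T = A.
Proof. by rewrite [A]mx11_scalar tr_scalar_mx. Qed.

Section ThreeSasakian.
Variables (K : comNzRingType) (n : nat) (d : 'I_n -> {additive K -> K}).
Hypothesis dM : forall k x y, d k (x * y) = d k x * y + x * d k y.
Hypothesis dC : forall j k x, d j (d k x) = d k (d j x).
Hypothesis dbl0 : forall x : K, x + x = 0 -> x = 0.
Variables (g gi : 'M[K]_n) (G : 'I_n -> 'M[K]_n).
Hypotheses (gT : g^T = g) (ggi : g *m gi = 1%:M).
Hypothesis Gsym : forall i j, row i (G j) = row j (G i).
Hypothesis Gg : forall k, dmx d k g = G k *m g + g *m (G k)^T.

Local Notation e_ k := (delta_mx (0 : 'I_1) k : 'rV[K]_n).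
Local Notation nv := (nabla_vec d G).
Local Notation nc := (nabla_cov d G).
Local Notation ne := (nabla_end d G).
Local Notation curv := (curvature d G).

(** P is the endomorphism X |-> - nabla_X xi; [sas_skew] is the Killing
    equation and [sas_end] the curvature condition of a Sasakian structure. *)
Record sasakian_pair (xi : 'rV[K]_n) (P : 'M[K]_n) : Prop := SasakianPair {
  sas_vec : forall k, nv k xi = - row k P ;
  sas_skew : P *m g + (P *m g)^T = 0 ;
  sas_unit : xi *m g *m xi^T = 1%:M ;
  sas_end : forall k, ne k P = (row k g)^T *m xi - (xi *m g)^T *m e_ k }.

(** The curvature tensor that g would have if it were the metric of a unit
    sphere. *)
Definition round_curvature i j : 'M[K]_n :=
  (row j g)^T *m e_ i - (row i g)^T *m e_ j.
Local Notation R0 := round_curvature.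
Definition weyl_part i j : 'M[K]_n := curv i j - R0 i j.
Local Notation W := weyl_part.

Lemma row_gT k : (row k g)^T = g *m (e_ k)^T.
Proof. by rewrite rowE trmx_mul gT. Qed.

Lemma dualT (v : 'rV[K]_n) : (v *m g)^T = g *m v^T.
Proof. by rewrite trmx_mul gT. Qed.

Lemma row_inj_mx m (A B : 'M[K]_(n, m)) : (forall k, e_ k *m A = e_ k *m B) -> A = B.
Proof. by move=> E; apply/row_matrixP => k; rewrite !rowE. Qed.

Section One.
Variables (xi : 'rV[K]_n) (P : 'M[K]_n).
Hypothesis S : sasakian_pair xi P.
Local Notation eta := (xi *m g).

Lemma sas_vecE k : nv k xi = - (e_ k *m P).
Proof. by rewrite (sas_vec S) rowE. Qed.

Lemma sas_covE k : nc k eta = - (e_ k *m P *m g).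
Proof. by rewrite nabla_dual // sas_vecE mulNmx. Qed.

Lemma sas_skewE : g *m P^T = - (P *m g).
Proof. by have /eqP := sas_skew S; rewrite trmx_mul gT addrC addr_eq0 => /eqP. Qed.

Lemma sas_skewT : (P *m g)^T = - (P *m g).
Proof. by rewrite trmx_mul gT sas_skewE. Qed.

(** Differentiate g(xi, xi) = 1. *)
Lemma sas_P_dual : P *m eta^T = 0.
Proof.
apply: row_inj_mx => k; rewrite mulmx0; apply: dbl0_mx => //.
have := d_inner dM Gg k xi xi.
rewrite (sas_unit S) dmx1 // sas_vecE oppmxT !mulNmx mulmxN -opprD.
move=> /eqP; rewrite eq_sym oppr_eq0 => /eqP <-.
congr (_ + _); first by rewrite dualT !mulmxA.
by rewrite dualT -[RHS]mx11T !trmx_mul !trmxK gT !mulmxA.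
Qed.

Lemma sas_xiP : xi *m P = 0.
Proof.
apply: (mulmxg_inj ggi); rewrite mul0mx -mulmxA -[P *m g]opprK -sas_skewE mulmxN.
by rewrite mulmxA -[eta]trmxK -trmx_mul sas_P_dual trmx0 oppr0.
Qed.

Lemma xi_row_dual k : xi *m (row k g)^T = e_ k *m eta^T.
Proof. by rewrite row_gT dualT -[LHS]mx11T !trmx_mul trmxK gT mulmxA. Qed.

(** Differentiate xi P = 0. *)
Lemma sas_PP : P *m P = eta^T *m xi - 1%:M.
Proof.
apply: row_inj_mx => k.
have := nabla_vecM dM G k xi P; rewrite sas_xiP sas_vecE (sas_end S).
rewrite {1}/nabla_vec dmx0 mul0mx addr0 mulmxBr !mulmxA xi_row_dual.
rewrite dualT !mulmxA (sas_unit S) mul1mx mulNmx => /eqP.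
rewrite eq_sym addrC subr_eq0 => /eqP E.
by rewrite -E mulmxBr mulmx1 !mulmxA.
Qed.

(** Applied to the Reeb field the curvature is that of the sphere: the Ricci
    identity for xi expresses it through the derivatives of P. *)
Lemma sas_xi_weyl i j : xi *m W i j = 0.
Proof.
rewrite /weyl_part mulmxBr.
rewrite (curvature_vec dM dC _ _ (T := fun k => - (e_ k *m P))) //; last first.
  by move=> k; rewrite sas_vecE.
rewrite !dmxN !dmxM // !dmx_delta // !mul0mx !add0r.
have E a : dmx d a P = ne a P - P *m G a + G a *m P.
  by rewrite /nabla_end; mx_linear.
rewrite !E !(sas_end S) /R0.
rewrite !(mulmxBr, mulmxDr, mulNmx) !(mulmxA xi) !xi_row_dual !mulmxA.
rewrite (delta_G Gsym i j).
have gsym : e_ j *m (row i g)^T = e_ i *m (row j g)^T.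
  by rewrite !row_gT -[LHS]mx11T !trmx_mul !trmxK gT mulmxA.
rewrite gsym; mx_linear.
Qed.

(** The Ricci identity for P: its second derivatives are known, and give the
    commutator of P with the curvature of the sphere. *)
Lemma sas_P_weyl i j : P *m W i j = W i j *m P.
Proof.
suff : P *m curv i j - curv i j *m P = P *m R0 i j - R0 i j *m P.
  rewrite /weyl_part; move: (curv i j) (R0 i j) => C R E.
  apply/eqP; rewrite -subr_eq0; apply/eqP.
  transitivity (P *m C - C *m P - (P *m R - R *m P)); first by mx_expand; mx_linear.
  by rewrite E subrr.
pose T k := (row k g)^T *m xi - eta^T *m e_ k.
have dT a b : dmx d a (T b) + T b *m G a - G a *m T b =
    (e_ b *m G a *m g)^T *m xi - (row b g)^T *m (e_ a *m P)
    + (e_ a *m P *m g)^T *m e_ b - eta^T *m (e_ b *m G a).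
  have -> : dmx d a (T b) + T b *m G a - G a *m T b = ne a (T b) by [].
  have -> : T b = (e_ b *m g)^T *m xi + (- eta)^T *m e_ b.
    by rewrite /T rowE oppmxT mulNmx.
  rewrite nabla_endD // !nabla_outer // nabla_dual // sas_vecE.
  have -> : nc a (- eta) = - nc a eta.
    by rewrite /nabla_cov dmxN mulNmx; mx_linear.
  rewrite sas_covE opprK /nabla_vec !dmx_delta // !add0r rowE oppmxT mulmxN mulNmx.
  by rewrite addrA.
rewrite (curvature_end dM dC _ _ (T := T)); last exact: (sas_end S).
rewrite !dT (delta_G Gsym i j) /R0 mulmxBr mulmxBl !row_gT.
have E k : (e_ k *m P *m g)^T = - (P *m (g *m (e_ k)^T)).
  rewrite !trmx_mul gT mulmxA sas_skewE mulNmx !mulmxA.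
  by [].
rewrite !E !mulmxA; mx_expand; mx_linear.
Qed.

End One.
Lemma round_skew i j : R0 i j *m g + (R0 i j *m g)^T = 0.
Proof.
rewrite /R0 mulmxBl addmxT oppmxT -!mulmxA -!rowE !trmx_mul !trmxK.
by mx_linear.
Qed.

Lemma weylN i j : W j i = - W i j.
Proof. rewrite /weyl_part (curvatureN d G i j) /R0; mx_linear. Qed.

Lemma weyl_cyc i j k : row k (W i j) + row i (W j k) + row j (W k i) = 0.
Proof.
have gs a b : e_ a *m (row b g)^T = e_ b *m (row a g)^T.
  by rewrite !row_gT -[LHS]mx11T !trmx_mul !trmxK gT mulmxA.
have := row_curvature d Gsym k i j.
rewrite !rowE /weyl_part.
move: (curv i j) (curv j k) (curv k i) => C1 C2 C3 E.
rewrite /R0 !mulmxBr !mulmxA.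
rewrite (gs k j) (gs k i) (gs i j).
transitivity (e_ k *m C1 + e_ i *m C2 + e_ j *m C3); last exact: E.
mx_linear.
Qed.

Lemma weyl_skew i j : W i j *m g + (W i j *m g)^T = 0.
Proof.
have E1 := curvature_skew dM dC gT Gg i j; have E2 := round_skew i j.
rewrite /weyl_part; move: (curv i j) E1 => C E1.
transitivity (C *m g + (C *m g)^T - (R0 i j *m g + (R0 i j *m g)^T)).
  by rewrite mulmxBl addmxT oppmxT; mx_linear.
by rewrite E1 E2 subrr.
Qed.

Section Two.
Variables (xi1 xi2 xi3 : 'rV[K]_n) (P1 P2 P3 : 'M[K]_n).
Hypotheses (S1 : sasakian_pair xi1 P1) (S2 : sasakian_pair xi2 P2).
Hypothesis S3 : sasakian_pair xi3 P3.
Hypothesis ortho : xi1 *m g *m xi2^T = 0.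
Hypothesis bracket : xi2 *m P1 - xi1 *m P2 = xi3 + xi3.

(** Differentiate g(xi1, xi2) = 0. *)
Lemma cross_sum : xi2 *m P1 + xi1 *m P2 = 0.
Proof.
have E : P1 *m (xi2 *m g)^T + P2 *m (xi1 *m g)^T = 0.
  apply: row_inj_mx => k; rewrite mulmx0 mulmxDr.
  have := d_inner dM Gg k xi1 xi2.
  rewrite ortho dmx0 (sas_vecE S1) (sas_vecE S2) oppmxT !mulNmx mulmxN -opprD.
  move=> /eqP; rewrite eq_sym oppr_eq0 => /eqP <-.
  congr (_ + _); first by rewrite dualT !mulmxA.
  by rewrite dualT -[RHS]mx11T !trmx_mul !trmxK gT !mulmxA.
apply: (mulmxg_inj ggi); rewrite mul0mx mulmxDl -!mulmxA.
rewrite -[P1 *m g]opprK -[P2 *m g]opprK -(sas_skewE S1) -(sas_skewE S2).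
rewrite !mulmxN -opprD !mulmxA -[X in - X]trmxK addmxT.
by rewrite !trmx_mul !trmxK gT -!dualT E trmx0 oppr0.
Qed.

(** The bracket relation gives the difference of the two products, and
    [cross_sum] gives their sum. *)
Lemma cross21 : xi2 *m P1 = xi3.
Proof.
apply/eqP; rewrite -subr_eq0; apply/eqP; apply: dbl0_mx => //.
transitivity ((xi2 *m P1 - xi1 *m P2) + (xi2 *m P1 + xi1 *m P2) - (xi3 + xi3)).
  by mx_linear.
by rewrite bracket cross_sum addr0 subrr.
Qed.

Lemma cross12 : xi1 *m P2 = - xi3.
Proof. by rewrite -cross21; apply/eqP; rewrite -addr_eq0 addrC cross_sum. Qed.

Lemma cross_dual12 : P1 *m (xi2 *m g)^T = - (xi3 *m g)^T.
Proof.
by rewrite -cross21 -mulmxA [(xi2 *m (_ *m _))^T]trmx_mul (sas_skewT S1) mulNmx opprK dualT mulmxA.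
Qed.

Lemma cross_dual21 : P2 *m (xi1 *m g)^T = (xi3 *m g)^T.
Proof.
by rewrite -[xi3]opprK -cross12 mulNmx oppmxT -mulmxA
  [(xi1 *m (_ *m _))^T]trmx_mul (sas_skewT S2)
  mulNmx opprK dualT mulmxA.
Qed.

Lemma ortho21 : xi2 *m (xi1 *m g)^T = 0.
Proof. by rewrite dualT mulmxA -[LHS]mx11T !trmx_mul trmxK gT mulmxA. Qed.

Lemma ortho12 : xi1 *m (xi2 *m g)^T = 0.
Proof. by rewrite dualT mulmxA. Qed.

(** Differentiate xi2 P1 = xi3. *)
Lemma prod21 : P2 *m P1 = P3 + (xi2 *m g)^T *m xi1.
Proof.
apply: row_inj_mx => k; have := nabla_vecM dM G k xi2 P1.
rewrite cross21 (sas_vecE S3) (sas_vecE S2) (sas_end S1) mulmxBr !mulmxA xi_row_dual.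
rewrite ortho21 mul0mx subr0 mulmxDr !mulmxA mulNmx => E.
apply/eqP; rewrite -subr_eq0; apply/eqP.
transitivity (- (e_ k *m P3)
    - (- (e_ k *m P2 *m P1) + e_ k *m (xi2 *m g)^T *m xi1)); first by mx_linear.
by rewrite -E subrr.
Qed.

Lemma prod12 : P1 *m P2 = - P3 + (xi1 *m g)^T *m xi2.
Proof.
apply: row_inj_mx => k; have := nabla_vecM dM G k xi1 P2.
have nvN v : nv k (- v) = - nv k v by rewrite /nabla_vec dmxN; mx_expand; mx_linear.
rewrite cross12 nvN (sas_vecE S3) (sas_vecE S1) (sas_end S2) mulmxBr !mulmxA.
rewrite xi_row_dual ortho12 mul0mx subr0 mulmxDr mulmxN !mulmxA mulNmx opprK => E.
apply/eqP; rewrite -subr_eq0; apply/eqP.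
transitivity (e_ k *m P3
    - (- (e_ k *m P1 *m P2) + e_ k *m (xi1 *m g)^T *m xi2)); first by mx_linear.
by rewrite -E subrr.
Qed.

(** Up to terms killed by W, P3 is both P2 P1 and - P1 P2; as W commutes with
    P1, the trace is its own opposite. *)
Lemma weyl_trace0 i j : \tr (W i j *m P3) = 0.
Proof.
have W0 xi P : sasakian_pair xi P -> W i j *m (xi *m g)^T = 0.
  by move=> S; exact: (W_dual gT weyl_skew (sas_xi_weyl S) i j).
apply: dbl0.
have E21 : W i j *m P3 = W i j *m (P2 *m P1).
  by rewrite prod21 mulmxDr mulmxA (W0 _ _ S2) mul0mx addr0.
have E12 : W i j *m P3 = - (W i j *m (P1 *m P2)).
  by rewrite prod12 mulmxDr mulmxA (W0 _ _ S1) mul0mx addr0 mulmxN opprK.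
rewrite {1}E21 E12 [X in _ + X]linearN /= mulmxA mxtrace_mulC !mulmxA.
by rewrite (sas_P_weyl S1) subrr.
Qed.
End Two.

Variables (xi1 xi2 xi3 : 'rV[K]_n) (P1 P2 P3 : 'M[K]_n).

Record three_sasakian_tensors : Prop := ThreeSasakianTensors {
  tri_pair1 : sasakian_pair xi1 P1 ;
  tri_pair2 : sasakian_pair xi2 P2 ;
  tri_pair3 : sasakian_pair xi3 P3 ;
  tri_ortho12 : xi1 *m g *m xi2^T = 0 ;
  tri_ortho23 : xi2 *m g *m xi3^T = 0 ;
  tri_ortho31 : xi3 *m g *m xi1^T = 0 ;
  tri_bracket12 : xi2 *m P1 - xi1 *m P2 = xi3 + xi3 ;
  tri_bracket23 : xi3 *m P2 - xi2 *m P3 = xi1 + xi1 ;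
  tri_bracket31 : xi1 *m P3 - xi3 *m P1 = xi2 + xi2 }.

Hypothesis tri : three_sasakian_tensors.

(** Conjugation by each P_a changes the sign of the contraction, while
    conjugation by P3 is conjugation by P2 and by P1 in turn. *)
Theorem weyl_ricci_flat : trace_form W = 0.
Proof.
case: tri => S1 S2 S3 o12 o23 o31 b12 b23 b31.
have c1 : P1 *m trace_form W *m P1^T = - trace_form W.
  exact: (trace_form_complex dbl0 gT ggi weylN weyl_cyc weyl_skew (sas_PP S1)
    (sas_xi_weyl S1) (sas_P_weyl S1) (weyl_trace0 S2 S3 S1 o23 b23)).
have c2 : P2 *m trace_form W *m P2^T = - trace_form W.
  exact: (trace_form_complex dbl0 gT ggi weylN weyl_cyc weyl_skew (sas_PP S2)
    (sas_xi_weyl S2) (sas_P_weyl S2) (weyl_trace0 S3 S1 S2 o31 b31)).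
have c3 : P3 *m trace_form W *m P3^T = - trace_form W.
  exact: (trace_form_complex dbl0 gT ggi weylN weyl_cyc weyl_skew (sas_PP S3)
    (sas_xi_weyl S3) (sas_P_weyl S3) (weyl_trace0 S1 S2 S3 o12 b12)).
have rT : (trace_form W)^T = trace_form W.
  exact: (trace_formT dbl0 gT ggi weylN weyl_cyc weyl_skew).
have rxi : trace_form W *m xi1^T = 0.
  apply/matrixP => j k; rewrite mxE zeromxE.
  have E q : trace_form W j q * xi1^T q k = \sum_l xi1 k q * W l j q l.
    by rewrite [trace_form _ _ _]mxE [_^T _ _]mxE -mulr_sumr mulrC.
  rewrite (eq_bigr _ (fun q _ => E q)) exchange_big big1 //= => l _.
  by have /matrixP/(_ k l) := sas_xi_weyl S1 l j; rewrite zeromxE mxE.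
have xir : xi1 *m trace_form W = 0 by rewrite -rT -[LHS]trmxK trmx_mul trmxK rxi trmx0.
apply: dbl0_mx => //; rewrite -{1}[trace_form W]opprK -{1}c3.
have -> : P3 = P2 *m P1 - (xi2 *m g)^T *m xi1.
  by rewrite (prod21 S1 S2 S3 o12 b12) addrK.
have E1 : (P2 *m P1 - (xi2 *m g)^T *m xi1) *m trace_form W =
    P2 *m P1 *m trace_form W.
  by rewrite mulmxBl -(mulmxA (xi2 *m g)^T) xir mulmx0 subr0.
have E2 : trace_form W *m (P2 *m P1 - (xi2 *m g)^T *m xi1)^T =
    trace_form W *m P1^T *m P2^T.
  by rewrite addmxT oppmxT !trmx_mul mulmxBr !mulmxA rxi !mul0mx subr0.
have E3 : P1 *m (trace_form W *m (P1^T *m P2^T)) =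
    P1 *m trace_form W *m P1^T *m P2^T by rewrite !mulmxA.
rewrite E1 -mulmxA E2 -!mulmxA E3 c1 mulNmx mulmxN mulmxA c2.
by rewrite opprK addNr.
Qed.

Theorem three_sasakian_einstein : ricci_of d G = (n%:R - 1) *: g.
Proof.
apply/matrixP => j k; rewrite scalemxE.
have /matrixP/(_ j k) := weyl_ricci_flat; rewrite zeromxE [trace_form _ _ _]mxE => W0.
rewrite [ricci_of _ _ _ _]mxE.
transitivity (\sum_l W l j k l + \sum_l R0 l j k l).
  by rewrite -big_split /=; apply: eq_bigr => l _; rewrite -addmxE /weyl_part subrK.
rewrite W0 add0r.
have gs : g k j = g j k by rewrite -{1}gT mxE.
have E l : R0 l j k l = g j k - (if l == j then g j k else 0).
  rewrite /R0 addmxE oppmxE !mxE !big_ord1 !mxE eqxx /=.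
  by case: eqP => [->|_]; rewrite ?mulr1 ?mulr0.
rewrite (eq_bigr _ (fun l _ => E l)) sumrB -big_mkcond big_pred1_eq.
by rewrite sumr_const card_ord mulrBl mul1r mulr_natl.
Qed.
End ThreeSasakian.

(** * The Ricci tensor of a deformed three-Sasakian metric *)

Section Deformation.
Variables (K : comNzRingType) (n : nat) (d : 'I_n -> {additive K -> K}).
Hypothesis dM : forall k x y, d k (x * y) = d k x * y + x * d k y.
Variable G : 'I_n -> 'M[K]_n.
Hypothesis Gsym : forall i j, row i (G j) = row j (G i).
Local Notation e_ k := (delta_mx (0 : 'I_1) k : 'rV[K]_n).
Local Notation nv := (nabla_vec d G).
Local Notation nc := (nabla_cov d G).
Local Notation ne := (nabla_end d G).

(** Meant for Q l = nabla_l P, the covariant derivatives of a fixed P. *)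
Definition divergence (Q : 'I_n -> 'M[K]_n) (j : 'I_n) : K := \sum_l Q l j l.

Section OneTerm.
Variables (eta : 'rV[K]_n) (Q : 'M[K]_n).

(** The (1, 2)-tensor eta(X) Q(Y) + eta(Y) Q(X), as an endomorphism for each
    X = d_k. *)
Definition sym_tensor k : 'M[K]_n := eta^T *m row k Q + eta 0 k *: Q.

Lemma sym_tensor_sym i j : row i (sym_tensor j) = row j (sym_tensor i).
Proof.
apply/matrixP => a b; rewrite !mxE !big_ord1 !mxE ord1; ring.
Qed.

Definition nabla_sym i j : 'M[K]_n :=
  (nc i eta)^T *m row j Q + eta^T *m row j (ne i Q)
  + (nc i eta 0 j *: Q + eta 0 j *: ne i Q).

(** The part of the derivative of [sym_tensor] that comes from differentiating
    the coordinate field d_j itself.  Being symmetric in i and j, it cancels in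
    the curvature. *)
Definition sym_rest i j : 'M[K]_n :=
  eta^T *m row j (G i *m Q) + (eta *m (G i)^T) 0 j *: Q.

Lemma sym_rest_sym i j : sym_rest i j = sym_rest j i.
Proof.
congr (_ + _); first by rewrite !row_mul Gsym.
congr (_ *: _); rewrite !mxE; apply: eq_bigr => l _.
by have /matrixP/(_ 0 l) := Gsym i j; rewrite !mxE => ->.
Qed.

Lemma nabla_sym_tensor i j :
  ne i (sym_tensor j) = nabla_sym i j + sym_rest i j.
Proof.
have dd : d i (eta 0 j) = nc i eta 0 j + (eta *m (G i)^T) 0 j.
  by rewrite /nabla_cov -addmxE subrK mxE.
rewrite /sym_tensor /nabla_sym /sym_rest nabla_endD /= nabla_outer //.
rewrite /nabla_vec rowE dmxM // dmx_delta // mul0mx add0r.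
have -> : ne i (eta 0 j *: Q) = d i (eta 0 j) *: Q + eta 0 j *: ne i Q.
  by rewrite /nabla_end dmxZ // -scalemxAl -scalemxAr; mx_linear.
rewrite dd !rowE /nabla_end; mx_expand.
mx_linear.
Qed.

Hypotheses (Qeta : Q *m eta^T = 0) (trQ : \tr Q = 0).

(** Since Q is trace free and kills eta, neither the tensor nor its derivative
    contributes a full trace to the Ricci tensor; what remains is a divergence
    and the quadratic terms. *)
Lemma sym_tensor_trace m : \sum_l sym_tensor l m l = 0.
Proof.
have E l : sym_tensor l m l = eta 0 m * Q l l + Q m l * eta^T l 0.
  by rewrite !mxE big_ord1 !mxE [_ * Q m l]mulrC.
rewrite (eq_bigr _ (fun l _ => E l)) big_split /= -mulr_sumr.
have -> : \sum_l Q l l = 0 by exact: trQ.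
by have /matrixP/(_ m 0) := Qeta; rewrite mxE zeromxE => ->; rewrite mulr0 addr0.
Qed.

Lemma nabla_sym_trace j k : \sum_l nabla_sym j l k l = 0.
Proof.
have E l : nabla_sym j l k l =
    (nc j eta 0 k * Q l l + eta 0 k * ne j Q l l)
    + (Q k l * (nc j eta)^T l 0 + ne j Q k l * eta^T l 0).
  rewrite /nabla_sym; move: (nc j eta) (ne j Q) => a b.
  by rewrite !mxE !big_ord1 !mxE; ring.
rewrite (eq_bigr _ (fun l _ => E l)) !big_split /= -!mulr_sumr.
have -> : \sum_l Q l l = 0 by exact: trQ.
have -> : \sum_l ne j Q l l = 0.
  transitivity (\tr (ne j Q)) => //.
  rewrite /nabla_end linearD linearN /= linearD /= [\tr (G j *m Q)]mxtrace_mulC addrK.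
  transitivity (d j (\tr Q)); last by rewrite trQ raddf0.
  by rewrite /mxtrace raddf_sum; apply: eq_bigr => l _; rewrite mxE.
have Z : Q *m (nc j eta)^T + ne j Q *m eta^T = 0.
  have := congr1 (fun M : 'cV_n => dmx d j M) Qeta; rewrite dmxM // dmx0 dmxT => E0.
  transitivity (dmx d j Q *m eta^T + Q *m (dmx d j eta)^T
     - G j *m (Q *m eta^T)); last by rewrite E0 Qeta mulmx0 subrr.
  rewrite /nabla_cov /nabla_end addmxT oppmxT trmx_mul trmxK; mx_expand; mx_linear.
have /matrixP/(_ k 0) := Z; rewrite addmxE zeromxE !mxE => ->.
by rewrite !mulr0 !addr0.
Qed.

Lemma nabla_sym_div (A : 'M[K]_n) j k : (forall l, nc l eta = - row l A) ->
  \sum_l nabla_sym l j k l =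
    eta 0 k * divergence (fun l => ne l Q) j + eta 0 j * divergence (fun l => ne l Q) k
    - (Q *m A) j k - (Q *m A) k j.
Proof.
move=> nA.
have E l : nabla_sym l j k l =
    (eta 0 k * ne l Q j l + eta 0 j * ne l Q k l) - Q j l * A l k - Q k l * A l j.
  rewrite /nabla_sym nA; move: (ne l Q) => b.
  by rewrite !mxE !big_ord1 !mxE; ring.
rewrite (eq_bigr _ (fun l _ => E l)) !sumrB big_split /= -!mulr_sumr.
by rewrite ![(_ *m _) _ _]mxE.
Qed.

End OneTerm.

Lemma sym_tensor_tr_mul a Qa b Qb k j :
  \tr (sym_tensor a Qa k *m sym_tensor b Qb j) =
    (Qa *m b^T) k 0 * (Qb *m a^T) j 0 + b 0 j * (Qa *m (Qb *m a^T)) k 0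
    + a 0 k * (Qb *m (Qa *m b^T)) j 0 + a 0 k * b 0 j * \tr (Qa *m Qb).
Proof.
rewrite /sym_tensor mulmxDl !mulmxDr !linearD /=.
have rowk (M : 'M[K]_n) (u : 'rV[K]_n) i : (row i M *m u^T) 0 0 = (M *m u^T) i 0.
  by rewrite -row_mul mxE.
have outer (u v : 'rV[K]_n) : \tr (u^T *m v) = (v *m u^T) 0 0.
  by rewrite mxtrace_mulC /mxtrace big_ord1.
have rowM (M N : 'M[K]_n) i : row i M *m N = row i (M *m N) by rewrite row_mul.
have -> : \tr (a^T *m row k Qa *m (b^T *m row j Qb)) =
    (Qa *m b^T) k 0 * (Qb *m a^T) j 0.
  rewrite -[_ *m (b^T *m _)]mulmxA [row k Qa *m _]mulmxA.
  rewrite [row k Qa *m b^T]mx11_scalar mul_scalar_mx -scalemxAr linearZ /=.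
  by rewrite outer !rowk.
have -> : \tr (a^T *m row k Qa *m (b 0 j *: Qb)) =
    b 0 j * (Qa *m (Qb *m a^T)) k 0.
  by rewrite -scalemxAr linearZ /= -mulmxA rowM outer rowk mulmxA.
have -> : \tr (a 0 k *: Qa *m (b^T *m row j Qb)) =
    a 0 k * (Qb *m (Qa *m b^T)) j 0.
  rewrite -scalemxAl linearZ /= mxtrace_mulC -mulmxA rowM outer rowk.
  by rewrite mulmxA.
rewrite -scalemxAl -scalemxAr !linearZ /=.
ring.
Qed.

End Deformation.

Section SasakianDeformation.
Variables (K : comNzRingType) (n : nat) (d : 'I_n -> {additive K -> K}).
Hypothesis dM : forall k x y, d k (x * y) = d k x * y + x * d k y.
Hypothesis dC : forall j k x, d j (d k x) = d k (d j x).
Hypothesis dbl0 : forall x : K, x + x = 0 -> x = 0.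
Variables (g gi : 'M[K]_n) (G : 'I_n -> 'M[K]_n).
Hypotheses (gT : g^T = g) (ggi : g *m gi = 1%:M).
Hypothesis Gsym : forall i j, row i (G j) = row j (G i).
Hypothesis Gg : forall k, dmx d k g = G k *m g + g *m (G k)^T.

Local Notation e_ k := (delta_mx (0 : 'I_1) k : 'rV[K]_n).
Local Notation nv := (nabla_vec d G).
Local Notation nc := (nabla_cov d G).
Local Notation ne := (nabla_end d G).
Local Notation tri := (three_sasakian_tensors d g G).

(** Thanks to this cyclic symmetry, relations are only proved for the first of
    the three fields. *)
Lemma tri_rot xi1 xi2 xi3 P1 P2 P3 :
  tri xi1 xi2 xi3 P1 P2 P3 -> tri xi2 xi3 xi1 P2 P3 P1.
Proof. by case=> *; split. Qed.

(** The inverse of the deformed metric, with one index lowered by the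
    undeformed one. *)
Definition raising (ci m1 m2 m3 : K) (xi1 xi2 xi3 : 'rV[K]_n) : 'M[K]_n :=
  ci%:M + (m1 *: ((xi1 *m g)^T *m xi1) + m2 *: ((xi2 *m g)^T *m xi2)
    + m3 *: ((xi3 *m g)^T *m xi3)).

Lemma raising_rot ci m1 m2 m3 xi1 xi2 xi3 :
  raising ci m1 m2 m3 xi1 xi2 xi3 = raising ci m2 m3 m1 xi2 xi3 xi1.
Proof. by rewrite /raising; mx_linear. Qed.

Definition deformed (c k1 k2 k3 : K) (xi1 xi2 xi3 : 'rV[K]_n) : 'M[K]_n :=
  c *: g + (k1 *: ((xi1 *m g)^T *m (xi1 *m g))
    + k2 *: ((xi2 *m g)^T *m (xi2 *m g)) + k3 *: ((xi3 *m g)^T *m (xi3 *m g))).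

Section Tri.
Variables (xi1 xi2 xi3 : 'rV[K]_n) (P1 P2 P3 : 'M[K]_n).
Hypothesis T : tri xi1 xi2 xi3 P1 P2 P3.
Local Notation eta1 := (xi1 *m g).
Local Notation eta2 := (xi2 *m g).
Local Notation eta3 := (xi3 *m g).

Let S1 := tri_pair1 T.
Let S2 := tri_pair2 T.
Let S3 := tri_pair3 T.

Lemma tri11 : xi1 *m eta1^T = 1%:M.
Proof. by rewrite dualT // mulmxA (sas_unit S1). Qed.
Lemma tri12 : xi1 *m eta2^T = 0.
Proof. exact: (ortho12 gT (tri_ortho12 T)). Qed.
Lemma tri13 : xi1 *m eta3^T = 0.
Proof. exact: (ortho21 gT (tri_ortho31 T)). Qed.
Lemma tri_xi1P1 : xi1 *m P1 = 0.
Proof. exact: (sas_xiP dM dbl0 gT ggi Gg S1). Qed.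
Lemma tri_xi2P1 : xi2 *m P1 = xi3.
Proof. exact: (cross21 dM dbl0 gT ggi Gg S1 S2 (tri_ortho12 T) (tri_bracket12 T)). Qed.
Lemma tri_xi3P1 : xi3 *m P1 = - xi2.
Proof. exact: (cross12 dM dbl0 gT ggi Gg S3 S1 (tri_ortho31 T) (tri_bracket31 T)). Qed.
Lemma tri_P1eta1 : P1 *m eta1^T = 0.
Proof. exact: (sas_P_dual dM dbl0 gT Gg S1). Qed.
Lemma tri_P1eta2 : P1 *m eta2^T = - eta3^T.
Proof. exact: (cross_dual12 dM dbl0 gT ggi Gg S1 S2 (tri_ortho12 T) (tri_bracket12 T)). Qed.
Lemma tri_P1eta3 : P1 *m eta3^T = eta2^T.
Proof. exact: (cross_dual21 dM dbl0 gT ggi Gg S3 S1 (tri_ortho31 T) (tri_bracket31 T)). Qed.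
Lemma tri_P1P1 : P1 *m P1 = eta1^T *m xi1 - 1%:M.
Proof. exact: (sas_PP dM dbl0 gT ggi Gg S1). Qed.
Lemma tri_P1P2 : P1 *m P2 = - P3 + eta1^T *m xi2.
Proof. exact: (prod12 dM dbl0 gT ggi Gg S1 S2 S3 (tri_ortho12 T) (tri_bracket12 T)). Qed.
Lemma tri_trP1 : \tr P1 = 0.
Proof. exact: (skew_tr0 dbl0 gT ggi (sas_skew S1)). Qed.

End Tri.

Lemma tr_outer (u v : 'rV[K]_n) : \tr (u^T *m v) = (v *m u^T) 0 0.
Proof. by rewrite mxtrace_mulC /mxtrace big_ord1. Qed.

Lemma mxtraceB (A B : 'M[K]_n) : \tr (A - B) = \tr A - \tr B.
Proof. exact: linearB. Qed.

Lemma divergenceD (A B : 'I_n -> 'M[K]_n) j :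
  divergence (fun l => A l + B l) j = divergence A j + divergence B j.
Proof. by rewrite -big_split; apply: eq_bigr => l _; rewrite addmxE. Qed.

Lemma divergenceZ c (A : 'I_n -> 'M[K]_n) j :
  divergence (fun l => c *: A l) j = c * divergence A j.
Proof. by rewrite mulr_sumr; apply: eq_bigr => l _; rewrite scalemxE. Qed.

Lemma eq_divergence (A B : 'I_n -> 'M[K]_n) j :
  (forall l, A l = B l) -> divergence A j = divergence B j.
Proof. by move=> E; apply: eq_bigr => l _; rewrite E. Qed.

Lemma divergence_sas xi P j : sasakian_pair d g G xi P ->
  divergence (fun l => ne l P) j = (1 - n%:R) * (xi *m g) 0 j.
Proof.
move=> S; rewrite /divergence.
have E l : ne l P j l = xi 0 l * g l j - (xi *m g) 0 j.
  rewrite (sas_end S) addmxE oppmxE; move: (xi *m g) => eta.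
  by rewrite !mxE !big_ord1 !mxE !eqxx /= mulr1 mulrC.
rewrite (eq_bigr _ (fun l _ => E l)) sumrB sumr_const card_ord.
by rewrite mulrBl mul1r mulr_natl [in RHS]mxE {1}mxE.
Qed.

Lemma divergence_outer a A b B j : \tr B = 0 ->
  (forall l, nc l a = - row l A) -> (forall l, nv l b = - row l B) ->
  divergence (fun l => ne l (a^T *m b)) j = - (b *m A) 0 j.
Proof.
move=> tB na nb; rewrite /divergence.
have E l : ne l (a^T *m b) j l = - (b 0 l * A l j) - a 0 j * B l l.
  by rewrite nabla_outer // na nb addmxE !mxE !big_ord1 !mxE; ring.
rewrite (eq_bigr _ (fun l _ => E l)) sumrB -mulr_sumr sumrN.
by rewrite [X in _ * X](_ : _ = 0) ?mulr0 ?subr0 // mxE.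
Qed.

Lemma nc_dual xi P : sasakian_pair d g G xi P ->
  forall k, nc k (xi *m g) = - row k (P *m g).
Proof. by move=> S k; rewrite (sas_covE dM Gg S) rowE mulmxA. Qed.

Lemma curvature_shift (S : 'I_n -> 'M[K]_n) i j :
  curvature d (fun k => G k - S k) i j =
  curvature d G i j - (ne i (S j) - ne j (S i)) + (S j *m S i - S i *m S j).
Proof.
by rewrite /curvature /nabla_end !dmxB; mx_expand; mx_linear.
Qed.

Section Raised.
Variables (xi1 xi2 xi3 : 'rV[K]_n) (P1 P2 P3 : 'M[K]_n).
Hypothesis T : tri xi1 xi2 xi3 P1 P2 P3.
Local Notation eta1 := (xi1 *m g).
Local Notation eta2 := (xi2 *m g).
Local Notation eta3 := (xi3 *m g).
Let T' := tri_rot T.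
Let T'' := tri_rot T'.

Variables (ci m1 m2 m3 : K).
Hypotheses (dci : forall k, d k ci = 0) (dm2 : forall k, d k m2 = 0).
Hypothesis dm3 : forall k, d k m3 = 0.
Local Notation L := (raising ci m1 m2 m3 xi1 xi2 xi3).
Local Notation Q1 := (P1 *m L).

Lemma raising_eta1 : L *m eta1^T = (ci + m1) *: eta1^T.
Proof.
rewrite /raising !mulmxDl mul_scalar_mx -!scalemxAl -!mulmxA.
rewrite (tri11 T) mulmx1 (tri13 T') (tri12 T'').
by rewrite !mulmx0 !scaler0 !addr0 scalerDl.
Qed.

(** Within the span of the Reeb fields P1 is a quarter turn exchanging xi2 and
    xi3, hence the crossed coefficients. *)
Lemma Q1_expand :
  Q1 = ci *: P1 - m2 *: (eta3^T *m xi2) + m3 *: (eta2^T *m xi3).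
Proof.
rewrite /raising !mulmxDr mul_mx_scalar -!scalemxAr !mulmxA.
rewrite (tri_P1eta1 T) (tri_P1eta2 T) (tri_P1eta3 T) mul0mx scaler0 add0r mulNmx.
rewrite scalerN; mx_linear.
Qed.

Lemma Q1eta1 : Q1 *m eta1^T = 0.
Proof. by rewrite -mulmxA raising_eta1 -scalemxAr (tri_P1eta1 T) scaler0. Qed.

Lemma Q1P1 : Q1 *m P1 = ci *: (eta1^T *m xi1 - 1%:M)
  - m2 *: (eta3^T *m xi3) - m3 *: (eta2^T *m xi2).
Proof.
rewrite Q1_expand !mulmxDl mulNmx -!scalemxAl -!mulmxA (tri_P1P1 T).
by rewrite (tri_xi2P1 T) (tri_xi3P1 T) mulmxN scalerN.
Qed.

Lemma trQ1 : \tr Q1 = 0.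
Proof.
rewrite Q1_expand !linearD linearN /= !linearZ /= !tr_outer (tri_trP1 T).
by rewrite (tri12 T') (tri13 T'') mxE !mulr0 subr0 addr0.
Qed.

Lemma div_Q1 j : divergence (fun l => ne l Q1) j =
  - ((n%:R - 1) * ci + m2 + m3) * eta1 0 j.
Proof.
rewrite Q1_expand.
have E l : ne l (ci *: P1 - m2 *: (eta3^T *m xi2) + m3 *: (eta2^T *m xi3)) =
   ci *: ne l P1 + (- m2) *: ne l (eta3^T *m xi2) + m3 *: ne l (eta2^T *m xi3).
  by rewrite !nabla_endD -scaleNr !nabla_endZ // raddfN dm2 oppr0.
rewrite (eq_divergence _ E) !divergenceD !divergenceZ (divergence_sas _ (tri_pair1 T)).
rewrite (divergence_outer (B := P2) _ _ (nc_dual (tri_pair3 T))) //; last 2 first.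
- exact: tri_trP1 T'.
- exact: sas_vec (tri_pair2 T).
rewrite (divergence_outer (B := P3) _ _ (nc_dual (tri_pair2 T))) //; last 2 first.
- exact: tri_trP1 T''.
- exact: sas_vec (tri_pair3 T).
rewrite !mulmxA (tri_xi3P1 T'') (tri_xi2P1 T') mulNmx oppmxE.
ring.
Qed.

End Raised.

Section RaisedPairs.
Variables (xi1 xi2 xi3 : 'rV[K]_n) (P1 P2 P3 : 'M[K]_n).
Hypothesis T : tri xi1 xi2 xi3 P1 P2 P3.
Local Notation eta1 := (xi1 *m g).
Local Notation eta2 := (xi2 *m g).
Local Notation eta3 := (xi3 *m g).
Let T' := tri_rot T.
Let T'' := tri_rot T'.
Variables (ci m1 m2 m3 : K).
Local Notation L := (raising ci m1 m2 m3 xi1 xi2 xi3).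
Local Notation Q1 := (P1 *m L).
Local Notation Q2 := (P2 *m L).

Lemma Q1eta2 : Q1 *m eta2^T = - ((ci + m2) *: eta3^T).
Proof.
rewrite -mulmxA raising_rot (raising_eta1 T') -scalemxAr (tri_P1eta2 T).
by rewrite scalerN.
Qed.

Lemma Q1eta3 : Q1 *m eta3^T = (ci + m3) *: eta2^T.
Proof.
by rewrite -mulmxA raising_rot raising_rot (raising_eta1 T'') -scalemxAr
  (tri_P1eta3 T).
Qed.

Lemma trQ1Q1 : \tr (Q1 *m Q1) =
  ci ^+ 2 * (3%:R - n%:R) - 2%:R * (ci + m2) * (ci + m3).
Proof.
rewrite {1}(Q1_expand T) !mulmxDl mulNmx -!scalemxAl -!mulmxA.
have E23 : \tr (eta3^T *m (xi2 *m Q1)) = ci + m3.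
  by rewrite tr_outer -mulmxA Q1eta3 -scalemxAr (tri11 T') !mxE mulr1.
have E32 : \tr (eta2^T *m (xi3 *m Q1)) = - (ci + m2).
  rewrite tr_outer -mulmxA Q1eta2 mulmxN -scalemxAr (tri11 T'') oppmxE.
  by rewrite !mxE mulr1.
have EP : \tr (P1 *m Q1) = ci * (1 - n%:R) - m2 - m3.
  rewrite mxtrace_mulC (Q1P1 T) !mxtraceB !mxtraceZ mxtraceB mxtrace1.
  by rewrite !tr_outer (tri11 T) (tri11 T') (tri11 T'') !mxE !mulr1.
rewrite mxtraceD mxtraceB !mxtraceZ E23 E32 EP.
ring.
Qed.

Lemma trQ1Q2 : \tr (Q1 *m Q2) = 0.
Proof.
rewrite {1}(Q1_expand T) !mulmxDl mulNmx -!scalemxAl -!mulmxA.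
have E2 : xi2 *m Q2 = 0 by rewrite mulmxA (tri_xi1P1 T') mul0mx.
have E3 : \tr (eta2^T *m (xi3 *m Q2)) = 0.
  by rewrite tr_outer -mulmxA raising_rot (Q1eta1 T') mulmx0 mxE.
have EP : \tr (P1 *m Q2) = 0.
  rewrite raising_rot (Q1_expand T') mulmxDr mulmxDr mulmxN -!scalemxAr !mulmxA.
  rewrite (tri_P1eta1 T) (tri_P1eta3 T) (tri_P1P2 T) mul0mx scaler0 subr0.
  rewrite mxtraceD !mxtraceZ mxtraceD linearN /= !tr_outer (tri12 T) (tri_trP1 T'').
  by rewrite (tri13 T') mxE oppr0 !(mulr0, addr0).
by rewrite E2 mulmx0 scaler0 subr0 mxtraceD !mxtraceZ E3 EP !mulr0 addr0.
Qed.

Lemma cV_opp_row (v : 'rV[K]_n) c k : (- (c *: v^T)) k 0 = - (c * v 0 k).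
Proof. by rewrite !mxE. Qed.

Lemma cV_row (v : 'rV[K]_n) c k : (c *: v^T) k 0 = c * v 0 k.
Proof. by rewrite !mxE. Qed.

Lemma tr_sym_tensor_off k j :
  \tr (sym_tensor eta1 Q1 k *m sym_tensor eta2 Q2 j) =
    (ci + m1) * (ci + m3) * (eta2 0 k * eta2 0 j)
    + (ci + m2) * (ci + m3) * (eta1 0 k * eta1 0 j)
    - (ci + m1) * (ci + m2) * (eta3 0 k * eta3 0 j).
Proof.
have E21 : Q2 *m eta1^T = (ci + m1) *: eta3^T.
  rewrite -mulmxA (raising_eta1 T) -scalemxAr.
  by rewrite (tri_P1eta3 T').
have E23 : Q2 *m eta3^T = - ((ci + m3) *: eta1^T).
  by rewrite -mulmxA raising_rot raising_rot (raising_eta1 T'') -scalemxAr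
    (tri_P1eta2 T') scalerN.
rewrite sym_tensor_tr_mul trQ1Q2 E21 Q1eta2 mulmxN -!scalemxAr E23 Q1eta3.
rewrite scalerN opprK !scalerA !cV_opp_row !cV_row.
ring.
Qed.

Lemma tr_sym_tensor_diag k j :
  \tr (sym_tensor eta1 Q1 k *m sym_tensor eta1 Q1 j) =
  (ci ^+ 2 * (3%:R - n%:R) - 2%:R * (ci + m2) * (ci + m3)) * (eta1 0 k * eta1 0 j).
Proof.
rewrite sym_tensor_tr_mul trQ1Q1 (Q1eta1 T) mulmx0 !mxE.
ring.
Qed.

Lemma nabla_sym_div1 j k :
  (forall k, d k ci = 0) -> (forall k, d k m2 = 0) -> (forall k, d k m3 = 0) ->
  \sum_l nabla_sym d G eta1 Q1 l j k l =
    - (2%:R * (n%:R * ci + m2 + m3)) * (eta1 0 k * eta1 0 j)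
    + 2%:R * ci * g k j
    + 2%:R * m3 * (eta2 0 k * eta2 0 j) + 2%:R * m2 * (eta3 0 k * eta3 0 j).
Proof.
move=> dci dm2 dm3.
rewrite (nabla_sym_div _ _ _ (nc_dual (tri_pair1 T))) !(div_Q1 T) // mulmxA (Q1P1 T).
have E a b : ((ci *: (eta1^T *m xi1 - 1%:M) - m2 *: (eta3^T *m xi3)
    - m3 *: (eta2^T *m xi2)) *m g) a b = ci * (eta1 0 a * eta1 0 b - g a b)
    - m2 * (eta3 0 a * eta3 0 b) - m3 * (eta2 0 a * eta2 0 b).
  rewrite !mulmxBl -!scalemxAl mulmxBl mul1mx -!mulmxA.
  move: (eta1) (eta2) (eta3) => u v w.
  by rewrite !mxE !big_ord1 !mxE.
rewrite !E; have -> : g j k = g k j by rewrite -{1}gT mxE.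
ring.
Qed.

End RaisedPairs.

Section NewMetric.
Variables (xi1 xi2 xi3 : 'rV[K]_n) (P1 P2 P3 : 'M[K]_n).
Hypothesis T : tri xi1 xi2 xi3 P1 P2 P3.
Local Notation eta1 := (xi1 *m g).
Local Notation eta2 := (xi2 *m g).
Local Notation eta3 := (xi3 *m g).
Let T' := tri_rot T.
Let T'' := tri_rot T'.
Variables (c k1 k2 k3 ci l1 l2 l3 : K).
Hypotheses (dc : forall k, d k c = 0) (dci : forall k, d k ci = 0).
Hypotheses (dk1 : forall k, d k k1 = 0) (dk2 : forall k, d k k2 = 0).
Hypothesis dk3 : forall k, d k k3 = 0.
Hypotheses (dl1 : forall k, d k l1 = 0) (dl2 : forall k, d k l2 = 0).
Hypothesis dl3 : forall k, d k l3 = 0.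
Hypotheses (cK : c * ci = 1) (l1K : (c + k1) * l1 = 1).
Hypotheses (l2K : (c + k2) * l2 = 1) (l3K : (c + k3) * l3 = 1).
Local Notation L := (raising ci (l1 - ci) (l2 - ci) (l3 - ci) xi1 xi2 xi3).
Local Notation g' := (deformed c k1 k2 k3 xi1 xi2 xi3).

Lemma raising_deformed : L *m g' = g.
Proof.
have E (xi : 'rV[K]_n) (a b s : K) : L *m (xi *m g)^T = s *: (xi *m g)^T -> a * s = b ->
    L *m (a *: ((xi *m g)^T *m (xi *m g))) = b *: ((xi *m g)^T *m (xi *m g)).
  by move=> E <-; rewrite -scalemxAr [L *m (_ *m _)]mulmxA E -scalemxAl scalerA.
rewrite /deformed !mulmxDr.
rewrite (E xi1 k1 (k1 * l1) l1) //; last by rewrite (raising_eta1 T) addrC subrK.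
rewrite (E xi2 k2 (k2 * l2) l2) //; last first.
  by rewrite raising_rot (raising_eta1 T') addrC subrK.
rewrite (E xi3 k3 (k3 * l3) l3) //; last first.
  by rewrite raising_rot raising_rot (raising_eta1 T'') addrC subrK.
rewrite -scalemxAr /raising !mulmxDl mul_scalar_mx -!scalemxAl -!mulmxA.
have f k l : (c + k) * l = 1 -> k * l = 1 - c * l by move=> <-; ring.
rewrite (f _ _ l1K) (f _ _ l2K) (f _ _ l3K) !scalerDr !scalerA cK.
rewrite !mulrBr cK; mx_linear.
Qed.

(** Adding k eta^2 to the metric, with eta dual to a Killing field, adds the
    Koszul terms k (eta(X) nabla_Y xi + eta(Y) nabla_X xi), with the index
    raised by the inverse of the deformed metric. *)
Definition deformed_connection k : 'M[K]_n :=
  G k - (k1 *: sym_tensor eta1 (P1 *m L) k + k2 *: sym_tensor eta2 (P2 *m L) k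
         + k3 *: sym_tensor eta3 (P3 *m L) k).
Local Notation G' := deformed_connection.

Lemma deformed_connection_sym i j : row i (G' j) = row j (G' i).
Proof.
have F (et : 'rV[K]_n) (Q : 'M[K]_n) b :
    sym_tensor et Q j i b = sym_tensor et Q i j b.
  by have /matrixP/(_ 0 b) := sym_tensor_sym et Q i j; rewrite [LHS]mxE [RHS]mxE.
have H b : G j i b = G i j b.
  by have /matrixP/(_ 0 b) := Gsym i j; rewrite [LHS]mxE [RHS]mxE.
apply/matrixP => a b; rewrite [LHS]mxE [RHS]mxE /deformed_connection.
move: (F eta1 (P1 *m L) b) (F eta2 (P2 *m L) b) (F eta3 (P3 *m L) b) (H b).
move: (sym_tensor eta1 _) (sym_tensor eta2 _) (sym_tensor eta3 _) => A B C.
by rewrite !(addmxE, oppmxE, scalemxE) => -> -> -> ->.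
Qed.

Lemma sym_tensor_metric xi P k : sasakian_pair d g G xi P ->
  nabla_cov d G k (xi *m g) = - row k (P *m g) ->
  let eta := xi *m g in
  let S := sym_tensor eta (P *m L) k *m g' in
  (nc k eta)^T *m eta + eta^T *m nc k eta = - (S + S^T).
Proof.
move=> SP E eta S.
have ES : S = eta^T *m row k (P *m g) + eta 0 k *: (P *m g).
  rewrite /S /sym_tensor mulmxDl -scalemxAl -!mulmxA raising_deformed.
  by rewrite -row_mul -mulmxA raising_deformed.
have EST : S^T = (row k (P *m g))^T *m eta - eta 0 k *: (P *m g).
  rewrite ES addmxT [(eta^T *m _)^T]trmx_mul trmxK linearZ /= (sas_skewT gT SP).
  by rewrite scalerN.
rewrite EST ES -/eta E oppmxT mulNmx mulmxN.
mx_linear.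
Qed.

(** With [deformed_connection_sym] this shows that the deformed connection is
    the Levi-Civita connection of the deformed metric. *)
Lemma deformed_compat k : dmx d k g' = G' k *m g' + g' *m (G' k)^T.
Proof.
have gT' : g'^T = g'.
  rewrite /deformed !addmxT !linearZ /= gT !trmx_mul !gT !trmxK.
  by rewrite ?mulmxA.
have sq a : dmx d k (a^T *m a) =
    (nc k a)^T *m a + a^T *m nc k a + G k *m (a^T *m a) + a^T *m a *m (G k)^T.
  rewrite dmxM // dmxT /nabla_cov addmxT oppmxT trmx_mul trmxK.
  by mx_expand; mx_linear.
rewrite {1}/deformed !dmxD !dmxZ // dc dk1 dk2 dk3 !scale0r !add0r !sq Gg.
rewrite (sym_tensor_metric (tri_pair1 T)); last exact: nc_dual (tri_pair1 T) k.
rewrite (sym_tensor_metric (tri_pair2 T)); last exact: nc_dual (tri_pair2 T) k.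
rewrite (sym_tensor_metric (tri_pair3 T)); last exact: nc_dual (tri_pair3 T) k.
have GL : G k *m g' = c *: (G k *m g) + (k1 *: (G k *m (eta1^T *m eta1))
    + k2 *: (G k *m (eta2^T *m eta2)) + k3 *: (G k *m (eta3^T *m eta3))).
  by rewrite /deformed !mulmxDr -!scalemxAr.
have GR : g' *m (G k)^T = c *: (g *m (G k)^T) + (k1 *: (eta1^T *m eta1 *m (G k)^T)
    + k2 *: (eta2^T *m eta2 *m (G k)^T) + k3 *: (eta3^T *m eta3 *m (G k)^T)).
  by rewrite /deformed !mulmxDl -!scalemxAl.
rewrite ![(sym_tensor _ _ _ *m g')^T]trmx_mul gT' /deformed_connection.
move: g' (sym_tensor eta1 _ k) (sym_tensor eta2 _ k) (sym_tensor eta3 _ k) GL GR.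
move=> h A B C GL GR.
rewrite mulmxBl !mulmxDl -!scalemxAl GL.
rewrite addmxT oppmxT !addmxT !linearZ /= mulmxBr !mulmxDr -!scalemxAr GR.
mx_linear.
Qed.

Local Notation T1 := (sym_tensor eta1 (P1 *m L)).
Local Notation T2 := (sym_tensor eta2 (P2 *m L)).
Local Notation T3 := (sym_tensor eta3 (P3 *m L)).

Let dm l : (forall k, d k l = 0) -> forall k, d k (l - ci) = 0.
Proof. by move=> dl k; rewrite raddfB dl dci subrr. Qed.

Definition shift k : 'M[K]_n := k1 *: T1 k + k2 *: T2 k + k3 *: T3 k.

Definition nabla_shift i j : 'M[K]_n :=
  k1 *: nabla_sym d G eta1 (P1 *m L) i j + k2 *: nabla_sym d G eta2 (P2 *m L) i j
  + k3 *: nabla_sym d G eta3 (P3 *m L) i j.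

(** The difference tensor enters the curvature through its antisymmetrised
    covariant derivative and its commutator; [sym_rest] drops out. *)
Lemma deformed_curvature i j : curvature d G' i j =
  curvature d G i j - (nabla_shift i j - nabla_shift j i)
  + (shift j *m shift i - shift i *m shift j).
Proof.
have E : curvature d G' i j = curvature d G i j
    - (ne i (shift j) - ne j (shift i)) + (shift j *m shift i - shift i *m shift j).
  exact: (curvature_shift shift).
have N a b : ne a (shift b) = nabla_shift a b +
   (k1 *: sym_rest G eta1 (P1 *m L) a b + k2 *: sym_rest G eta2 (P2 *m L) a b
    + k3 *: sym_rest G eta3 (P3 *m L) a b).
  rewrite /shift /nabla_shift; move: (P1 *m L) (P2 *m L) (P3 *m L) => Q1 Q2 Q3.
  by rewrite !nabla_endD !nabla_endZ // !nabla_sym_tensor //; mx_linear.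
rewrite E !N (sym_rest_sym Gsym eta1 (P1 *m L) j i).
rewrite (sym_rest_sym Gsym eta2 (P2 *m L) j i) (sym_rest_sym Gsym eta3 (P3 *m L) j i).
move: (sym_rest _ _ _ _ _) (sym_rest _ eta2 _ _ _) (sym_rest _ eta3 _ _ _) => A B C.
move: (nabla_shift i j) (nabla_shift j i) (shift j *m _) => X Y Z.
mx_linear.
Qed.

Lemma shift_sym i j : row i (shift j) = row j (shift i).
Proof.
have := deformed_connection_sym i j; rewrite /deformed_connection -/(shift i).
by rewrite -/(shift j) !linearB /= Gsym => /addrI /oppr_inj.
Qed.

Lemma shift_trace m : \sum_l shift l m l = 0.
Proof.
have E l : shift l m l = k1 * T1 l m l + k2 * T2 l m l + k3 * T3 l m l.
  rewrite /shift; move: (T1 l) (T2 l) (T3 l) => A B C.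
  by rewrite !(addmxE, scalemxE).
rewrite (eq_bigr _ (fun l _ => E l)) !big_split /= -!mulr_sumr.
rewrite !sym_tensor_trace ?mulr0 ?addr0 //.
- by rewrite 2!raising_rot (Q1eta1 T'').
- by rewrite 2!raising_rot (trQ1 T'').
- by rewrite raising_rot (Q1eta1 T').
- by rewrite raising_rot (trQ1 T').
- exact: (Q1eta1 T).
- exact: (trQ1 T).
Qed.

Lemma shift_trace_mul j k :
  \sum_l (shift j *m shift l - shift l *m shift j) k l = - \tr (shift k *m shift j).
Proof.
have E l : (shift j *m shift l - shift l *m shift j) k l =
    (shift j *m shift l) k l - (shift l *m shift j) k l.
  by rewrite addmxE oppmxE.
rewrite (eq_bigr _ (fun l _ => E l)) sumrB.
have -> : \sum_l (shift j *m shift l) k l = 0.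
  transitivity (\sum_l \sum_m shift j k m * shift l m l).
    by apply: eq_bigr => l _; rewrite mxE.
  rewrite exchange_big big1 //= => m _.
  by rewrite -mulr_sumr shift_trace mulr0.
rewrite sub0r; congr (- _); apply: eq_bigr => l _; rewrite !mxE.
apply: eq_bigr => m _; congr (_ * _).
by have /matrixP/(_ 0 m) := shift_sym k l; rewrite [LHS]mxE [RHS]mxE.
Qed.

Lemma nabla_shift_trace j k : \sum_l nabla_shift j l k l = 0.
Proof.
have E l : nabla_shift j l k l =
    k1 * nabla_sym d G eta1 (P1 *m L) j l k l
    + k2 * nabla_sym d G eta2 (P2 *m L) j l k l
    + k3 * nabla_sym d G eta3 (P3 *m L) j l k l.
  rewrite /nabla_shift; move: (nabla_sym _ _ eta1 _ _ _) => A.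
  move: (nabla_sym _ _ eta2 _ _ _) (nabla_sym _ _ eta3 _ _ _) => B C.
  by rewrite !(addmxE, scalemxE).
rewrite (eq_bigr _ (fun l _ => E l)) !big_split /= -!mulr_sumr.
rewrite !nabla_sym_trace ?mulr0 ?addr0 //.
- by rewrite 2!raising_rot (Q1eta1 T'').
- by rewrite 2!raising_rot (trQ1 T'').
- by rewrite raising_rot (Q1eta1 T').
- by rewrite raising_rot (trQ1 T').
- exact: (Q1eta1 T).
- exact: (trQ1 T).
Qed.

Let square (eta : 'rV[K]_n) := eta^T *m eta.

(** The coefficient of eta_1^2: k1, k2, k3 are the deformations, ci and
    l1, l2, l3 stand for 1/c and 1/(c + k1), 1/(c + k2), 1/(c + k3).  The other
    two coefficients are obtained by cyclic permutation. *)
Definition ricci_coef (k1 k2 k3 l1 l2 l3 : K) : K :=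
  2%:R * k1 * ((n%:R - 2%:R) * ci + l2 + l3)
  - 2%:R * k2 * (l3 - ci) - 2%:R * k3 * (l2 - ci)
  - (k1 ^+ 2 * (ci ^+ 2 * (3%:R - n%:R) - 2%:R * l2 * l3)
     + 2%:R * (k1 * k2 * l2 * l3 + k1 * k3 * l2 * l3 - k2 * k3 * l2 * l3)).

Theorem deformed_ricci : ricci_of d G' =
  (n%:R - 1 - 2%:R * ci * (k1 + k2 + k3)) *: g
  + (ricci_coef k1 k2 k3 l1 l2 l3 *: square eta1
     + ricci_coef k2 k3 k1 l2 l3 l1 *: square eta2
     + ricci_coef k3 k1 k2 l3 l1 l2 *: square eta3).
Proof.
apply/matrixP => j k.
have sqE (u : 'rV[K]_n) : square u j k = u 0 k * u 0 j.
  by rewrite /square mxE big_ord1 mxE mulrC.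
rewrite !(addmxE, scalemxE) !sqE [ricci_of _ _ _ _]mxE.
have E l : curvature d G' l j k l = curvature d G l j k l
    - (nabla_shift l j k l - nabla_shift j l k l)
    + (shift j *m shift l - shift l *m shift j) k l.
  rewrite deformed_curvature.
  move: (nabla_shift l j) (nabla_shift j l) (shift j *m _ - _) => A B C.
  by move: (curvature d G l j) => D; rewrite !(addmxE, oppmxE).
rewrite (eq_bigr _ (fun l _ => E l)) big_split /= !sumrB shift_trace_mul.
rewrite [\sum_l nabla_shift j l k l](nabla_shift_trace j k).
have -> : \sum_l curvature d G l j k l = (n%:R - 1) * g j k.
  have /matrixP/(_ j k) := three_sasakian_einstein dM dC dbl0 gT ggi Gsym Gg T.
  by rewrite scalemxE [ricci_of _ _ _ _]mxE.
have -> : \sum_l nabla_shift l j k l =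
    k1 * \sum_l nabla_sym d G eta1 (P1 *m L) l j k l
    + k2 * \sum_l nabla_sym d G eta2 (P2 *m L) l j k l
    + k3 * \sum_l nabla_sym d G eta3 (P3 *m L) l j k l.
  rewrite !mulr_sumr -!big_split /=; apply: eq_bigr => l _.
  rewrite /nabla_shift; move: (nabla_sym _ _ eta1 _ _ _) => A.
  move: (nabla_sym _ _ eta2 _ _ _) (nabla_sym _ _ eta3 _ _ _) => B C.
  by rewrite !(addmxE, scalemxE).
have -> : \tr (shift k *m shift j) =
    k1 * (k1 * \tr (T1 k *m T1 j) + k2 * \tr (T1 k *m T2 j) + k3 * \tr (T1 k *m T3 j))
    + k2 * (k1 * \tr (T2 k *m T1 j) + k2 * \tr (T2 k *m T2 j)
            + k3 * \tr (T2 k *m T3 j))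
    + k3 * (k1 * \tr (T3 k *m T1 j) + k2 * \tr (T3 k *m T2 j)
            + k3 * \tr (T3 k *m T3 j)).
  rewrite /shift; move: (T1 k) (T2 k) (T3 k) (T1 j) (T2 j) (T3 j) => A B C A' B' C'.
  rewrite !mulmxDl !mulmxDr !mxtraceD -!scalemxAl -!scalemxAr !mxtraceZ.
  ring.
rewrite [\tr (T2 k *m T1 j)]mxtrace_mulC [\tr (T3 k *m T2 j)]mxtrace_mulC.
rewrite [\tr (T1 k *m T3 j)]mxtrace_mulC.
have R1 : L = raising ci (l2 - ci) (l3 - ci) (l1 - ci) xi2 xi3 xi1.
  by rewrite raising_rot.
have R2 : L = raising ci (l3 - ci) (l1 - ci) (l2 - ci) xi3 xi1 xi2.
  by rewrite raising_rot raising_rot.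
rewrite (nabla_sym_div1 T) //; try exact: dm.
have := nabla_sym_div1 T' (l2 - ci) j k dci (dm dl3) (dm dl1).
rewrite -R1 => ->.
have := nabla_sym_div1 T'' (l3 - ci) j k dci (dm dl1) (dm dl2).
rewrite -R2 => ->.
rewrite (tr_sym_tensor_diag T) (tr_sym_tensor_off T).
have := tr_sym_tensor_diag T' ci (l2 - ci) (l3 - ci) (l1 - ci) k j.
rewrite -R1 => ->.
have := tr_sym_tensor_diag T'' ci (l3 - ci) (l1 - ci) (l2 - ci) k j.
rewrite -R2 => ->.
have := tr_sym_tensor_off T ci (l1 - ci) (l2 - ci) (l3 - ci) j k => ->.
have E23 := tr_sym_tensor_off T' ci (l2 - ci) (l3 - ci) (l1 - ci).
have := E23 k j; rewrite -R1 => ->; have := E23 j k; rewrite -R1 => ->.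
have E31 := tr_sym_tensor_off T'' ci (l3 - ci) (l1 - ci) (l2 - ci).
have := E31 k j; rewrite -R2 => ->; have := E31 j k; rewrite -R2 => ->.
have -> : g j k = g k j by rewrite -{1}gT mxE.
rewrite /ricci_coef.
ring.
Qed.

End NewMetric.
End SasakianDeformation.

(** * The Levi-Civita connection *)

Section LeviCivita.
Variables (K : comNzRingType) (n : nat) (d : 'I_n -> {additive K -> K}).
Variable half : K.
Hypothesis halfK : half + half = 1.
Local Notation e_ k := (delta_mx (0 : 'I_1) k : 'rV[K]_n).

Lemma halfD (x : K) : half * (x + x) = x.
Proof. by rewrite -[RHS]mul1r -halfK; ring. Qed.

Lemma half_dbl0 (x : K) : x + x = 0 -> x = 0.
Proof. by move=> x0; rewrite -(halfD x) x0 mulr0. Qed.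

(** The Christoffel symbols; half stands for 1/2, as the ring has no
    division. *)
Definition levi_civita (g gi : 'M[K]_n) k : 'M[K]_n := \matrix_(j, i)
  (half * \sum_l gi i l * (d k (g j l) + d j (g k l) - d l (g k j))).

Variables (g gi : 'M[K]_n).
Hypotheses (gT : g^T = g) (ggi : g *m gi = 1%:M).
Local Notation G := (levi_civita g gi).

Lemma gsymE i j : g i j = g j i.
Proof. by rewrite -{1}gT mxE. Qed.

Lemma mulg_tr (A : 'M[K]_n) : g *m A^T = (A *m g)^T.
Proof. by rewrite trmx_mul gT. Qed.

Lemma levi_civita_lower k j m :
  (G k *m g) j m = half * (d k (g j m) + d j (g k m) - d m (g k j)).
Proof.
pose b l := d k (g j l) + d j (g k l) - d l (g k j).
have E i : G k j i * g i m = \sum_l half * (b l * (g m i * gi i l)).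
  rewrite /levi_civita mxE (gsymE i m) -mulrA mulr_suml mulr_sumr.
  by apply: eq_bigr => l _; rewrite -/(b l); ring.
rewrite mxE (eq_bigr _ (fun i _ => E i)) exchange_big /=.
have D l : \sum_i g m i * gi i l = (m == l)%:R.
  by have /matrixP/(_ m l) := ggi; rewrite !mxE.
rewrite (eq_bigr (fun l => if l == m then half * b l else 0)); last first.
  move=> l _; rewrite -!mulr_sumr D eq_sym.
  by case: eqP; rewrite ?mulr1 ?mulr0.
by rewrite -big_mkcond big_pred1_eq.
Qed.

Lemma levi_civita_sym i j : row i (G j) = row j (G i).
Proof.
apply/matrixP => a b; rewrite !mxE; congr (_ * _); apply: eq_bigr => l _.
by rewrite (gsymE i j); congr (_ * _); ring.
Qed.

Lemma levi_civita_compat k : dmx d k g = G k *m g + g *m (G k)^T.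
Proof.
rewrite mulg_tr.
apply/matrixP => i j; rewrite addmxE [_^T i j]mxE !levi_civita_lower [LHS]mxE.
rewrite (gsymE j i) -{1}(halfD (d k (g i j))); ring.
Qed.

(** The Koszul argument: the three cyclic permutations of the compatibility
    equation determine the connection. *)
Lemma levi_civita_unique (H : 'I_n -> 'M[K]_n) :
  (forall i j, row i (H j) = row j (H i)) ->
  (forall k, dmx d k g = H k *m g + g *m (H k)^T) -> forall k, H k = G k.
Proof.
move=> Hs Hg k; apply: (mulmxg_inj ggi); apply/matrixP => j m.
rewrite levi_civita_lower.
have dE a b c : d a (g b c) = (H a *m g) b c + (H a *m g) c b.
  have /matrixP/(_ b c) := Hg a; rewrite addmxE mxE => ->.
  by rewrite mulg_tr [_^T b c]mxE.
have sE a b c : (H a *m g) b c = (H b *m g) a c.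
  have /(congr1 (fun r => (r *m g) 0 c)) := Hs b a.
  by rewrite -!row_mul [LHS]mxE [RHS]mxE.
rewrite !dE (sE j k m) (sE m k j) (sE m j k) -[LHS]halfD; ring.
Qed.

Hypothesis dM : forall k x y, d k (x * y) = d k x * y + x * d k y.
Local Notation nv := (nabla_vec d G).

(** The endomorphism X |-> - nabla_X xi. *)
Definition minus_nabla (xi : 'rV[K]_n) : 'M[K]_n := \matrix_(k, i) - nv k xi 0 i.

Lemma row_minus_nabla xi k : nv k xi = - row k (minus_nabla xi).
Proof. by apply/matrixP => a i; rewrite !mxE opprK ord1 ?mxE. Qed.

Definition lie_metric (xi : 'rV[K]_n) : 'M[K]_n := \matrix_(i, j)
  \sum_k (xi 0 k * d k (g i j) + g k j * d i (xi 0 k) + g i k * d j (xi 0 k)).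

Lemma lie_metricE xi :
  minus_nabla xi *m g + (minus_nabla xi *m g)^T = - lie_metric xi.
Proof.
have E i j : (minus_nabla xi *m g) i j = - (\sum_k g k j * d i (xi 0 k)
     + \sum_k xi 0 k * (G k *m g) i j).
  have -> : (minus_nabla xi *m g) i j = - (nv i xi *m g) 0 j.
    by rewrite row_minus_nabla mulNmx oppmxE opprK -row_mul [RHS]mxE.
  rewrite /nabla_vec mulmxDl addmxE; congr (- (_ + _)).
    by rewrite mxE; apply: eq_bigr => k _; rewrite mxE mulrC.
  rewrite -mulmxA mxE; apply: eq_bigr => k _; congr (_ * _).
  have /(congr1 (fun r => (r *m g) 0 j)) := levi_civita_sym k i.
  by rewrite -!row_mul [LHS]mxE [RHS]mxE.
apply/matrixP => i j; rewrite addmxE [_^T i j]mxE oppmxE !E [lie_metric _ _ _]mxE.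
rewrite !big_split /= -!opprD; congr (- _).
have dE k : d k (g i j) = (G k *m g) i j + (G k *m g) j i.
  have /matrixP/(_ i j) := levi_civita_compat k; rewrite addmxE mxE => ->.
  by rewrite mulg_tr [_^T i j]mxE.
have -> : \sum_k xi 0 k * d k (g i j) =
   \sum_k xi 0 k * (G k *m g) i j + \sum_k xi 0 k * (G k *m g) j i.
  by rewrite -big_split; apply: eq_bigr => k _; rewrite dE mulrDr.
have -> : \sum_k g i k * d j (xi 0 k) = \sum_k g k i * d j (xi 0 k).
  by apply: eq_bigr => k _; rewrite gsymE.
ring.
Qed.

Lemma bracket_minus_nabla (u v : 'rV[K]_n) :
  v *m minus_nabla u - u *m minus_nabla v =
  \row_i \sum_j (u 0 j * d j (v 0 i) - v 0 j * d j (u 0 i)).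
Proof.
have E (a b : 'rV[K]_n) i : (a *m minus_nabla b) 0 i =
    - (\sum_j a 0 j * d j (b 0 i) + \sum_j \sum_m a 0 j * b 0 m * G j m i).
  rewrite mxE -big_split -sumrN; apply: eq_bigr => j _.
  rewrite [minus_nabla _ _ _]mxE mulrN /nabla_vec addmxE mxE mulrDr; congr (- (_ + _)).
  by rewrite mxE mulr_sumr; apply: eq_bigr => m _; rewrite mulrA.
apply/matrixP => a i; rewrite ord1 addmxE oppmxE !E [RHS]mxE sumrB.
have -> : \sum_j \sum_m v 0 j * u 0 m * G j m i = \sum_j \sum_m u 0 j * v 0 m * G j m i.
  rewrite exchange_big; apply: eq_bigr => j _; apply: eq_bigr => m _.
  have /matrixP/(_ 0 i) := levi_civita_sym j m.
  by rewrite [LHS]mxE [RHS]mxE => ->; rewrite [v _ _ * _]mulrC.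
ring.
Qed.

End LeviCivita.

Lemma eq_ricci_of (K : comNzRingType) n (d : 'I_n -> {additive K -> K})
    (G H : 'I_n -> 'M[K]_n) :
  (forall k, G k = H k) -> ricci_of d G = ricci_of d H.
Proof.
move=> GH; apply/matrixP => j k; rewrite !mxE; apply: eq_bigr => l _.
by rewrite /curvature !GH.
Qed.

Section DeformedLeviCivita.
Variables (K : comNzRingType) (n : nat) (d : 'I_n -> {additive K -> K}).
Hypothesis dM : forall k x y, d k (x * y) = d k x * y + x * d k y.
Hypothesis dC : forall j k x, d j (d k x) = d k (d j x).
Variable half : K.
Hypothesis halfK : half + half = 1.
Variables (g gi : 'M[K]_n).
Hypotheses (gT : g^T = g) (ggi : g *m gi = 1%:M).
Local Notation LC := (levi_civita d half g gi).
Variables (xi1 xi2 xi3 : 'rV[K]_n) (P1 P2 P3 : 'M[K]_n).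
Hypothesis T : three_sasakian_tensors d g LC xi1 xi2 xi3 P1 P2 P3.
Variables (c k1 k2 k3 ci l1 l2 l3 : K).
Hypotheses (dc : forall k, d k c = 0) (dci : forall k, d k ci = 0).
Hypotheses (dk1 : forall k, d k k1 = 0) (dk2 : forall k, d k k2 = 0).
Hypothesis dk3 : forall k, d k k3 = 0.
Hypotheses (dl1 : forall k, d k l1 = 0) (dl2 : forall k, d k l2 = 0).
Hypothesis dl3 : forall k, d k l3 = 0.
Hypotheses (cK : c * ci = 1) (l1K : (c + k1) * l1 = 1).
Hypotheses (l2K : (c + k2) * l2 = 1) (l3K : (c + k3) * l3 = 1).

Let dbl0 := half_dbl0 halfK.
Let LCs := levi_civita_sym d half gi gT.
Let LCc := levi_civita_compat d halfK gT ggi.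
Local Notation L := (raising g ci (l1 - ci) (l2 - ci) (l3 - ci) xi1 xi2 xi3).
Local Notation g' := (deformed g c k1 k2 k3 xi1 xi2 xi3).

Lemma deformed_inverse : g' *m (gi *m L) = 1%:M.
Proof.
apply: mulmx1C; rewrite -mulmxA.
rewrite (raising_deformed gT T cK l1K l2K l3K).
exact: mulmx1C.
Qed.

Theorem deformed_levi_civita_ricci :
  ricci_of d (levi_civita d half g' (gi *m L)) =
  deformed g (n%:R - 1 - 2%:R * ci * (k1 + k2 + k3))
    (ricci_coef n ci k1 k2 k3 l1 l2 l3) (ricci_coef n ci k2 k3 k1 l2 l3 l1)
    (ricci_coef n ci k3 k1 k2 l3 l1 l2) xi1 xi2 xi3.
Proof.
have g'T : g'^T = g'.
  by rewrite /deformed !addmxT !linearZ /= gT !trmx_mul !trmxK.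
have U := levi_civita_unique halfK g'T deformed_inverse
  (deformed_connection_sym g LCs xi1 xi2 xi3 P1 P2 P3 k1 k2 k3 ci l1 l2 l3)
  (deformed_compat dM gT LCc T dc dk1 dk2 dk3 cK l1K l2K l3K).
rewrite -(eq_ricci_of d U).
exact: (deformed_ricci dM dC dbl0 gT ggi LCs LCc T dci dk1 dk2 dk3 dl1 dl2 dl3).
Qed.

End DeformedLeviCivita.

Section Morphism.
Variables (K K' : comNzRingType) (f : {rmorphism K -> K'}) (n : nat).

Lemma map_deformed (g : 'M[K]_n) c k1 k2 k3 (xi1 xi2 xi3 : 'rV[K]_n) :
  map_mx f (deformed g c k1 k2 k3 xi1 xi2 xi3) =
  deformed (map_mx f g) (f c) (f k1) (f k2) (f k3)
    (map_mx f xi1) (map_mx f xi2) (map_mx f xi3).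
Proof.
have E (xi : 'rV[K]_n) : map_mx f ((xi *m g)^T *m (xi *m g)) =
    (map_mx f xi *m map_mx f g)^T *m (map_mx f xi *m map_mx f g).
  by rewrite map_mxM -map_trmx map_mxM.
by rewrite /deformed !map_mxD !map_mxZ !E.
Qed.

Lemma map_ricci_coef ci k1 k2 k3 l1 l2 l3 :
  f (ricci_coef n ci k1 k2 k3 l1 l2 l3) =
  ricci_coef n (f ci) (f k1) (f k2) (f k3) (f l1) (f l2) (f l3).
Proof.
by rewrite /ricci_coef !(rmorph1, rmorphB, rmorphD, rmorphM, rmorphXn, rmorph_nat).
Qed.

End Morphism.

(** * Symmetry of second derivatives *)

Lemma is_derive_line (R : realType) (V W : normedModType R) (f : V -> W) (y u : V)
    (s : R) (l : W) :
  is_derive (y + s *: u) u f l -> is_derive s 1 (fun r : R => f (y + r *: u)) l.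
Proof.
have E : (fun h : R => h^-1 *: (f (y + (h *: 1 + s) *: u) - f (y + s *: u))) =
    (fun h : R => h^-1 *: (f (h *: u + (y + s *: u)) - f (y + s *: u))).
  apply/funext => h; congr (_ *: (f _ - _)).
  by rewrite scalerDl /GRing.scale/= mulr1 addrCA.
by case=> df dl; split; [rewrite /derivable E|rewrite /derive E].
Qed.

Lemma dist_le_half (R : realFieldType) (e A B q : R) :
  `|A - q| < e / 2 -> `|B - q| < e / 2 -> `|A - B| <= e.
Proof.
move=> L1 L2; rewrite (_ : A - B = (A - q) - (B - q)); last by ring.
by apply: (le_trans (ler_normB _ _)); rewrite (splitr e) lerD // ltW.
Qed.

Section Schwarz.
Variables (R : realType) (n : nat) (U : set 'rV[R]_n).
Hypothesis oU : open U.
Variable f : 'rV[R]_n -> R.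

Lemma derivable_line_continuous (y u : 'rV[R]_n) (g : 'rV[R]_n -> R) (s : R) :
  derivable g (y + s *: u) u -> {for s, continuous (fun r : R => g (y + r *: u))}.
Proof.
move=> /derivableP/is_derive_line [dg _].
exact/differentiable_continuous/derivable1_diffP.
Qed.

(** The mean value theorem, applied in the direction u and then in the
    direction v. *)
Lemma second_difference (x u v : 'rV[R]_n) (h : R) : 0 < h ->
  (forall a b, 0 <= a <= h -> 0 <= b <= h -> derivable f (x + a *: u + b *: v) u) ->
  (forall a b, 0 <= a <= h -> 0 <= b <= h ->
     derivable ('D_u f) (x + a *: u + b *: v) v) ->
  exists a b, [/\ 0 <= a <= h, 0 <= b <= h &
    f (x + h *: u + h *: v) - f (x + h *: u) - f (x + h *: v) + f x =
    h * h * 'D_v ('D_u f) (x + a *: u + b *: v)].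
Proof.
move=> h0 du dvu.
pose phi (r : R) := f ((x + h *: v) + r *: u) - f (x + r *: u).
have hh : 0 <= h <= h by rewrite lexx ltW.
have h00 : 0 <= (0 : R) <= h by apply/andP; split=> //; exact: ltW.
have d1 r : 0 <= r <= h -> derivable f ((x + h *: v) + r *: u) u.
  by move=> rh; rewrite addrAC; apply: du.
have d2 r : 0 <= r <= h -> derivable f (x + r *: u) u.
  by move=> rh; rewrite -[x + _]addr0 -(scale0r v); apply: du.
have [a + Ea] : exists2 a, a \in `]0, h[ & phi h - phi 0 =
    ('D_u f ((x + h *: v) + a *: u) - 'D_u f (x + a *: u)) * (h - 0).
  apply: (@MVT R phi (fun r => 'D_u f ((x + h *: v) + r *: u) - 'D_u f (x + r *: u))).
  - by [].
  - move=> r; rewrite in_itv /= => /andP[r0 rh].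
    have rr : 0 <= r <= h by rewrite !ltW.
    apply: is_deriveB; apply: is_derive_line; apply: derivableP; [exact: d1|exact: d2].
  - apply: continuous_in_subspaceT => r; rewrite inE /= in_itv /= => rr.
    by apply: continuousB; apply: derivable_line_continuous; [exact: d1|exact: d2].
rewrite in_itv /= => /andP[a0 ah]; have aa : 0 <= a <= h by rewrite !ltW.
pose psi (r : R) := 'D_u f ((x + a *: u) + r *: v).
have [b + Eb] : exists2 b, b \in `]0, h[ & psi h - psi 0 =
    'D_v ('D_u f) ((x + a *: u) + b *: v) * (h - 0).
  apply: (@MVT R psi (fun r => 'D_v ('D_u f) ((x + a *: u) + r *: v))).
  - by [].
  - move=> r; rewrite in_itv /= => /andP[r0 rh].
    have rr : 0 <= r <= h by rewrite !ltW.
    exact: (is_derive_line (derivableP (dvu a r aa rr))).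
  - apply: continuous_in_subspaceT => r; rewrite inE /= in_itv /= => rr.
    exact: (derivable_line_continuous (dvu a r aa rr)).
rewrite in_itv /= => /andP[b0 bh].
exists a, b; split => //; first by rewrite !ltW.
have -> : f (x + h *: u + h *: v) - f (x + h *: u) - f (x + h *: v) + f x =
    phi h - phi 0.
  rewrite /phi !scale0r !addr0 (addrAC x); ring.
rewrite Ea addrAC -[x + a *: u in X in _ - X]addr0 -(scale0r v) -/(psi h) -/(psi 0).
by rewrite Eb subr0; ring.
Qed.

(** Computed in the two possible orders, a small second difference yields both
    mixed derivatives at points close to x. *)
Lemma schwarz (x u v : 'rV[R]_n) : U x ->
  (forall y, U y -> derivable f y u) -> (forall y, U y -> derivable f y v) ->
  (forall y, U y -> derivable ('D_u f) y v) ->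
  (forall y, U y -> derivable ('D_v f) y u) ->
  {for x, continuous ('D_v ('D_u f))} -> {for x, continuous ('D_u ('D_v f))} ->
  'D_v ('D_u f) x = 'D_u ('D_v f) x.
Proof.
move=> Ux du dv dvu duv cvu cuv; apply/eqP; rewrite -subr_eq0 -normr_le0.
apply/ler_addgt0Pl => e e0; rewrite addr0.
have e2 : 0 < e / 2 by rewrite divr_gt0.
have N : \forall y \near x, U y /\ `|'D_v ('D_u f) x - 'D_v ('D_u f) y| < e / 2 /\
    `|'D_u ('D_v f) x - 'D_u ('D_v f) y| < e / 2.
  have N1 : \forall y \near x, U y by apply: open_nbhs_nbhs.
  move/cvgrPdist_lt : cvu => /(_ _ e2) N2; move/cvgrPdist_lt : cuv => /(_ _ e2) N3.
  exact: (filterI N1 (filterI N2 N3)).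
have [r /= r0 rN] := (nbhs_ballP _ _).1 N.
pose D := `|u| + `|v| + 1.
have D0 : 0 < D by rewrite /D ltr_wpDl // addr_ge0.
pose h := r / (2 * D).
have h0 : 0 < h by rewrite divr_gt0 // mulr_gt0.
have inb a b : 0 <= a <= h -> 0 <= b <= h -> ball x r (x + a *: u + b *: v).
  move=> /andP[a0 ah] /andP[b0 bh]; rewrite -ball_normE /=.
  rewrite -addrA opprD addrA subrr sub0r normrN.
  apply: (le_lt_trans (ler_normD _ _)); rewrite !normrZ !ger0_norm //.
  have : a * `|u| + b * `|v| <= h * D.
    rewrite /D !mulrDr mulr1; apply: ler_wpDr; first exact: ltW.
    by apply: lerD; apply: ler_wpM2r.
  move/le_lt_trans; apply; rewrite /h invfM mulrA mulfVK ?gt_eqF //.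
  by rewrite ltr_pdivrMr // ltr_pMr // ltr1n.
have [a [b [aa bb E1]]] := second_difference h0
  (fun a b ha hb => du _ (rN _ (inb a b ha hb)).1)
  (fun a b ha hb => dvu _ (rN _ (inb a b ha hb)).1).
have inb' a' b' : 0 <= a' <= h -> 0 <= b' <= h -> ball x r (x + a' *: v + b' *: u).
  by move=> ha hb; rewrite addrAC; apply: inb.
have [a' [b' [aa' bb' E2]]] := second_difference h0
  (fun a b ha hb => dv _ (rN _ (inb' a b ha hb)).1)
  (fun a b ha hb => duv _ (rN _ (inb' a b ha hb)).1).
have E3 : 'D_v ('D_u f) (x + a *: u + b *: v) = 'D_u ('D_v f) (x + a' *: v + b' *: u).
  have hh0 : h * h != 0 by rewrite mulf_neq0 ?gt_eqF.
  apply: (mulfI hh0); apply: (etrans (esym E1)); apply: etrans E2.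
  by congr (_ + f x); rewrite (addrAC x (h *: v)); exact: addrAC.
have [_ [+ _]] := rN _ (inb a b aa bb); have [_ [_ +]] := rN _ (inb' a' b' aa' bb').
rewrite E3.
by move=> L2 L1; exact: dist_le_half L1 L2.
Qed.

End Schwarz.

(** * The ring of smooth functions on an open set *)

Section DirectionalSmoothness.
Variables (R : realType) (n : nat) (U : set 'rV[R]_n).
Hypothesis oU : open U.
Implicit Types f g : 'rV[R]_n -> R.

(** Smoothness in terms of directional derivatives and continuity only.  It
    follows from total differentiability of all orders, is enough for the
    symmetry of second derivatives, and is stable under products and inverses
    by short inductions. *)
Fixpoint csmooth (k : nat) f : Prop :=
  if k is k'.+1 then
    [/\ forall x, U x -> {for x, continuous f},
        forall x v, U x -> derivable f x v
      & forall v, csmooth k' ('D_v f)]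
  else True.

Lemma near_eq_on x f g : U x -> (forall y, U y -> f y = g y) ->
  \forall y \near x, f y = g y.
Proof.
by move=> Ux fg; have N : \forall y \near x, U y; [exact: open_nbhs_nbhs|apply: filterS N].
Qed.

Lemma eq_on_derive x v f g : U x -> (forall y, U y -> f y = g y) ->
  'D_v f x = 'D_v g x.
Proof. by move=> Ux fg; apply: near_eq_derive; exact: near_eq_on. Qed.

Lemma eq_csmooth k f g : (forall y, U y -> f y = g y) -> csmooth k f -> csmooth k g.
Proof.
elim: k f g => //= k IH f g fg [cf df sf]; split.
- move=> x Ux; have N := near_eq_on Ux fg.
  have L : f z @[z --> x] --> g x by rewrite -(fg _ Ux); exact: cf.
  exact: (cvg_trans (near_eq_cvg N) L).
- by move=> x v Ux; apply: near_eq_derivable (df x v Ux); exact: near_eq_on.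
- move=> v; apply: IH (sf v) => y Uy; exact: eq_on_derive.
Qed.

Lemma csmooth_cst k c : csmooth k (cst c).
Proof.
elim: k c => //= k IH c; split => [x _|x v _|v].
- exact: cst_continuous.
- exact: derivable_cst.
- by apply: eq_csmooth (IH 0) => y _; rewrite derive_cst.
Qed.

Lemma csmoothD k f g : csmooth k f -> csmooth k g -> csmooth k (fun x => f x + g x).
Proof.
elim: k f g => //= k IH f g [cf df sf] [cg dg sg]; split => [x Ux|x v Ux|v].
- by apply: continuousD; [exact: cf|exact: cg].
- by apply: derivableD; [exact: df|exact: dg].
- apply: eq_csmooth (IH _ _ (sf v) (sg v)) => y Uy.
  by rewrite deriveD //; [exact: df|exact: dg].
Qed.

Lemma csmoothS k f : csmooth k.+1 f -> csmooth k f.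
Proof.
elim: k f => //= k IH f [cf df sf]; split => // v; exact: IH.
Qed.

Lemma csmoothM k f g : csmooth k f -> csmooth k g -> csmooth k (fun x => f x * g x).
Proof.
elim: k f g => // k IH f g kf kg.
have [cf df sf] := kf; have [cg dg sg] := kg; split => [x Ux|x v Ux|v].
- by apply: continuousM; [exact: cf|exact: cg].
- by apply: derivableM; [exact: df|exact: dg].
- have E1 := IH _ _ (csmoothS kf) (sg v); have E2 := IH _ _ (csmoothS kg) (sf v).
  apply: eq_csmooth (csmoothD E1 E2) => y Uy.
  by rewrite deriveM //; [exact: df|exact: dg].
Qed.

Lemma csmoothN k f : csmooth k f -> csmooth k (fun x => - f x).
Proof.
move=> kf; apply: eq_csmooth (csmoothM (csmooth_cst k (-1)) kf) => y _.
by rewrite mulN1r.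
Qed.

Lemma csmoothV k f : (forall x, U x -> f x != 0) -> csmooth k f ->
  csmooth k (fun x => (f x)^-1).
Proof.
move=> f0; elim: k => // k IH kf.
have Vk := IH (csmoothS kf); have [cf df sf] := kf; split => [x Ux|x v Ux|v].
- by apply: continuousV; [exact: f0|exact: cf].
- by apply: derivableV; [exact: f0|exact: df].
- apply: eq_csmooth (csmoothN (csmoothM (csmoothM Vk Vk) (sf v))) => y Uy.
  rewrite deriveV; [|exact: f0|exact: df].
  by rewrite /GRing.scale/= mulNr expr2 invfM.
Qed.

Lemma csmooth_entry m p (F : 'rV[R]_n -> 'M[R]_(m, p)) k i j :
  ndifferentiable k U F -> csmooth k (fun x => F x i j).
Proof.
elim: k F => //= k IH F [dF sF]; split => [x Ux|x v Ux|v].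
- have cF : {for x, continuous F} by apply: differentiable_continuous; exact: dF.
  apply: (@continuous_comp _ _ _ F (fun N : 'M[R]_(m, p) => N i j) x cF).
  exact: coord_continuous.
- have /derivable_mxP := @diff_derivable _ _ _ F x v (dF x Ux); exact.
- apply: eq_csmooth (IH _ (sF v)) => y Uy.
  by rewrite derive_mx ?mxE //; apply: diff_derivable; exact: dF.
Qed.

Lemma csmooth_schwarz f x u v : (forall k, csmooth k f) -> U x ->
  'D_v ('D_u f) x = 'D_u ('D_v f) x.
Proof.
(* Two orders for the mixed derivatives, a third for their continuity. *)
move=> /(_ 3%N) /= [_ df sf] Ux.
have [c1 d1 s1] := sf u; have [c2 d2 s2] := sf v.
apply: (schwarz oU Ux); [by move=> y; exact: df| by move=> y; exact: df |
  by move=> y; exact: d1 | by move=> y; exact: d2 | |].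
- by have [cc _ _] := s1 v; exact: cc.
- by have [cc _ _] := s2 u; exact: cc.
Qed.

End DirectionalSmoothness.

Section SmoothFunctions.
Variables (R : realType) (n : nat) (U : set 'rV[R]_n) (p0 : 'rV[R]_n).
Variables (oU : open U) (Up0 : U p0).

(** The value 0 off U makes functions that agree on U equal, so that the ring
    axioms hold as equalities.  The point p0 ensures that 1 and 0 differ. *)
Record smoothfun (oU : open U) (Up0 : U p0) := SmoothFun {
  sfun_val :> 'rV[R]_n -> R ;
  sfun_smooth : forall k, csmooth U k sfun_val ;
  sfun_off : forall x, ~ U x -> sfun_val x = 0 }.

Local Notation F := (smoothfun oU Up0).

HB.instance Definition _ := gen_eqMixin F.
HB.instance Definition _ := gen_choiceMixin F.

Lemma sfunP (f g : F) : (forall x, U x -> f x = g x) -> f = g.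
Proof.
case: f g => [f fs f0] [g gs g0] /= fg.
have E : f = g.
  by apply/funext => x; have [Ux|nUx] := pselect (U x); [exact: fg|rewrite f0 // g0].
by move: fs f0 gs g0; rewrite E => *; congr SmoothFun; exact: Prop_irrelevance.
Qed.

Definition cutoff (f : 'rV[R]_n -> R) (x : 'rV[R]_n) : R :=
  if pselect (U x) then f x else 0.

Lemma cutoffE f x : U x -> cutoff f x = f x.
Proof. by rewrite /cutoff; case: pselect. Qed.

Lemma cutoff_smooth f : (forall k, csmooth U k f) -> forall k, csmooth U k (cutoff f).
Proof.
by move=> fs k; apply: (eq_csmooth oU _ (fs k)) => x Ux; rewrite cutoffE.
Qed.

Lemma cutoff_off f x : ~ U x -> cutoff f x = 0.
Proof. by rewrite /cutoff; case: pselect. Qed.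

Definition sfun_mk (f : 'rV[R]_n -> R) (fs : forall k, csmooth U k f) : F :=
  @SmoothFun oU Up0 (cutoff f) (cutoff_smooth fs) (@cutoff_off f).

Lemma sfun_mkE f fs x : U x -> @sfun_mk f fs x = f x.
Proof. exact: cutoffE. Qed.

Definition sfun_add (f g : F) : F :=
  sfun_mk (fun k => csmoothD oU (sfun_smooth f k) (sfun_smooth g k)).
Definition sfun_mul (f g : F) : F :=
  sfun_mk (fun k => csmoothM oU (sfun_smooth f k) (sfun_smooth g k)).
Definition sfun_opp (f : F) : F := sfun_mk (fun k => csmoothN oU (sfun_smooth f k)).
Definition sfun_cst (c : R) : F := sfun_mk (fun k => csmooth_cst oU k c).

Fact sfun_addA : associative sfun_add.
Proof. by move=> f g h; apply: sfunP => x Ux; rewrite !sfun_mkE // addrA. Qed.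
Fact sfun_addC : commutative sfun_add.
Proof. by move=> f g; apply: sfunP => x Ux; rewrite !sfun_mkE // addrC. Qed.
Fact sfun_add0 : left_id (sfun_cst 0) sfun_add.
Proof. by move=> f; apply: sfunP => x Ux; rewrite !sfun_mkE // add0r. Qed.
Fact sfun_addN : left_inverse (sfun_cst 0) sfun_opp sfun_add.
Proof. by move=> f; apply: sfunP => x Ux; rewrite !sfun_mkE // addNr. Qed.

HB.instance Definition _ :=
  GRing.isZmodule.Build F sfun_addA sfun_addC sfun_add0 sfun_addN.

Fact sfun_mulA : associative sfun_mul.
Proof. by move=> f g h; apply: sfunP => x Ux; rewrite !sfun_mkE // mulrA. Qed.
Fact sfun_mulC : commutative sfun_mul.
Proof. by move=> f g; apply: sfunP => x Ux; rewrite !sfun_mkE // mulrC. Qed.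
Fact sfun_mul1 : left_id (sfun_cst 1) sfun_mul.
Proof. by move=> f; apply: sfunP => x Ux; rewrite !sfun_mkE // mul1r. Qed.
Fact sfun_mulD : left_distributive sfun_mul sfun_add.
Proof. by move=> f g h; apply: sfunP => x Ux; rewrite !sfun_mkE // mulrDl. Qed.
Fact sfun_1neq0 : sfun_cst 1 != sfun_cst 0.
Proof.
apply/eqP => /(congr1 (fun f : F => f p0)); rewrite !sfun_mkE // => /eqP.
by rewrite oner_eq0.
Qed.

HB.instance Definition _ :=
  GRing.Zmodule_isComNzRing.Build F sfun_mulA sfun_mulC sfun_mul1 sfun_mulD sfun_1neq0.

Fact sfun_deriv_smooth (v : 'rV[R]_n) (f : F) k : csmooth U k ('D_v f).
Proof. by have [_ _ +] := sfun_smooth f k.+1; exact. Qed.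

Definition sfun_deriv (v : 'rV[R]_n) (f : F) : F := sfun_mk (sfun_deriv_smooth v f).

Lemma sfun_derivable (f : F) x v : U x -> derivable f x v.
Proof. by move=> Ux; have [_ + _] := sfun_smooth f 1; exact. Qed.

Lemma sfun_derivE v (f : F) x : U x -> sfun_deriv v f x = 'D_v f x.
Proof. exact: sfun_mkE. Qed.

Lemma sfunDE (f g : F) x : U x -> (f + g : F) x = f x + g x.
Proof. exact: cutoffE. Qed.
Lemma sfunNE (f : F) x : U x -> (- f : F) x = - f x.
Proof. exact: cutoffE. Qed.
Lemma sfunME (f g : F) x : U x -> (f * g : F) x = f x * g x.
Proof. exact: cutoffE. Qed.
Lemma sfun1E x : U x -> (1 : F) x = 1.
Proof. exact: cutoffE. Qed.
Lemma sfunBE (f g : F) x : U x -> (f - g : F) x = f x - g x.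
Proof. by move=> Ux; rewrite sfunDE // sfunNE. Qed.

Lemma sfun_derivB v : {morph sfun_deriv v : f g / f - g}.
Proof.
move=> f g; apply: sfunP => x Ux; rewrite sfunBE // !sfun_derivE //.
rewrite -deriveB; [|exact: sfun_derivable|exact: sfun_derivable].
by apply: (eq_on_derive oU) => // y Uy; rewrite sfunBE.
Qed.

HB.instance Definition _ v := GRing.isZmodMorphism.Build F F (sfun_deriv v) (sfun_derivB v).

Lemma sfun_derivM v (f g : F) :
  sfun_deriv v (f * g) = sfun_deriv v f * g + f * sfun_deriv v g.
Proof.
apply: sfunP => x Ux; rewrite sfunDE // !sfunME // !sfun_derivE //.
transitivity ('D_v (fun y => f y * g y) x).
  by apply: (eq_on_derive oU) => // y Uy; rewrite sfunME.
rewrite deriveM; [|exact: sfun_derivable|exact: sfun_derivable].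
by rewrite addrC; congr (_ + _); rewrite mulrC.
Qed.

Lemma sfun_derivC u v (f : F) : sfun_deriv u (sfun_deriv v f) = sfun_deriv v (sfun_deriv u f).
Proof.
apply: sfunP => x Ux.
have E a b : sfun_deriv a (sfun_deriv b f) x = 'D_a ('D_b f) x.
  apply: (etrans (sfun_derivE a (sfun_deriv b f) Ux)).
  by apply: (eq_on_derive oU) => // y; exact: sfun_derivE.
apply: (etrans (E u v)); apply: etrans (esym (E v u)).
by apply: (csmooth_schwarz oU) => // k; exact: sfun_smooth.
Qed.

Lemma sfun_deriv_cst v c : sfun_deriv v (sfun_cst c) = 0.
Proof.
apply: sfunP => x Ux; rewrite sfun_derivE // [RHS]cutoffE //.
transitivity ('D_v (cst c : 'rV[R]_n -> R) x); last exact: derive_cst.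
by apply: (eq_on_derive oU) => // y Uy; rewrite sfun_mkE.
Qed.

Section Evaluation.
Variable x : 'rV[R]_n.
Hypothesis Ux : U x.

Definition sfun_ev (f : F) : R := f x.

Fact sfun_evB : {morph sfun_ev : f g / f - g}.
Proof. by move=> f g; exact: sfunBE. Qed.
Fact sfun_evM : monoid_morphism sfun_ev.
Proof. by split=> [|f g]; [exact: sfun1E|exact: sfunME]. Qed.

Definition ev : {rmorphism F -> R} :=
  HB.pack sfun_ev (GRing.isZmodMorphism.Build F R sfun_ev sfun_evB)
    (GRing.isMonoidMorphism.Build F R sfun_ev sfun_evM).

End Evaluation.

End SmoothFunctions.

(** * Coordinate formulas as values of ring identities *)

Lemma curvature_entry (K : comNzRingType) n (d : 'I_n -> {additive K -> K})
    (G : 'I_n -> 'M[K]_n) i j a b :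
  curvature d G i j a b = dmx d i (G j) a b - dmx d j (G i) a b
    + ((G j *m G i) a b - (G i *m G j) a b).
Proof.
rewrite /curvature; move: (dmx d i _) (dmx d j _) (G j *m _) (G i *m _) => A B C D.
by rewrite !(addmxE, oppmxE) addrA.
Qed.

Section Transfer.
Variables (R : realType) (n : nat) (U : set 'rV[R]_n) (p0 : 'rV[R]_n).
Variables (oU : open U) (Up0 : U p0).
Local Notation F := (smoothfun oU Up0).
Local Notation ev := (ev oU Up0).

Definition coord_deriv (k : 'I_n) : {additive F -> F} := sfun_deriv (delta_mx 0 k).
Local Notation d := coord_deriv.

Lemma coord_derivM k (x y : F) : d k (x * y) = d k x * y + x * d k y.
Proof. exact: sfun_derivM. Qed.

Lemma coord_derivC j k (x : F) : d j (d k x) = d k (d j x).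
Proof. exact: sfun_derivC. Qed.

(** Derivatives at a point of the open set U only depend on the values on U, so
    an element of the ring may be replaced by any function with the same
    values. *)
Lemma ev_coord_deriv k (f : F) (h : 'rV[R]_n -> R) x (Ux : U x) :
  (forall y (Uy : U y), ev Uy f = h y) -> ev Ux (d k f) = partial k h x.
Proof.
move=> fh; apply: (etrans (sfun_derivE (delta_mx 0 k) f Ux)).
apply: (eq_on_derive oU) => // y Uy; exact: (fh y Uy).
Qed.

Lemma sfun_evP (f g : F) : (forall x (Ux : U x), ev Ux f = ev Ux g) -> f = g.
Proof. by move=> fg; apply: sfunP => x Ux; exact: (fg x Ux). Qed.

Lemma mx_sfunP m p (A B : 'M[F]_(m, p)) :
  (forall x (Ux : U x), map_mx (ev Ux) A = map_mx (ev Ux) B) -> A = B.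
Proof.
move=> AB; apply/matrixP => i j; apply: sfun_evP => x Ux.
by have /matrixP/(_ i j) := AB x Ux; rewrite !mxE.
Qed.

Definition lift_mx m p (A : 'rV[R]_n -> 'M[R]_(m, p)) (sA : smooth U A) : 'M[F]_(m, p) :=
  \matrix_(i, j) sfun_mk oU Up0 (fun k => csmooth_entry oU i j (sA k)).

Lemma ev_lift m p (A : 'rV[R]_n -> 'M[R]_(m, p)) (sA : smooth U A) x (Ux : U x) :
  map_mx (ev Ux) (lift_mx sA) = A x.
Proof. by apply/matrixP => i j; rewrite !mxE; exact: sfun_mkE. Qed.

Definition const (c : R) : F := sfun_cst oU Up0 c.

Lemma ev_const c x (Ux : U x) : ev Ux (const c) = c.
Proof. exact: sfun_mkE. Qed.

Lemma coord_deriv_const k c : d k (const c) = 0.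
Proof. exact: sfun_deriv_cst. Qed.

Lemma const_halfK : const 2^-1 + const 2^-1 = 1.
Proof.
apply: sfun_evP => x Ux; rewrite rmorphD rmorph1 !ev_const.
by rewrite [RHS](splitr (1 : R)) !mul1r.
Qed.

(** The determinant vanishes nowhere, so it is a unit of the ring and the
    adjugate formula applies. *)
Lemma lift_inverse (A : 'M[F]_n) :
  (forall x (Ux : U x), map_mx (ev Ux) A \in unitmx) -> exists B, A *m B = 1%:M.
Proof.
move=> uA.
have d0 x (Ux : U x) : \det A x != 0.
  by move: (uA x Ux); rewrite unitmxE det_map_mx unitfE.
pose di : F := sfun_mk oU Up0
  (fun k => csmoothV oU d0 (sfun_smooth (\det A) k)).
exists (di *: \adj A); rewrite -scalemxAr mul_mx_adj; apply/matrixP => i j.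
rewrite !mxE; case: (i == j); last by rewrite mulr0.
rewrite mulr1n; apply: sfun_evP => x Ux; rewrite rmorphM rmorph1.
have -> : ev Ux di = (\det A x)^-1 by exact: sfun_mkE.
exact: (mulVf (d0 x Ux)).
Qed.

Lemma map_mx_inverse (A B : 'M[F]_n) x (Ux : U x) : A *m B = 1%:M ->
  map_mx (ev Ux) B = invmx (map_mx (ev Ux) A).
Proof.
move=> AB; have E : map_mx (ev Ux) A *m map_mx (ev Ux) B = 1%:M.
  by rewrite -map_mxM AB map_mx1.
have [uA _] := mulmx1_unit E.
by rewrite -[LHS]mul1mx -(mulVmx uA) -mulmxA E mulmx1.
Qed.

Section MetricTransfer.
Variables (h : 'rV[R]_n -> 'M[R]_n) (H Hi : 'M[F]_n).
Hypothesis evH : forall x (Ux : U x), map_mx (ev Ux) H = h x.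
Hypothesis HHi : H *m Hi = 1%:M.
Local Notation LC := (levi_civita d (const 2^-1) H Hi).

Lemma ev_levi_civita k j i x (Ux : U x) : ev Ux (LC k j i) = christoffel h i k j x.
Proof.
have hE a b y (Uy : U y) : ev Uy (H a b) = h y a b by rewrite -evH mxE.
have hi a b : ev Ux (Hi a b) = invmx (h x) a b.
  by rewrite -evH -(map_mx_inverse Ux HHi) mxE.
rewrite /levi_civita mxE rmorphM ev_const /christoffel; congr (_ * _).
rewrite rmorph_sum; apply: eq_bigr => l _.
rewrite rmorphM rmorphB rmorphD hi.
rewrite !(ev_coord_deriv (h := fun y => h y _ _) _ Ux (fun y Uy => hE _ _ y Uy)).
by [].
Qed.

(** The bridge between the two descriptions of the Ricci tensor: evaluation at
    x is a ring morphism that carries derivations to partial derivatives. *)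
Lemma ev_ricci x (Ux : U x) : map_mx (ev Ux) (ricci_of d LC) = ricci h x.
Proof.
apply/matrixP => j k; rewrite mxE [ricci_of _ _ _ _]mxE [RHS]mxE rmorph_sum.
apply: eq_bigr => l _; rewrite /riemann /curvature.
have E1 a b c e : ev Ux (dmx d a (LC b) c e) = partial a (christoffel h e b c) x.
  rewrite [dmx _ _ _ _ _]mxE; apply: ev_coord_deriv => y Uy.
  exact: ev_levi_civita.
have E2 a b c e : ev Ux ((LC a *m LC b) c e) =
    \sum_m christoffel h e b m x * christoffel h m a c x.
  rewrite mxE rmorph_sum; apply: eq_bigr => m _.
  by rewrite rmorphM !ev_levi_civita mulrC.
rewrite curvature_entry rmorphD !rmorphB; congr (_ + _).
  by congr (_ - _); [exact: (E1 l j k l)|exact: (E1 j l k l)].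
rewrite sumrB; congr (_ - _); [exact: (E2 j l k l)|exact: (E2 l j k l)].
Qed.

End MetricTransfer.
End Transfer.

Lemma posdef_unit (R : realFieldType) n (A : 'M[R]_n) :
  (forall v : 'rV[R]_n, v != 0 -> 0 < (v *m A *m v^T) 0 0) -> A \in unitmx.
Proof.
move=> pA; rewrite -row_free_unit -kermx_eq0; apply/negPn/negP => /rowV0Pn [v vk v0].
by have := pA v v0; rewrite (sub_kermxP vk) mul0mx mxE ltxx.
Qed.

Lemma nabla_end_entry (K : comNzRingType) n (d : 'I_n -> {additive K -> K})
    (G : 'I_n -> 'M[K]_n) k P a b :
  nabla_end d G k P a b =
  d k (P a b) + \sum_m (P a m * G k m b - G k a m * P m b).
Proof. by rewrite /nabla_end !mxE sumrB addrA. Qed.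

Definition sasakian_on (R : realType) n (U : set 'rV[R]_n) (g : 'rV[R]_n -> 'M[R]_n)
    (X : 'rV[R]_n -> 'rV[R]_n) : Prop :=
  [/\ forall x, U x -> lie_derivative_metric X g x = 0,
      forall x, U x -> inner g x (X x) (X x) = 1
    & forall x, U x -> forall k j l : 'I_n,
      covariant_derivative_endo g (fun y => - covariant_derivative g X y) k x j l
      = g x k j * X x 0 l - dual_form g X x 0 j * (k == l)%:R].

Section LocalSasakian.
Variables (R : realType) (n : nat) (U : set 'rV[R]_n) (p0 : 'rV[R]_n).
Variables (oU : open U) (Up0 : U p0).
Local Notation F := (smoothfun oU Up0).
Local Notation ev := (ev oU Up0).
Local Notation d := (coord_deriv oU Up0).
Local Notation const := (const oU Up0).

Variable g : 'rV[R]_n -> 'M[R]_n.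
Hypothesis gT : forall x, U x -> (g x)^T = g x.
Variables gK gi : 'M[F]_n.
Hypothesis evg : forall x (Ux : U x), map_mx (ev Ux) gK = g x.
Hypothesis ggi : gK *m gi = 1%:M.

Local Notation LC := (levi_civita d (const 2^-1) gK gi).

Fact gKT : gK^T = gK.
Proof. by apply: mx_sfunP => x Ux; rewrite -map_trmx evg gT. Qed.

Section Field.
Variable X : 'rV[R]_n -> 'rV[R]_n.
Variable xi : 'rV[F]_n.
Hypothesis evX : forall x (Ux : U x), map_mx (ev Ux) xi = X x.
Let evXE x (Ux : U x) j : ev Ux (xi 0 j) = X x 0 j.
Proof. by rewrite -(evX Ux) [RHS]mxE. Qed.
Let evgE x (Ux : U x) i j : ev Ux (gK i j) = g x i j.
Proof. by rewrite -(evg Ux) [RHS]mxE. Qed.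

Lemma ev_dX k j x (Ux : U x) : ev Ux (d k (xi 0 j)) = partial k (fun y => X y 0 j) x.
Proof. by apply: ev_coord_deriv => y Uy; exact: evXE. Qed.

Lemma ev_dg k i j x (Ux : U x) : ev Ux (d k (gK i j)) = partial k (fun y => g y i j) x.
Proof. by apply: ev_coord_deriv => y Uy; exact: evgE. Qed.

Lemma ev_minus_nabla x (Ux : U x) :
  map_mx (ev Ux) (minus_nabla d (const 2^-1) gK gi xi) = - covariant_derivative g X x.
Proof.
apply/matrixP => k i; rewrite mxE [minus_nabla _ _ _ _ _ _ _]mxE [RHS]mxE rmorphN.
congr (- _); rewrite [RHS]mxE /nabla_vec addmxE rmorphD.
rewrite [dmx _ _ _ _ _]mxE ev_dX; congr (_ + _).
rewrite mxE rmorph_sum; apply: eq_bigr => m _.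
by rewrite rmorphM evXE (ev_levi_civita evg ggi) mulrC.
Qed.

Lemma ev_lie x (Ux : U x) :
  map_mx (ev Ux) (lie_metric d gK xi) = lie_derivative_metric X g x.
Proof.
apply/matrixP => i j; rewrite mxE [lie_metric _ _ _ _ _]mxE [RHS]mxE rmorph_sum.
apply: eq_bigr => k _; rewrite rmorphD rmorphD.
congr (_ + _ + _); rewrite rmorphM; congr (_ * _).
- exact: evXE.
- exact: ev_dg.
- exact: evgE.
- exact: ev_dX.
- exact: evgE.
- exact: ev_dX.
Qed.

Hypothesis sas : sasakian_on U g X.

Lemma lift_sasakian :
  sasakian_pair d gK LC xi (minus_nabla d (const 2^-1) gK gi xi).
Proof.
have [killing unit nabla2] := sas.
have P_ev x (Ux : U x) a b : ev Ux (minus_nabla d (const 2^-1) gK gi xi a b) =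
    (- covariant_derivative g X x) a b.
  by rewrite -(ev_minus_nabla Ux) [RHS]mxE.
split.
- move=> k; exact: row_minus_nabla.
- rewrite (lie_metricE d (const_halfK oU Up0) gKT ggi).
  apply: mx_sfunP => x Ux; rewrite map_mxN ev_lie killing //.
  by rewrite map_mx0 oppr0.
- apply: mx_sfunP => x Ux; rewrite !map_mxM -map_trmx evX evg map_mx1.
  by apply/matrixP => i j; rewrite !ord1 [LHS](unit x Ux) mxE.
- move=> k; apply: mx_sfunP => x Ux; apply/matrixP => j l.
  have := nabla2 x Ux k j l; rewrite [LHS]mxE => E.
  have -> : map_mx (ev Ux) ((row k gK)^T *m xi - (xi *m gK)^T *m delta_mx 0 k) j l =
      g x k j * X x 0 l - dual_form g X x 0 j * (k == l)%:R.
    rewrite map_mxB !map_mxM -!map_trmx map_row evg evX map_delta_mx map_mxM evX evg.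
    rewrite addmxE oppmxE !mxE !big_ord1 !mxE eqxx /= eq_sym; congr (_ - _).
  rewrite -E mxE nabla_end_entry rmorphD.
  congr (_ + _); first by apply: ev_coord_deriv => y Uy; exact: P_ev.
  rewrite rmorph_sum; apply: eq_bigr => m _; rewrite rmorphB.
  congr (_ - _); rewrite rmorphM; [rewrite mulrC|]; congr (_ * _).
  - exact: ev_levi_civita.
  - exact: P_ev.
  - exact: ev_levi_civita.
  - exact: P_ev.
Qed.

End Field.

Variables X1 X2 X3 : 'rV[R]_n -> 'rV[R]_n.
Variables xi1 xi2 xi3 : 'rV[F]_n.
Hypothesis ev1 : forall x (Ux : U x), map_mx (ev Ux) xi1 = X1 x.
Hypothesis ev2 : forall x (Ux : U x), map_mx (ev Ux) xi2 = X2 x.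
Hypothesis ev3 : forall x (Ux : U x), map_mx (ev Ux) xi3 = X3 x.
Hypotheses (sas1 : sasakian_on U g X1) (sas2 : sasakian_on U g X2).
Hypothesis sas3 : sasakian_on U g X3.

Lemma lift_inner X Y (xi ze : 'rV[F]_n) :
  (forall x (Ux : U x), map_mx (ev Ux) xi = X x) ->
  (forall x (Ux : U x), map_mx (ev Ux) ze = Y x) ->
  (forall x, U x -> inner g x (X x) (Y x) = 0) -> xi *m gK *m ze^T = 0.
Proof.
move=> eX eY XY; apply: mx_sfunP => x Ux; rewrite !map_mxM -map_trmx eX eY evg map_mx0.
by apply/matrixP => i j; rewrite !ord1 [LHS](XY x Ux) mxE.
Qed.

Lemma lift_bracket X Y Z (xi ze la : 'rV[F]_n) :
  (forall x (Ux : U x), map_mx (ev Ux) xi = X x) ->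
  (forall x (Ux : U x), map_mx (ev Ux) ze = Y x) ->
  (forall x (Ux : U x), map_mx (ev Ux) la = Z x) ->
  (forall x, U x -> lie_bracket X Y x = 2 *: Z x) ->
  ze *m minus_nabla d (const 2^-1) gK gi xi - xi *m minus_nabla d (const 2^-1) gK gi ze
  = la + la.
Proof.
move=> eX eY eZ XY; rewrite bracket_minus_nabla ?gKT //.
have eXE x (Ux : U x) i : ev Ux (xi 0 i) = X x 0 i by rewrite -(eX _ Ux) [RHS]mxE.
have eYE x (Ux : U x) i : ev Ux (ze 0 i) = Y x 0 i by rewrite -(eY _ Ux) [RHS]mxE.
apply: mx_sfunP => x Ux; rewrite map_mxD eZ -mulr2n -scaler_nat -XY //.
apply/matrixP => a i; rewrite mxE [(\row__ _) _ _]mxE [RHS]mxE rmorph_sum.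
apply: eq_bigr => j _; rewrite rmorphB.
congr (_ - _); rewrite rmorphM; congr (_ * _).
- exact: eXE.
- by apply: ev_coord_deriv => y Uy; exact: eYE.
- exact: eYE.
- by apply: ev_coord_deriv => y Uy; exact: eXE.
Qed.

Hypothesis o12 : forall x, U x -> inner g x (X1 x) (X2 x) = 0.
Hypothesis o23 : forall x, U x -> inner g x (X2 x) (X3 x) = 0.
Hypothesis o31 : forall x, U x -> inner g x (X3 x) (X1 x) = 0.
Hypothesis b12 : forall x, U x -> lie_bracket X1 X2 x = 2 *: X3 x.
Hypothesis b23 : forall x, U x -> lie_bracket X2 X3 x = 2 *: X1 x.
Hypothesis b31 : forall x, U x -> lie_bracket X3 X1 x = 2 *: X2 x.

Local Notation mn := (minus_nabla d (const 2^-1) gK gi).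

Lemma lift_three_sasakian :
  three_sasakian_tensors d gK LC xi1 xi2 xi3 (mn xi1) (mn xi2) (mn xi3).
Proof.
split.
- exact: lift_sasakian ev1 sas1.
- exact: lift_sasakian ev2 sas2.
- exact: lift_sasakian ev3 sas3.
- exact: lift_inner ev1 ev2 o12.
- exact: lift_inner ev2 ev3 o23.
- exact: lift_inner ev3 ev1 o31.
- exact: lift_bracket ev1 ev2 ev3 b12.
- exact: lift_bracket ev2 ev3 ev1 b23.
- exact: lift_bracket ev3 ev1 ev2 b31.
Qed.

Variables c k1 k2 k3 : R.
Hypotheses (c0 : c != 0) (ck1 : c + k1 != 0) (ck2 : c + k2 != 0) (ck3 : c + k3 != 0).

Theorem local_ricci x : U x ->
  ricci (fun y => deformed (g y) c k1 k2 k3 (X1 y) (X2 y) (X3 y)) x =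
  deformed (g x) (n%:R - 1 - 2%:R * c^-1 * (k1 + k2 + k3))
    (ricci_coef n c^-1 k1 k2 k3 (c + k1)^-1 (c + k2)^-1 (c + k3)^-1)
    (ricci_coef n c^-1 k2 k3 k1 (c + k2)^-1 (c + k3)^-1 (c + k1)^-1)
    (ricci_coef n c^-1 k3 k1 k2 (c + k3)^-1 (c + k1)^-1 (c + k2)^-1)
    (X1 x) (X2 x) (X3 x).
Proof.
move=> Ux; have T := lift_three_sasakian.
have inv a : a != 0 -> const a * const a^-1 = 1.
  by move=> a0; apply: sfun_evP => y Uy; rewrite rmorphM rmorph1 !ev_const divff.
have invD a b : a + b != 0 -> (const a + const b) * const (a + b)^-1 = 1.
  move=> a0; apply: sfun_evP => y Uy.
  by rewrite rmorphM rmorph1 rmorphD !ev_const divff.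
have dcst a k : d k (const a) = 0 by exact: coord_deriv_const.
have HHi := deformed_inverse gKT ggi T (inv _ c0) (invD _ _ ck1) (invD _ _ ck2)
  (invD _ _ ck3).
have evH y (Uy : U y) :
    map_mx (ev Uy) (deformed gK (const c) (const k1) (const k2) (const k3) xi1 xi2 xi3)
    = deformed (g y) c k1 k2 k3 (X1 y) (X2 y) (X3 y).
  by rewrite map_deformed !ev_const evg ev1 ev2 ev3.
rewrite -(ev_ricci evH HHi Ux).
rewrite (deformed_levi_civita_ricci (@coord_derivM _ _ _ _ oU Up0)
  (@coord_derivC _ _ _ _ oU Up0) (const_halfK oU Up0) gKT ggi T (dcst c) (dcst c^-1)
  (dcst k1) (dcst k2) (dcst k3) (dcst _) (dcst _) (dcst _)
  (inv _ c0) (invD _ _ ck1) (invD _ _ ck2) (invD _ _ ck3)).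
rewrite map_deformed evg ev1 ev2 ev3 !map_ricci_coef !ev_const.
rewrite rmorphB rmorphB rmorph_nat rmorph1 rmorphM rmorphM rmorph_nat.
by rewrite !rmorphD !ev_const.
Qed.

End LocalSasakian.

(** * The Ricci tensors of the family *)

Section ChartRicci.
Variables (R : realType) (M : topologicalType) (A : atlas R 7 M).
Variables (g : tensor2_components A) (E1 E2 E3 : vector_components A).
Hypotheses (gm : riemannian_metric g) (ts : three_sasakian g E1 E2 E3).

Lemma chart_metric_unit (i : chart A) x : ch_img i x -> g i x \in unitmx.
Proof. by case: gm => _ _ _ pd Ux; apply: posdef_unit; exact: pd. Qed.

(** Substituting pi^* g_N = g - eta_1^2 - eta_2^2 - eta_3^2. *)
Lemma metric_family_deformed (a b c : R) (i : chart A) x :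
  metric_family g E1 E2 E3 a b c i x =
  deformed (g i x) (c ^+ 2) (a ^+ 2 - c ^+ 2) (a ^+ 2 - c ^+ 2) (b ^+ 2 - c ^+ 2)
    (E1 i x) (E2 i x) (E3 i x).
Proof.
rewrite /metric_family /transverse_metric /square_form /dual_form /deformed.
by mx_linear.
Qed.

(** The components of the Ricci tensor along eta_1^2 + eta_2^2, eta_3^2 and
    pi^* g_N, for the metric with parameters a, b, c. *)
Definition ricci_a (a b c : R) : R := 4 - 2 * b ^+ 2 / a ^+ 2 + 4 * a ^+ 4 / c ^+ 4.
Definition ricci_b (a b c : R) : R := 2 * b ^+ 4 / a ^+ 4 + 4 * b ^+ 4 / c ^+ 4.
Definition ricci_c (a b c : R) : R := 12 - (4 * a ^+ 2 + 2 * b ^+ 2) / c ^+ 2.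

Lemma sasakian_chart (xi : vector_components A) (i : chart A) :
  sasakian g xi -> sasakian_on (ch_img i) (g i) (xi i).
Proof.
by case=> [[_ kill] unit sas]; split => x Ux; [exact: kill|exact: unit|exact: sas].
Qed.

Lemma ricci_metric_family (a b c : R) (i : chart A) x :
  0 < a -> 0 < b -> 0 < c -> ch_img i x ->
  ricci (metric_family g E1 E2 E3 a b c i) x =
  ricci_a a b c *: (square_form g E1 i x + square_form g E2 i x)
  + ricci_b a b c *: square_form g E3 i x
  + ricci_c a b c *: transverse_metric g E1 E2 E3 i x.
Proof.
move=> a0 b0 c0 Ux; have oU : open (ch_img i) by exact: ch_img_open.
have [[s1 s2 s3] orth brack] := ts.
have [sg _ gT _] := gm.
have gT' y : ch_img i y -> (g i y)^T = g i y by exact: gT.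
have [sE1 sE2 sE3] : [/\ smooth (ch_img i) (E1 i), smooth (ch_img i) (E2 i)
    & smooth (ch_img i) (E3 i)].
  by case: s1 s2 s3 => [[[+ _] _] _ _] [[[+ _] _] _ _] [[[+ _] _] _ _]; split.
have evg := ev_lift oU Ux (sg i).
have [gi ggi] : exists gi, lift_mx oU Ux (sg i) *m gi = 1%:M.
  by apply: lift_inverse => y Uy; rewrite evg; exact: chart_metric_unit.
have ev1 := ev_lift oU Ux sE1; have ev2 := ev_lift oU Ux sE2.
have ev3 := ev_lift oU Ux sE3.
have c2 : c ^+ 2 != 0 by rewrite expf_neq0 ?gt_eqF.
have E z : c ^+ 2 + (z - c ^+ 2) = z by rewrite addrC subrK.
have a2 : c ^+ 2 + (a ^+ 2 - c ^+ 2) != 0 by rewrite E expf_neq0 ?gt_eqF.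
have b2 : c ^+ 2 + (b ^+ 2 - c ^+ 2) != 0 by rewrite E expf_neq0 ?gt_eqF.
have -> : metric_family g E1 E2 E3 a b c i = (fun y => deformed (g i y) (c ^+ 2)
    (a ^+ 2 - c ^+ 2) (a ^+ 2 - c ^+ 2) (b ^+ 2 - c ^+ 2) (E1 i y) (E2 i y) (E3 i y)).
  by apply/funext => y; exact: metric_family_deformed.
rewrite (local_ricci gT' evg ggi ev1 ev2 ev3 (sasakian_chart i s1)
  (sasakian_chart i s2) (sasakian_chart i s3) _ _ _ _ _ _ c2 a2 a2 b2 Ux); last first.
1-6: by move=> y Uy; have [? ? ?] := orth i y Uy; have [? ? ?] := brack i y Uy.
rewrite !E /deformed.
have [an bn cn] : [/\ a != 0, b != 0 & c != 0] by rewrite !gt_eqF.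
have C : 7%:R - 1 - 2%:R / c ^+ 2 * (a ^+ 2 - c ^+ 2 + (a ^+ 2 - c ^+ 2) + (b ^+ 2 - c ^+ 2))
   = ricci_c a b c by rewrite /ricci_c; field.
have C1 : ricci_coef 7 (c ^+ 2)^-1 (a ^+ 2 - c ^+ 2) (a ^+ 2 - c ^+ 2) (b ^+ 2 - c ^+ 2)
  (a ^+ 2)^-1 (a ^+ 2)^-1 (b ^+ 2)^-1 = ricci_a a b c - ricci_c a b c.
  by rewrite /ricci_coef /ricci_a /ricci_c; field; rewrite ?an ?bn ?cn.
have C2 : ricci_coef 7 (c ^+ 2)^-1 (a ^+ 2 - c ^+ 2) (b ^+ 2 - c ^+ 2) (a ^+ 2 - c ^+ 2)
  (a ^+ 2)^-1 (b ^+ 2)^-1 (a ^+ 2)^-1 = ricci_a a b c - ricci_c a b c.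
  by rewrite /ricci_coef /ricci_a /ricci_c; field; rewrite ?an ?bn ?cn.
have C3 : ricci_coef 7 (c ^+ 2)^-1 (b ^+ 2 - c ^+ 2) (a ^+ 2 - c ^+ 2) (a ^+ 2 - c ^+ 2)
  (b ^+ 2)^-1 (a ^+ 2)^-1 (a ^+ 2)^-1 = ricci_b a b c - ricci_c a b c.
  by rewrite /ricci_coef /ricci_b /ricci_c; field; rewrite ?an ?bn ?cn.
rewrite C C1 C2 C3 /transverse_metric /square_form /dual_form.
by mx_linear.
Qed.

End ChartRicci.

(** * Primitives on an open interval *)

Section Primitive.
Variable R : realType.
Local Notation mu := (@lebesgue_measure R).

Lemma continuous_on_segment_integrable (f : R -> R) (u v : R) :
  (forall x, u <= x <= v -> {for x, continuous f}) ->
  mu.-integrable `[u, v] (EFin \o f).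
Proof.
move=> cf; apply: continuous_compact_integrable; first exact: segment_compact.
by apply: continuous_in_subspaceT => x; rewrite inE /= in_itv /= => xuv; exact: cf.
Qed.

Lemma open_interval_lt (K : set R) x : open K -> K x -> exists2 u, u < x & K u.
Proof.
move=> oK Kx; have N : nbhs x K by exact: open_nbhs_nbhs.
have [r /= r0 rK] := (nbhs_ballP _ _).1 N; exists (x - r / 2).
  by rewrite ltrBlDr ltrDl divr_gt0.
apply: rK; rewrite /ball /= opprB addrC subrK ger0_norm ?divr_ge0 ?ltW //.
by rewrite ltr_pdivrMr // ltr_pMr // ltr1n.
Qed.

Lemma open_interval_gt (K : set R) x : open K -> K x -> exists2 u, x < u & K u.
Proof.
move=> oK Kx; have N : nbhs x K by exact: open_nbhs_nbhs.
have [r /= r0 rK] := (nbhs_ballP _ _).1 N; exists (x + r / 2).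
  by rewrite ltrDl divr_gt0.
apply: rK; rewrite /ball /= opprD addrA subrr sub0r normrN ger0_norm ?divr_ge0 ?ltW //.
by rewrite ltr_pdivrMr // ltr_pMr // ltr1n.
Qed.

Lemma integral_between (f : R -> R) (u w x : R) : u < w -> w <= x ->
  (forall y, u <= y <= x -> {for y, continuous f}) ->
  \int[mu]_(t in `[u, x]) f t - \int[mu]_(t in `[u, w]) f t = \int[mu]_(t in `[w, x]) f t.
Proof.
move=> uw wx cf; rewrite (@Rintegral_itvB _ _ (BLeft u) (BRight x) w).
- rewrite Rintegral_itv_obnd_cbnd //.
  apply: (@integrableS _ _ _ mu `[w, x]) => //.
  - by apply: subset_itvr; rewrite bnd_simp.
  - apply: continuous_on_segment_integrable => y /andP[wy yx]; apply: cf.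
    by rewrite yx (le_trans (ltW uw)).
- exact: continuous_on_segment_integrable.
- by rewrite bnd_simp ltW.
- by rewrite bnd_simp.
Qed.

(** The integral from u to x has derivative f x only for u < x, and an open
    interval need not have a least element; hence the starting point u varies
    with x, and the value is normalised at x0 so that it does not depend on
    u. *)
Lemma primitive_on (K : set R) (f : R -> R) : open K -> is_interval K ->
  (forall x, K x -> {for x, continuous f}) ->
  exists P : R -> R, forall x, K x -> is_derive x 1 P (f x).
Proof.
move=> oK iK cf; have [[x0 Kx0]|K0] := pselect (exists x, K x); last first.
  by exists (fun=> 0) => x Kx; exfalso; apply: K0; exists x.
have cfi u x : K u -> K x -> forall y, u <= y <= x -> {for y, continuous f}.
  by move=> Ku Kx y uyx; apply: cf; apply: (iK u x).
pose D u x := \int[mu]_(t in `[u, x]) f t - \int[mu]_(t in `[u, x0]) f t.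
have Dlt u w x : K u -> K w -> K x -> u < w -> w <= x -> w <= x0 -> D u x = D w x.
  move=> Ku Kw Kx uw wx wx0; rewrite /D.
  rewrite -(integral_between uw wx (cfi _ _ Ku Kx)).
  by rewrite -(integral_between uw wx0 (cfi _ _ Ku Kx0)); ring.
have Deq u w x : K u -> K w -> K x -> u <= x -> u <= x0 -> w <= x -> w <= x0 ->
    D u x = D w x.
  move=> Ku Kw Kx ux ux0 wx wx0; case: (ltgtP u w) => [uw|wu|->//].
  - exact: Dlt.
  - by apply/esym; exact: Dlt.
pose low x u := [/\ K u, u < x & u < x0].
have lowP x : K x -> exists u, low x u.
  move=> Kx; have [u ux Ku] := open_interval_lt oK Kx.
  have [u0 ux0 Ku0] := open_interval_lt oK Kx0.
  have [uu0|u0u] := leP u u0; first by exists u; split => //; exact: le_lt_trans ux0.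
  by exists u0; split => //; exact: lt_trans ux.
pose P x := D (xget 0 (low x)) x.
exists P => x Kx; have [u [Ku ux ux0]] := lowP x Kx.
have [v xv Kv] := open_interval_gt oK Kx.
have PE : \forall y \near x, D u y = P y.
  have N1 : \forall y \near x, K y by exact: open_nbhs_nbhs.
  have N2 : \forall y \near x, u < y by exact: lt_nbhsr.
  apply: filterS2 N1 N2 => y Ky uy; rewrite /P.
  case: xgetP => [w _ [Kw wy wx0]|/(_ u)]; last by case; split.
  by apply: Deq => //; exact: ltW.
apply: near_eq_is_derive PE _.
have [df f'] := @continuous_FTC1_closed _ f u x v xv
  (continuous_on_segment_integrable (cfi _ _ Ku Kv)) ux (cf x Kx).
rewrite /D -[f x]subr0; apply: is_deriveB.
by split; [exact: df|rewrite -derive1E; exact: f'].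
Qed.

End Primitive.

(** * The Ricci flow of the family as a differential equation *)

Section MatrixDerivative.
Variables (R : realType) (m n : nat).
Implicit Types M : R -> 'M[R]_(m, n).

Lemma is_derive_mxP M (t : R) (D : 'M[R]_(m, n)) :
  is_derive t (1 : R) M D <-> forall i j, is_derive t 1 (fun u => M u i j) (D i j).
Proof.
split=> [[dM <-] i j|dM].
  split; first by have /derivable_mxP := dM; exact.
  by rewrite derive_mx // mxE.
have DM : derivable M t 1.
  by apply/derivable_mxP => i j; case: (dM i j).
split => //; rewrite derive_mx //; apply/matrixP => i j; rewrite mxE.
by case: (dM i j).
Qed.

Lemma is_derive_trace M (t : R) (D : 'M[R]_(m, n)) (w : 'M[R]_(n, m)) :
  is_derive t (1 : R) M D -> is_derive t 1 (fun u => \tr (w *m M u)) (\tr (w *m D)).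
Proof.
move=> /is_derive_mxP dM.
have E (N : 'M[R]_(m, n)) : \tr (w *m N) = \sum_(i < n) \sum_(j < m) w i j * N j i.
  by apply: eq_bigr => i _; rewrite mxE.
have -> : (fun u => \tr (w *m M u)) =
    \sum_(i < n) \sum_(j < m) (fun u => w i j * M u j i).
  apply/funext => u; rewrite E fct_sumE; apply: eq_bigr => i _.
  by rewrite fct_sumE.
rewrite E; apply: is_derive_sum => i; apply: is_derive_sum => j.
Qed.

End MatrixDerivative.

Section FlowEquations.
Variables (R : realType) (M : topologicalType) (A : atlas R 7 M).
Variables (g : tensor2_components A) (E1 E2 E3 : vector_components A).
Hypotheses (gm : riemannian_metric g) (ts : three_sasakian g E1 E2 E3).

Definition flow_equations (a b c : R -> R) (t : R) : Prop :=
  [/\ is_derive t 1 (fun u => a u ^+ 2) (- 2 * ricci_a (a t) (b t) (c t)),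
      is_derive t 1 (fun u => b u ^+ 2) (- 2 * ricci_b (a t) (b t) (c t))
    & is_derive t 1 (fun u => c u ^+ 2) (- 2 * ricci_c (a t) (b t) (c t))].

Section AtPoint.
Variables (i : chart A) (x : 'rV[R]_7).
Hypothesis Ux : ch_img i x.

Let S := square_form g E1 i x + square_form g E2 i x.
Let T := square_form g E3 i x.
Let N := transverse_metric g E1 E2 E3 i x.

Lemma trace_square (w : 'M[R]_7) X :
  \tr (w *m square_form g X i x) = (dual_form (g i) (X i) x *m w *m
    (dual_form (g i) (X i) x)^T) 0 0.
Proof.
by rewrite /square_form mulmxA mxtrace_mulC mulmxA /mxtrace big_ord1.
Qed.

Lemma inner_sym X Y : inner (g i) x X Y = inner (g i) x Y X.
Proof.
have [_ _ gT _] := gm.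
rewrite /inner -[in LHS](trmxK (X *m g i x *m Y^T)) mxE.
by rewrite !trmx_mul trmxK gT // mulmxA.
Qed.

Lemma trace_outer_square X Y :
  \tr ((X i x)^T *m X i x *m square_form g Y i x) = inner (g i) x (X i x) (Y i x) ^+ 2.
Proof.
have [_ _ gT _] := gm.
rewrite trace_square /dual_form.
have -> : Y i x *m g i x *m ((X i x)^T *m X i x) *m (Y i x *m g i x)^T =
   (Y i x *m g i x *m (X i x)^T) *m (X i x *m g i x *m (Y i x)^T).
  by rewrite trmx_mul gT // !mulmxA.
by rewrite mxE big_ord1 -/(inner _ _ _ _) -/(inner _ _ _ _) inner_sym expr2.
Qed.

Lemma trace_outer_metric X :
  \tr ((X i x)^T *m X i x *m g i x) = inner (g i) x (X i x) (X i x).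
Proof. by rewrite -mulmxA mxtrace_mulC /mxtrace big_ord1. Qed.

(** Pairing a bilinear form with w1 and w3 evaluates it on E1 and E3, and
    pairing it with w0 takes its trace. *)
Let w1 := (E1 i x)^T *m E1 i x.
Let w3 := (E3 i x)^T *m E3 i x.
Let w0 := invmx (g i x).

Lemma frame_values : [/\ \tr (w1 *m S) = 1, \tr (w1 *m T) = 0 & \tr (w1 *m N) = 0]
  /\ [/\ \tr (w3 *m S) = 0, \tr (w3 *m T) = 1 & \tr (w3 *m N) = 0]
  /\ [/\ \tr (w0 *m S) = 2, \tr (w0 *m T) = 1 & \tr (w0 *m N) = 4].
Proof.
have [[[_ u1 _] [_ u2 _] [_ u3 _]] orth _] := ts.
have [ o12 o23 o31] := orth i x Ux.
move: (u1 i x Ux) (u2 i x Ux) (u3 i x Ux) => {}u1 {}u2 {}u3.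
have gu := chart_metric_unit gm Ux.
have w0sq X : inner (g i) x (X i x) (X i x) = 1 ->
    \tr (w0 *m square_form g X i x) = 1.
  move=> uX; rewrite trace_square /dual_form -(mulmxA (X i x)) (mulmxV gu) mulmx1.
  have [_ _ gT _] := gm.
  by rewrite trmx_mul gT // mulmxA.
have tB (w P Q : 'M[R]_7) : \tr (w *m (P - Q)) = \tr (w *m P) - \tr (w *m Q).
  by rewrite mulmxBr linearB.
have tD (w P Q : 'M[R]_7) : \tr (w *m (P + Q)) = \tr (w *m P) + \tr (w *m Q).
  by rewrite mulmxDr linearD.
rewrite /S /T /N /transverse_metric !tB !tD /w1 /w3 !trace_outer_square.
rewrite !trace_outer_metric !(w0sq E1 u1) !(w0sq E2 u2) !(w0sq E3 u3).
rewrite u1 u3 o12 (inner_sym (E1 i x)) o31 (inner_sym (E3 i x) (E2 i x)) o23.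
rewrite (mulVmx gu) mxtrace1.
by split; [|split]; split; ring.
Qed.

(** The three tensors are linearly independent at every point, and coefficients
    are read off by fixed linear forms; the number 4 is the dimension of the
    leaf space. *)
Lemma dual_frame : exists wa wb wc : 'M[R]_7, forall p q r : R,
  [/\ \tr (wa *m (p *: S + q *: T + r *: N)) = p,
      \tr (wb *m (p *: S + q *: T + r *: N)) = q
    & \tr (wc *m (p *: S + q *: T + r *: N)) = r].
Proof.
have [[s1 t1 n1] [[s3 t3 n3] [s0 t0 n0]]] := frame_values.
have lin (w X Y Z : 'M[R]_7) p q r : \tr (w *m (p *: X + q *: Y + r *: Z)) =
    p * \tr (w *m X) + q * \tr (w *m Y) + r * \tr (w *m Z).
  by rewrite !mulmxDr -!scalemxAr !mxtraceD !mxtraceZ.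
exists w1, w3, (4^-1 *: (w0 - (w1 + w1) - w3)) => p q r; split.
- by rewrite lin s1 t1 n1; ring.
- by rewrite lin s3 t3 n3; ring.
- have sub (X : 'M[R]_7) : \tr ((w0 - (w1 + w1) - w3) *m X) =
      \tr (w0 *m X) - (\tr (w1 *m X) + \tr (w1 *m X)) - \tr (w3 *m X).
    by rewrite !mulmxBl mulmxDl 2!raddfB raddfD.
  rewrite -scalemxAl mxtraceZ sub !lin s0 t0 n0 s1 t1 n1 s3 t3 n3.
  by field.
Qed.

Lemma metric_family_combination (a b c : R) :
  metric_family g E1 E2 E3 a b c i x = a ^+ 2 *: S + b ^+ 2 *: T + c ^+ 2 *: N.
Proof. by []. Qed.

Lemma flow_at_point (a b c : R -> R) t : 0 < a t -> 0 < b t -> 0 < c t ->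
  is_derive t (1 : R) (fun u => metric_family g E1 E2 E3 (a u) (b u) (c u) i x)
    (- 2 *: ricci (metric_family g E1 E2 E3 (a t) (b t) (c t) i) x)
  <-> flow_equations a b c t.
Proof.
move=> a0 b0 c0; rewrite (ricci_metric_family gm ts a0 b0 c0 Ux) -/S -/T -/N.
have dist (k p q r : R) (X Y Z : 'M[R]_7) : k *: (p *: X + q *: Y + r *: Z) =
    (k * p) *: X + (k * q) *: Y + (k * r) *: Z by rewrite !scalerDr !scalerA.
rewrite dist.
set ra := _ * ricci_a _ _ _; set rb := _ * ricci_b _ _ _; set rc := _ * ricci_c _ _ _.
split=> [dG|[da db dc]].
  have [wa [wb [wc w]]] := dual_frame.
  have dw v := is_derive_trace v dG.
  split.
  - have := dw wa; have [-> _ _] := w ra rb rc.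
    suff -> : (fun u => a u ^+ 2) =
      (fun u => \tr (wa *m metric_family g E1 E2 E3 (a u) (b u) (c u) i x)) by [].
    by apply/funext => u; have [<- _ _] := w (a u ^+ 2) (b u ^+ 2) (c u ^+ 2).
  - have := dw wb; have [_ -> _] := w ra rb rc.
    suff -> : (fun u => b u ^+ 2) =
      (fun u => \tr (wb *m metric_family g E1 E2 E3 (a u) (b u) (c u) i x)) by [].
    by apply/funext => u; have [_ <- _] := w (a u ^+ 2) (b u ^+ 2) (c u ^+ 2).
  - have := dw wc; have [_ _ ->] := w ra rb rc.
    suff -> : (fun u => c u ^+ 2) =
      (fun u => \tr (wc *m metric_family g E1 E2 E3 (a u) (b u) (c u) i x)) by [].
    by apply/funext => u; have [_ _ <-] := w (a u ^+ 2) (b u ^+ 2) (c u ^+ 2).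
apply/is_derive_mxP => j k.
have -> : (fun u => metric_family g E1 E2 E3 (a u) (b u) (c u) i x j k) =
   (S j k \*: (fun u => a u ^+ 2)) + (T j k \*: (fun u => b u ^+ 2))
   + (N j k \*: (fun u => c u ^+ 2)).
  apply/funext => u; rewrite metric_family_combination !(addmxE, scalemxE) !fctE.
  by rewrite /GRing.scale/= mulrC [b u ^+ 2 * _]mulrC [c u ^+ 2 * _]mulrC.
have -> : (ra *: S + rb *: T + rc *: N) j k = S j k *: ra + T j k *: rb + N j k *: rc.
  rewrite !(addmxE, scalemxE).
  by rewrite /GRing.scale/= mulrC [rb * _]mulrC [rc * _]mulrC.
apply: is_deriveD.
Qed.
End AtPoint.

(** All points of M give the same equation; one point is needed to recover the
    equation from the flow. *)
Lemma ricci_flowE (J : set R) (a b c : R -> R) : [set: M] !=set0 ->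
  (forall t, J t -> [/\ 0 < a t, 0 < b t & 0 < c t]) ->
  ricci_flow J (fun t => metric_family g E1 E2 E3 (a t) (b t) (c t)) <->
  forall t, J t -> flow_equations a b c t.
Proof.
move=> [p _] pos; split=> [fl t Jt|fl t i x Jt Ux]; have [a0 b0 c0] := pos t Jt.
  have [i ip] := ch_cover A p; have Ux : ch_img i (ch_coord i p) by exists p.
  exact: (proj1 (flow_at_point Ux a0 b0 c0) (fl t i _ Jt Ux)).
exact: (proj2 (flow_at_point Ux a0 b0 c0) (fl t Jt)).
Qed.

End FlowEquations.

(** * Change of time *)

Section TimeChange.
Variable R : realType.

Lemma is_derive_continuous (W : normedModType R) (f : R -> W) (x : R) (l : W) :
  is_derive x 1 f l -> {for x, continuous f}.
Proof. by case=> df _; apply: differentiable_continuous; exact/derivable1_diffP. Qed.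

Variables (J : set R) (s s' : R -> R).
Hypotheses (oJ : open J) (iJ : is_interval J).
Hypothesis ds : forall t, J t -> is_derive t (1 : R) s (s' t).
Hypothesis s'0 : forall t, J t -> 0 < s' t.

Lemma sub_interval (u v : R) : J u -> J v -> forall t, u <= t <= v -> J t.
Proof. by move=> Ju Jv t; exact: iJ. Qed.

Lemma within_continuous_s u v : J u -> J v -> {within `[u, v], continuous s}.
Proof.
move=> Ju Jv; apply: continuous_in_subspaceT => x; rewrite inE /= in_itv /= => xuv.
by apply: is_derive_continuous (ds _); exact: sub_interval xuv.
Qed.

Lemma increasing_s u v : J u -> J v -> u < v -> s u < s v.
Proof.
move=> Ju Jv uv.
have Jt t : t \in `]u, v[ -> J t.
  by rewrite in_itv /= => /andP[ut tv]; apply: (sub_interval Ju Jv); rewrite !ltW.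
have [t tuv E] := MVT uv (fun t ht => ds (Jt t ht)) (within_continuous_s Ju Jv).
by rewrite -subr_gt0 E mulr_gt0 ?subr_gt0 //; apply: s'0; exact: Jt.
Qed.

Lemma image_between u v y : J u -> J v -> u <= v -> s u <= y <= s v -> (s @` J) y.
Proof.
move=> Ju Jv uv yuv.
have suv : s u <= s v by case/andP: yuv; exact: le_trans.
have [t] : exists2 t, t \in `[u, v] & s t = y.
  apply: IVT => //; first exact: within_continuous_s.
  by rewrite min_l // max_r.
by rewrite in_itv /= => tuv <-; exists t => //; exact: (sub_interval Ju Jv).
Qed.

Lemma image_interval : is_interval (s @` J).
Proof.
move=> _ _ [u Ju <-] [v Jv <-] y yuv.
have [uv|vu] := leP u v; first exact: image_between yuv.
have := increasing_s Jv Ju vu; case/andP: yuv => h1 h2.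
by rewrite ltNge (le_trans h1 h2).
Qed.

Lemma image_open : open (s @` J).
Proof.
rewrite openE => _ [t Jt <-].
have [u ut Ju] := open_interval_lt oJ Jt; have [v tv Jv] := open_interval_gt oJ Jt.
have N1 : \forall y \near s t, s u < y by apply: lt_nbhsr; exact: increasing_s.
have N2 : \forall y \near s t, y < s v by apply: lt_nbhsl; exact: increasing_s.
apply: filterS2 N1 N2 => y h1 h2; apply: (@image_between u v) => //.
  by apply: ltW; exact: lt_trans tv.
by rewrite !ltW.
Qed.

(** A function with positive derivative on an interval is a legitimate change
    of time. *)
Lemma inverse_time : exists r : R -> R, (forall t, J t -> r (s t) = t) /\
  forall t, J t -> is_derive (s t) (1 : R) r (s' t)^-1.
Proof.
pose r y := xget 0 [set t | J t /\ s t = y].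
have rK t : J t -> r (s t) = t.
  move=> Jt; rewrite /r; case: xgetP => [w _ [Jw E]|/(_ t)]; last by case; split.
  apply/eqP; case: (ltgtP w t) => // h.
    by have := increasing_s Jw Jt h; rewrite E ltxx.
  by have := increasing_s Jt Jw h; rewrite E ltxx.
exists r; split=> // t Jt.
have NJ : \forall x \near t, J x by exact: open_nbhs_nbhs.
apply: is_derive_inverse.
- by apply: filterS NJ => x Jx; exact: rK.
- by apply: filterS NJ => x Jx; exact: is_derive_continuous (ds Jx).
- exact: ds.
- by rewrite gt_eqF // s'0.
Qed.

End TimeChange.

(** * The planar system *)

Section FlowField.
Variable R : realType.

(** The right-hand side of the planar system, found by differentiating
    A = a^2/c^2 and B = b^2/c^2 along the flow and multiplying by dt/ds = c^2;
    [flow_A_ricci] and [flow_B_ricci] are this computation. *)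
Definition flow_A (A B : R) : R :=
  - 8 + 4 * B / A + 24 * A - 16 * A ^+ 2 - 4 * A * B.
Definition flow_B (A B : R) : R :=
  - 4 * B ^+ 2 / A ^+ 2 - 12 * B ^+ 2 + 24 * B - 8 * A * B.
Definition flow_field (p : 'rV[R]_2) : 'rV[R]_2 :=
  \row_(j < 2) (if j == 0 then flow_A (p 0 0) (p 0 1) else flow_B (p 0 0) (p 0 1)).

Lemma ord2_cases (j : 'I_2) : j = 0 \/ j = 1.
Proof.
by case: j => [[|[|k]] h] //; [left|right]; apply: val_inj.
Qed.

Lemma is_derive_row2 (z : R -> 'rV[R]_2) (t : R) v :
  is_derive t (1 : R) z v <->
  is_derive t (1 : R) (fun u => z u 0 0) (v 0 0)
  /\ is_derive t (1 : R) (fun u => z u 0 1) (v 0 1).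
Proof.
split=> [/is_derive_mxP dz|[d0 d1]]; first by split; exact: dz.
by apply/is_derive_mxP => i j; rewrite ord1; case: (ord2_cases j) => ->.
Qed.

Lemma flow_field0 p : flow_field p 0 0 = flow_A (p 0 0) (p 0 1).
Proof. by rewrite mxE. Qed.
Lemma flow_field1 p : flow_field p 0 1 = flow_B (p 0 0) (p 0 1).
Proof. by rewrite mxE. Qed.
Lemma ratios0 (a b c : R) : ratios a b c 0 0 = a ^+ 2 / c ^+ 2.
Proof. by rewrite mxE. Qed.
Lemma ratios1 (a b c : R) : ratios a b c 0 1 = b ^+ 2 / c ^+ 2.
Proof. by rewrite mxE. Qed.

Lemma is_derive_quotient (f h : R -> R) (t df dh : R) : h t != 0 ->
  is_derive t (1 : R) f df -> is_derive t (1 : R) h dh ->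
  is_derive t (1 : R) (fun u => f u / h u) (df / h t - f t * dh / h t ^+ 2).
Proof.
move=> h0 hf hh; have hV := is_deriveV h0 hh.
apply: is_derive_eq; rewrite /GRing.scale/=; field.
exact: h0.
Qed.

Lemma is_derive_product (f h : R -> R) (t df dh : R) :
  is_derive t (1 : R) f df -> is_derive t (1 : R) h dh ->
  is_derive t (1 : R) (fun u => f u * h u) (f t * dh + h t * df).
Proof. by move=> hf hh; apply: is_derive_eq. Qed.

Lemma flow_A_ricci (a b c : R) : 0 < a -> 0 < c ->
  c ^+ 2 * ((- 2 * ricci_a a b c) / c ^+ 2
    - a ^+ 2 * (- 2 * ricci_c a b c) / (c ^+ 2) ^+ 2) =
  flow_A (a ^+ 2 / c ^+ 2) (b ^+ 2 / c ^+ 2).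
Proof.
move=> a0 c0; rewrite /ricci_a /ricci_c /flow_A; field.
by rewrite !gt_eqF.
Qed.

Lemma flow_B_ricci (a b c : R) : 0 < a -> 0 < c ->
  c ^+ 2 * ((- 2 * ricci_b a b c) / c ^+ 2
    - b ^+ 2 * (- 2 * ricci_c a b c) / (c ^+ 2) ^+ 2) =
  flow_B (a ^+ 2 / c ^+ 2) (b ^+ 2 / c ^+ 2).
Proof.
move=> a0 c0; rewrite /ricci_b /ricci_c /flow_B; field.
by rewrite !gt_eqF.
Qed.
End FlowField.

Section System.
Variables (R : realType) (M : topologicalType) (A : atlas R 7 M).
Variables (g : tensor2_components A) (E1 E2 E3 : vector_components A).
Hypotheses (gm : riemannian_metric g) (ts : three_sasakian g E1 E2 E3).
Hypothesis M0 : [set: M] !=set0.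

(** The chain rule for the inverse of the time change. *)
Lemma rescaled_flow_ode (K : set R) (z : R -> 'rV[R]_2) : open K -> is_interval K ->
  rescaled_ricci_flow g E1 E2 E3 K z ->
  forall s, K s -> quadrant (z s) /\ is_derive s (1 : R) z (flow_field (z s)).
Proof.
move=> oK iK [J [a [b [c [s [[oJ iJ] pos fl [sJ ds] zr]]]]]].
move/(ricci_flowE gm ts M0 pos) : fl => fl.
have c2 t : J t -> 0 < 1 / c t ^+ 2.
  by move=> Jt; have [_ _ c0] := pos t Jt; rewrite divr_gt0 // exprn_gt0.
have [r [rK dr]] := inverse_time oJ iJ ds c2.
rewrite -sJ => _ [t Jt <-]; have [a0 b0 c0] := pos t Jt.
split.
  by rewrite zr // /quadrant /= ratios0 ratios1; split; rewrite divr_gt0 // exprn_gt0.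
have [da db dc] := fl t Jt.
have cn : c t ^+ 2 != 0 by rewrite expf_neq0 // gt_eqF.
have drt : is_derive (s t) (1 : R) r (c t ^+ 2).
  by have := dr t Jt; rewrite div1r invrK.
have NK : \forall y \near s t, K y by apply: open_nbhs_nbhs; split => //; rewrite -sJ; exists t.
have comp (f : R -> R) (df : R) (j : 'I_2) :
    (forall u, ratios (a u) (b u) (c u) 0 j = f u) ->
    is_derive t (1 : R) f df -> is_derive (s t) (1 : R) (fun y => z y 0 j) (df * c t ^+ 2).
  move=> fE dfs; apply: (@near_eq_is_derive _ _ _ (f \o r)).
    apply: filterS NK => y; rewrite -sJ => -[u Ju <-] /=.
    by rewrite rK // zr // fE.
  by apply: is_derive1_comp; rewrite rK.
apply/is_derive_row2; split.
- rewrite flow_field0 zr // ratios0 ratios1 -flow_A_ricci // mulrC.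
  apply: (comp (fun u => a u ^+ 2 / c u ^+ 2)) => [u|]; first exact: ratios0.
  exact: (@is_derive_quotient _ (fun u => a u ^+ 2) (fun u => c u ^+ 2) t _ _ cn
    da dc).
- rewrite flow_field1 zr // ratios0 ratios1 -flow_B_ricci // mulrC.
  apply: (comp (fun u => b u ^+ 2 / c u ^+ 2)) => [u|]; first exact: ratios1.
  exact: (@is_derive_quotient _ (fun u => b u ^+ 2) (fun u => c u ^+ 2) t _ _ cn
    db dc).
Qed.

(** In the variable s the equation for c^2 is linear, with coefficient h
    depending on A and B only.  So c^2 is the exponential of a primitive of h,
    the time t is a primitive of c^2, and a^2 = A c^2, b^2 = B c^2. *)
Lemma ode_rescaled_flow (K : set R) (z : R -> 'rV[R]_2) : open K -> is_interval K ->
  (forall s, K s -> quadrant (z s) /\ is_derive s (1 : R) z (flow_field (z s))) ->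
  rescaled_ricci_flow g E1 E2 E3 K z.
Proof.
move=> oK iK sol.
pose X s := z s 0 0; pose Y s := z s 0 1.
have X0 s : K s -> 0 < X s by move=> /sol [[]].
have Y0 s : K s -> 0 < Y s by move=> /sol [[]].
have dX s : K s -> is_derive s (1 : R) X (flow_A (X s) (Y s)).
  by move=> /sol [_ /is_derive_row2 [+ _]]; rewrite flow_field0.
have dY s : K s -> is_derive s (1 : R) Y (flow_B (X s) (Y s)).
  by move=> /sol [_ /is_derive_row2 [_ +]]; rewrite flow_field1.
pose h s := - 2 * (12 - 4 * X s - 2 * Y s).
have ch s : K s -> {for s, continuous h}.
  move=> Ks; have cX := is_derive_continuous (dX s Ks).
  have cY := is_derive_continuous (dY s Ks).
  apply: continuousM; first exact: cst_continuous.
  apply: continuousB; [apply: continuousB; [exact: cst_continuous|]|];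
    by apply: continuousM => //; exact: cst_continuous.
have [q dq] := primitive_on oK iK ch.
pose C s := expR (q s).
have C0 s : 0 < C s by exact: expR_gt0.
have dC s : K s -> is_derive s (1 : R) C (C s * h s).
  by move=> Ks; apply: is_derive1_comp (dq s Ks).
have [tau dtau] := primitive_on oK iK (fun s Ks => is_derive_continuous (dC s Ks)).
have tau0 s : K s -> 0 < C s by [].
have [sig [sigK dsig]] := inverse_time oK iK dtau tau0.
pose a t := Num.sqrt (X (sig t) * C (sig t)).
pose b t := Num.sqrt (Y (sig t) * C (sig t)).
pose c t := Num.sqrt (C (sig t)).
pose J := tau @` K.
have oJ : open J := image_open oK iK dtau tau0.
have posJ t : J t -> [/\ 0 < a t, 0 < b t & 0 < c t].
  move=> [s Ks <-]; rewrite /a /b /c sigK //.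
  by split; rewrite sqrtr_gt0 // mulr_gt0 // ?X0 // Y0.
have a2 t : J t -> a t ^+ 2 = X (sig t) * C (sig t).
  by move=> [s Ks <-]; rewrite /a sigK // sqr_sqrtr // ltW // mulr_gt0 // X0.
have b2 t : J t -> b t ^+ 2 = Y (sig t) * C (sig t).
  by move=> [s Ks <-]; rewrite /b sigK // sqr_sqrtr // ltW // mulr_gt0 // Y0.
have c2 t : c t ^+ 2 = C (sig t) by rewrite /c sqr_sqrtr // ltW.
exists J, a, b, c, sig; split => //.
- by split=> //; exact: image_interval iK dtau tau0.
- apply/(ricci_flowE gm ts M0 posJ) => t Jt.
  have [a0 b0 c0] := posJ t Jt.
  have NJ : \forall u \near t, J u by exact: open_nbhs_nbhs.
  have E4 (u : R) : u ^+ 4 = (u ^+ 2) ^+ 2 by rewrite -exprM.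
  have ra : ricci_a (a t) (b t) (c t) = 4 - 2 * Y (sig t) / X (sig t) + 4 * X (sig t) ^+ 2.
    have [s Ks st] := Jt; have Xn : X (sig t) != 0 by rewrite -st sigK // gt_eqF // X0.
    rewrite /ricci_a !E4 a2 // b2 // c2; field.
    by rewrite Xn gt_eqF.
  have rb : ricci_b (a t) (b t) (c t) = (2 * Y (sig t) ^+ 2 / X (sig t) ^+ 2
      + 4 * Y (sig t) ^+ 2).
    have [s Ks st] := Jt; have Xn : X (sig t) != 0 by rewrite -st sigK // gt_eqF // X0.
    rewrite /ricci_b !E4 a2 // b2 // c2; field.
    by rewrite Xn gt_eqF.
  have rc : ricci_c (a t) (b t) (c t) = 12 - 4 * X (sig t) - 2 * Y (sig t).
    by rewrite /ricci_c a2 // b2 // c2; field; rewrite gt_eqF.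
  rewrite /flow_equations ra rb rc.
  have comp (f k : R -> R) (df l : R) : (forall u, J u -> f (sig u) = k u) ->
      is_derive (sig t) (1 : R) f df -> df = l * C (sig t) -> is_derive t (1 : R) k l.
    move=> fk dfs El; apply: (@near_eq_is_derive _ _ _ (f \o sig)).
      by apply: filterS NJ => u Ju; exact: fk.
    have -> : l = df * (C (sig t))^-1 by rewrite El mulfK // gt_eqF.
    apply: is_derive1_comp => //.
    by have [s Ks st] := Jt; rewrite -st sigK //; exact: dsig.
  have Ks : K (sig t) by have [s Ks st] := Jt; rewrite -st sigK.
  have dX' := dX _ Ks; have dY' := dY _ Ks; have dC' := dC _ Ks.
  have Xn : X (sig t) != 0 by rewrite gt_eqF // X0.
  split.
  + apply: (comp (fun s => X s * C s) _ (X (sig t) * (C (sig t) * h (sig t))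
       + C (sig t) * flow_A (X (sig t)) (Y (sig t)))).
    * by move=> u Ju; rewrite a2.
    * by rewrite /h /flow_A; field.
  + apply: (comp (fun s => Y s * C s) _ (Y (sig t) * (C (sig t) * h (sig t))
       + C (sig t) * flow_B (X (sig t)) (Y (sig t)))).
    * by move=> u Ju; rewrite b2.
    * by rewrite /h /flow_B; field.
  + apply: (comp C _ (C (sig t) * h (sig t))) => //.
    by rewrite /h; ring.
- split.
  + apply/seteqP; split=> [_ [_ [s Ks <-] <-]|s Ks]; first by rewrite sigK.
    by exists (tau s); [exists s|rewrite sigK].
  + move=> t [s Ks <-]; rewrite c2 sigK // div1r; exact: dsig.
- move=> t [s Ks <-]; apply/matrixP => i j; rewrite ord1 sigK //.
  have Jt : J (tau s) by exists s.
  case: (ord2_cases j) => ->.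
  + by rewrite ratios0 a2 // c2 sigK // mulfK // gt_eqF.
  + by rewrite ratios1 b2 // c2 sigK // mulfK // gt_eqF.
Qed.

End System.

(** * The critical points *)

Section CriticalPoints.
Variable R : realType.
Implicit Types p v : 'rV[R]_2.

Lemma differentiable_rV (V : normedModType R) n (F : V -> 'rV[R]_n) (p : V) :
  (forall j, differentiable (fun q => F q 0 j) p) -> differentiable F p.
Proof.
move=> dF; have -> : F = \sum_(j < n) (fun q => F q 0 j *: (delta_mx 0 j : 'rV[R]_n)).
  apply/funext => q; rewrite fct_sumE; exact: row_sum_delta.
by apply: differentiable_sum => j; exact: differentiableZl.
Qed.

Lemma flow_field_differentiable p : quadrant p -> differentiable (@flow_field R) p.
Proof.
case=> A0 B0; have An : p 0 0 != 0 by rewrite gt_eqF.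
have dA : differentiable (fun q : 'rV[R]_2 => q 0 0) p by exact: differentiable_coord.
have dB : differentiable (fun q : 'rV[R]_2 => q 0 1) p by exact: differentiable_coord.
have dAi : differentiable (fun q : 'rV[R]_2 => (q 0 0)^-1) p by exact: differentiableV.
have dc (c : R) : differentiable (fun _ : 'rV[R]_2 => c) p by exact: differentiable_cst.
apply: differentiable_rV => j; case: (ord2_cases j) => ->.
- have -> : (fun q : 'rV[R]_2 => flow_field q 0 0) =
    (fun _ => - 8) + (fun _ => 4) * (fun q => q 0 1) * (fun q => (q 0 0)^-1)
    + (fun _ => 24) * (fun q => q 0 0) - (fun _ => 16) * (fun q => q 0 0) * (fun q => q 0 0)
    - (fun _ => 4) * (fun q => q 0 0) * (fun q => q 0 1).
    by apply/funext => q; rewrite flow_field0 /flow_A !fctE expr2 mulrA.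
  by do ?[apply: differentiableB|apply: differentiableD|apply: differentiableM].
- have -> : (fun q : 'rV[R]_2 => flow_field q 0 1) =
    (fun _ => - 4) * (fun q => q 0 1) * (fun q => q 0 1) * (fun q => (q 0 0)^-1)
       * (fun q => (q 0 0)^-1)
    - (fun _ => 12) * (fun q => q 0 1) * (fun q => q 0 1)
    + (fun _ => 24) * (fun q => q 0 1) - (fun _ => 8) * (fun q => q 0 0) * (fun q => q 0 1).
    by apply/funext => q; rewrite flow_field1 /flow_B !fctE !expr2 invfM !mulrA.
  by do ?[apply: differentiableB|apply: differentiableD|apply: differentiableM].
Qed.

(** The differentials of [flow_A] and [flow_B] at (A, B) applied to (x, y). *)
Definition dflow_A (A B x y : R) : R :=
  4 * y / A - 4 * B * x / A ^+ 2 + 24 * x - 32 * A * x - 4 * x * B - 4 * A * y.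
Definition dflow_B (A B x y : R) : R :=
  - 8 * B * y / A ^+ 2 + 8 * B ^+ 2 * x / A ^+ 3 - 24 * B * y + 24 * y
  - 8 * x * B - 8 * A * y.

Lemma derive_flow_field p v : quadrant p ->
  'D_v (@flow_field R) p = \row_(j < 2)
    (if j == 0 then dflow_A (p 0 0) (p 0 1) (v 0 0) (v 0 1)
     else dflow_B (p 0 0) (p 0 1) (v 0 0) (v 0 1)).
Proof.
move=> qp; have [A0 B0] := qp; have An : p 0 0 != 0 by rewrite gt_eqF.
have dF : is_derive (p + (0 : R) *: v) v (@flow_field R) ('D_v (@flow_field R) p).
  rewrite scale0r addr0; apply: derivableP; apply: diff_derivable.
  exact: flow_field_differentiable.
have /is_derive_row2 [d0 d1] := is_derive_line dF.
have dL (k : 'I_2) : is_derive (0 : R) 1 (fun r : R => p 0 k + r * v 0 k) (v 0 k).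
  apply: is_derive_eq; rewrite /GRing.scale/=; ring.
have dA := dL 0; have dB := dL 1.
have LE (r : R) k : (p + r *: v) 0 k = p 0 k + r * v 0 k by rewrite !mxE.
have An0 : p 0 0 + 0 * v 0 0 != 0 by rewrite mul0r addr0.
have dAi := @is_deriveV _ (fun r : R => p 0 0 + r * v 0 0) 0 _ 1 An0 dA.
apply/matrixP => i j; rewrite ord1 [RHS]mxE; case: (ord2_cases j) => -> /=.
- have E : is_derive (0 : R) 1 (fun r : R => flow_field (p + r *: v) 0 0)
      (dflow_A (p 0 0) (p 0 1) (v 0 0) (v 0 1)).
    have -> : (fun r : R => flow_field (p + r *: v) 0 0) =
      (fun r => flow_A (p 0 0 + r * v 0 0) (p 0 1 + r * v 0 1)).
      by apply/funext => r; rewrite flow_field0 !LE.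
    rewrite /flow_A; apply: is_derive_eq.
    rewrite /GRing.scale/= /dflow_A !mul0r !addr0; field.
    exact: An.
  by case: E => _ <-; case: d0 => _ <-.
- have E : is_derive (0 : R) 1 (fun r : R => flow_field (p + r *: v) 0 1)
      (dflow_B (p 0 0) (p 0 1) (v 0 0) (v 0 1)).
    have -> : (fun r : R => flow_field (p + r *: v) 0 1) =
      (fun r => flow_B (p 0 0 + r * v 0 0) (p 0 1 + r * v 0 1)).
      by apply/funext => r; rewrite flow_field1 !LE.
    rewrite /flow_B.
    have -> : (fun r => - 4 * (p 0 1 + r * v 0 1) ^+ 2 / (p 0 0 + r * v 0 0) ^+ 2 -
        12 * (p 0 1 + r * v 0 1) ^+ 2 + 24 * (p 0 1 + r * v 0 1) -
        8 * (p 0 0 + r * v 0 0) * (p 0 1 + r * v 0 1)) =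
      (fun r => - 4 * (p 0 1 + r * v 0 1) ^+ 2 * ((p 0 0 + r * v 0 0)^-1) ^+ 2 -
        12 * (p 0 1 + r * v 0 1) ^+ 2 + 24 * (p 0 1 + r * v 0 1) -
        8 * (p 0 0 + r * v 0 0) * (p 0 1 + r * v 0 1)).
      by apply/funext => r; rewrite exprVn.
    apply: is_derive_eq.
    rewrite /GRing.scale/= /dflow_B !mul0r !addr0; field.
    exact: An.
  by case: E => _ <-; case: d1 => _ <-.
Qed.

Lemma ratios_M : ratios (1 : R) 1 1 = const_mx 1.
Proof.
by apply/matrixP => i j; rewrite !mxE expr1n divr1; case: ifP.
Qed.

Lemma ratios_squashed :
  ratios (Num.sqrt (1 / 5 : R)) (Num.sqrt (1 / 5)) 1 = const_mx (1 / 5).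
Proof.
apply/matrixP => i j; rewrite !mxE expr1n divr1 sqr_sqrtr ?divr_ge0 //.
by case: ifP.
Qed.

Lemma flow_field_M : flow_field (const_mx (1 : R)) = 0.
Proof.
apply/matrixP => i j; rewrite ord1 mxE; case: (ord2_cases j) => -> /=.
- by rewrite /flow_A !mxE divr1; ring.
- by rewrite /flow_B !mxE expr1n divr1; ring.
Qed.

Lemma quadrant_const (c : R) : 0 < c -> quadrant (const_mx c : 'rV[R]_2).
Proof. by move=> c0; split; rewrite mxE. Qed.

(** The eigenvectors are (1, 1), along the invariant diagonal, and (1, - 2). *)
Lemma squashed_saddle : saddle_point (@flow_field R) (const_mx (1 / 5)).
Proof.
have q5 : quadrant (const_mx (1 / 5) : 'rV[R]_2) by apply: quadrant_const.
split.
  apply/matrixP => i j; rewrite ord1 mxE; case: (ord2_cases j) => -> /=.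
  - by rewrite /flow_A !mxE; field.
  - by rewrite /flow_B !mxE; field.
have J v : v *m 'J (@flow_field R) (const_mx (1 / 5)) = 'D_v (@flow_field R) (const_mx (1 / 5)).
  by rewrite deriveEjacobian //; exact: flow_field_differentiable.
exists 16, (- (208 / 5)); split.
- by [].
- by rewrite oppr_lt0 divr_gt0.
- apply/eigenvalueP; exists (const_mx 1).
    rewrite J derive_flow_field //; apply/matrixP => i j; rewrite ord1 !mxE.
    by case: (ord2_cases j) => -> /=; rewrite /dflow_A /dflow_B; field.
  by apply/eqP => /matrixP/(_ 0 0); rewrite !mxE => /eqP; rewrite oner_eq0.
- apply/eigenvalueP; exists (\row_(j < 2) (if j == 0 then 1 else - 2)).
    rewrite J derive_flow_field //; apply/matrixP => i j; rewrite ord1 !mxE.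
    by case: (ord2_cases j) => -> /=; rewrite /dflow_A /dflow_B; field.
  by apply/eqP => /matrixP/(_ 0 0); rewrite !mxE => /eqP; rewrite oner_eq0.
Qed.

End CriticalPoints.

(** * Picard iteration *)

Section RowNorm.
Variables (R : realType) (m : nat).
Implicit Types v : 'rV[R]_m.

Lemma norm_rV_le v e : 0 <= e -> (`|v| <= e) <-> (forall j, `|v 0 j| <= e).
Proof.
move=> e0; rewrite [`|v|]mx_normrE; split=> [h j|h].
  exact: le_trans (le_bigmax _ _ (0, j)) h.
by apply: bigmax_le => // -[i j] _; rewrite ord1.
Qed.

Lemma coord_le_norm v j : `|v 0 j| <= `|v|.
Proof. by apply: (proj1 (norm_rV_le v (normr_ge0 v))). Qed.

Lemma cvg_row (T : Type) (F : set_system T) {FF : Filter F} (f : T -> 'rV[R]_m) v :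
  (forall j, f x 0 j @[x --> F] --> v 0 j) -> f x @[x --> F] --> v.
Proof.
move=> cj; apply/cvgrPdist_le => e e0.
have : \forall x \near F, forall j, `|v 0 j - f x 0 j| <= e.
  by apply: filter_forall => j; move/cvgrPdist_le : (cj j); exact.
apply: filterS => x hx; apply/norm_rV_le => [|j]; first exact: ltW.
by rewrite !mxE; exact: hx.
Qed.

End RowNorm.

Section Clamp.
Variables (R : realType) (c d : R).
Hypothesis d0 : 0 <= d.

(** The nearest point of the interval of centre c and radius d; composing with
    it makes a locally Lipschitz equation globally Lipschitz. *)
Definition clamp (t : R) : R := Num.max (c - d) (Num.min t (c + d)).

Let clampE t : [\/ t <= c - d /\ clamp t = c - d, c - d <= t <= c + d /\ clamp t = t |
  c + d <= t /\ clamp t = c + d].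
Proof.
rewrite /clamp; case: (leP t (c + d)) => h1;
  [case: (leP (c - d) t)|case: (leP (c - d) (c + d))] => h2.
- by constructor 2; split=> //; apply/andP.
- by constructor 1; split=> //; exact: ltW.
- by constructor 3; split=> //; exact: ltW.
- by have := d0; lra.
Qed.

Lemma clamp_in t : `|clamp t - c| <= d.
Proof.
have := d0; rewrite ler_norml.
by case: (clampE t) => [] [h ->] ?; apply/andP; split; move: h; lra.
Qed.

Lemma clamp_id t : `|t - c| <= d -> clamp t = t.
Proof. by rewrite ler_norml => /andP[]; case: (clampE t) => [] [h ->]; lra. Qed.

Lemma clamp_lip t u : `|clamp t - clamp u| <= `|t - u|.
Proof.
have n1 := ler_norm (t - u); have n2 := ler_norm (u - t); rewrite distrC in n2.
rewrite ler_norml; have := d0.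
by case: (clampE t) => [] [h ->]; case: (clampE u) => [] [k ->] ?;
  apply/andP; split; move: h k; lra.
Qed.

Lemma clamp_continuous : continuous clamp.
Proof.
move=> t; apply: (@continuous_max _ _ (cst (c - d)) (fun x => Num.min x (c + d))).
  exact: cst_continuous.
apply: (@continuous_min _ _ (fun x => x) (cst (c + d))).
  exact: cvg_id.
exact: cst_continuous.
Qed.

End Clamp.

Section Picard.
Variables (R : realType) (m : nat) (r0 : R) (w0 : 'rV[R]_m).

Lemma row_primitive (f : R -> 'rV[R]_m) : continuous f ->
  exists P : R -> 'rV[R]_m, P r0 = w0 /\ forall r, is_derive r (1 : R) P (f r).
Proof.
move=> cf.
have cfj j : forall r, setT r -> {for r, continuous (fun u => f u 0 j)}.
  move=> r _; apply: (@continuous_comp _ _ _ f (fun N : 'rV[R]_m => N 0 j) r (cf r)).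
  exact: coord_continuous.
have oT : open [set: R] by exact: openT.
have iT : is_interval [set: R] by [].
have P j := cid (primitive_on oT iT (cfj j)).
exists (fun r => \row_j (projT1 (P j) r - projT1 (P j) r0 + w0 0 j)); split.
  by apply/matrixP => i j; rewrite ord1 !mxE subrr add0r.
move=> r; apply/is_derive_mxP => i j; rewrite ord1.
have dP := projT2 (P j) r I.
have -> : (fun u => (\row_j (projT1 (P j) u - projT1 (P j) r0 + w0 0 j)) 0 j) =
    (fun u => projT1 (P j) u + (w0 0 j - projT1 (P j) r0)).
  by apply/funext => u; rewrite mxE addrAC addrA.
rewrite -[f r 0 j]addr0; apply: is_deriveD.
Qed.

(** The primitive of f with value w0 at r0; the constant w0 is a default value
    for functions that are not continuous. *)
Definition prim (f : R -> 'rV[R]_m) : R -> 'rV[R]_m :=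
  if pselect (continuous f) is left cf then projT1 (cid (row_primitive cf)) else cst w0.

Lemma prim0 f : prim f r0 = w0.
Proof. by rewrite /prim; case: pselect => // cf; case: cid => P []. Qed.

Lemma prim_derive f r : continuous f -> is_derive r (1 : R) (prim f) (f r).
Proof. by rewrite /prim; case: pselect => // cf _; case: cid => P [_ dP] /=. Qed.

Lemma prim_continuous f : continuous f -> continuous (prim f).
Proof. by move=> cf r; exact: is_derive_continuous (prim_derive r cf). Qed.

(** On the interval of radius 1 around r0 a bound on the derivative of h is a
    bound on h. *)
Lemma mean_value_bound (h dh : R -> R) (e r : R) :
  (forall u, `|u - r0| <= 1 -> is_derive u (1 : R) h (dh u)) -> h r0 = 0 ->
  `|r - r0| <= 1 -> 0 <= e ->
  (forall u, `|u - r0| <= 1 -> `|dh u| <= e) -> `|h r| <= e.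
Proof.
move=> dh_ h0 r1 e0 bd.
have fin u : `|u - r0| <= 1 -> `|dh u * (r - r0)| <= e.
  by move=> u1; rewrite normrM -[e]mulr1 ler_pM //; exact: bd.
have mvt a b : a <= b -> (forall u, a <= u <= b -> `|u - r0| <= 1) ->
    exists2 c, a <= c <= b & h b - h a = dh c * (b - a).
  move=> ab ab1; have [||c] := @MVT_segment _ h dh a b ab.
  - move=> u; rewrite in_itv /= => /andP[au ub].
    by apply: dh_; apply: ab1; rewrite !ltW.
  - apply: continuous_in_subspaceT => u; rewrite inE /= in_itv /= => uab.
    exact: is_derive_continuous (dh_ u (ab1 u uab)).
  - by rewrite in_itv /= => cab E; exists c.
move: (r1); rewrite ler_norml => /andP[r1a r1b].
have near1 u : r0 <= u <= r \/ r <= u <= r0 -> `|u - r0| <= 1.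
  by move=> hu; rewrite ler_norml; apply/andP; case: hu => /andP[]; split; lra.
have [rr|rr] := leP r0 r.
- have [c cab E] := mvt _ _ rr (fun u hu => near1 u (or_introl hu)).
  by rewrite -[h r]subr0 -h0 E; apply: fin; apply: near1; left.
- have [c cab E] := mvt _ _ (ltW rr) (fun u hu => near1 u (or_intror hu)).
  have -> : h r = dh c * (r - r0).
    by rewrite -[LHS]opprK -[- h r]add0r -{1}h0 E -mulrN opprB.
  by apply: fin; apply: near1; right.
Qed.

Lemma prim_dist (f k : R -> 'rV[R]_m) e : continuous f -> continuous k -> 0 <= e ->
  (forall u, `|u - r0| <= 1 -> `|f u - k u| <= e) ->
  forall r, `|r - r0| <= 1 -> `|prim f r - prim k r| <= e.
Proof.
move=> cf ck e0 fk r r1; apply/norm_rV_le => // j.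
have -> : (prim f r - prim k r) 0 j = prim f r 0 j - prim k r 0 j by rewrite !mxE.
apply: (@mean_value_bound (fun u => prim f u 0 j - prim k u 0 j)
   (fun u => f u 0 j - k u 0 j)) => // [u _||u u1].
- have /is_derive_mxP/(_ 0 j) d1 := prim_derive u cf.
  have /is_derive_mxP/(_ 0 j) d2 := prim_derive u ck.
  exact: is_deriveB.
- by rewrite !prim0 subrr.
- apply: le_trans (fk u u1).
  by have := coord_le_norm (f u - k u) j; rewrite !mxE.
Qed.

Variable H : R -> 'rV[R]_m -> 'rV[R]_m.
Hypothesis cH : forall w : R -> 'rV[R]_m, continuous w -> continuous (fun r => H r (w r)).
Hypothesis lipH : forall r x y, `|r - r0| <= 1 -> `|H r x - H r y| <= 2^-1 * `|x - y|.

Fixpoint picard_iter (n : nat) : R -> 'rV[R]_m :=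
  if n is n'.+1 then prim (fun r => H r (picard_iter n' r)) else cst w0.
Local Notation w := picard_iter.

Lemma picard_iter_continuous n : continuous (w n).
Proof.
elim: n => [|n IH] /=; first by move=> r; exact: cst_continuous.
by apply: prim_continuous; exact: cH.
Qed.

Lemma picard_first_bound : exists2 M, 0 <= M &
  forall r, `|r - r0| <= 1 -> `|w 1 r - w 0 r| <= M.
Proof.
have c1 : continuous (fun r => `|w 1 r - w 0 r|).
  move=> r; apply: (@continuous_comp _ _ _ (fun r => w 1 r - w 0 r) Num.norm r).
    by apply: continuousB; exact: picard_iter_continuous.
  exact: norm_continuous.
have ab : r0 - 1 <= r0 + 1 by lra.
have [c _ cM] := EVT_max ab (continuous_subspaceT c1).
exists `|w 1 c - w 0 c| => // r r1; apply: cM.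
by rewrite in_itv /=; move: r1; rewrite ler_norml => /andP[]; lra.
Qed.

Lemma picard_cauchy : exists2 M, 0 <= M & forall r, `|r - r0| <= 1 ->
  forall n k, `|w (n + k) r - w n r| <= M * 2^-1 ^+ n.
Proof.
have [M M0 bM] := picard_first_bound.
have half0 n : 0 <= 2^-1 ^+ n :> R by rewrite exprn_ge0 // invr_ge0.
have step n r : `|r - r0| <= 1 -> `|w n.+1 r - w n r| <= M * 2^-1 ^+ n.
  elim: n r => [|n IH] r r1; first by rewrite expr0 mulr1; exact: bM.
  apply: (prim_dist (cH (@picard_iter_continuous n.+1)) (cH (@picard_iter_continuous n))
    _ _ r1); first by rewrite mulr_ge0.
  move=> u u1; apply: (le_trans (lipH _ _ u1)).
  by rewrite exprS mulrCA ler_wpM2l ?invr_ge0 //; exact: IH.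
exists (M * 2) => [|r r1 n k]; first by rewrite mulr_ge0.
have : `|w (n + k) r - w n r| <= M * 2 * (2^-1 ^+ n - 2^-1 ^+ (n + k)).
  elim: k => [|k IH]; first by rewrite addn0 !subrr normr0 mulr0.
  rewrite addnS.
  have -> : w (n + k).+1 r - w n r = (w (n + k).+1 r - w (n + k)%N r) + (w (n + k)%N r - w n r).
    by rewrite addrA subrK.
  apply: (le_trans (ler_normD _ _)).
  apply: (le_trans (lerD (step (n + k)%N r r1) IH)).
  by rewrite exprS; move: (2^-1 ^+ (n + k)) (2^-1 ^+ n) => p q; rewrite le_eqVlt; apply/orP; left; apply/eqP; field.
move/le_trans; apply; rewrite ler_wpM2l ?mulr_ge0 //.
by rewrite lerBlDr lerDl.
Qed.

Lemma half_small (M e : R) : 0 <= M -> 0 < e -> exists n, M * 2^-1 ^+ n < e.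
Proof.
move=> M0 e0; have h1 : `|2^-1 : R| < 1.
  by rewrite ger0_norm ?invr_ge0 // invf_lt1 // ltr1n.
have /cvgrPdist_lt/(_ e e0) [N _ hN] := cvg_geometric M h1.
exists N; have := hN N (leqnn N); rewrite /= sub0r normrN.
by rewrite ger0_norm // mulr_ge0 // exprn_ge0 // invr_ge0.
Qed.

Lemma picard_limit : exists2 M, 0 <= M & exists u : R -> 'rV[R]_m,
  forall r, `|r - r0| <= 1 -> forall n, `|w n r - u r| <= M * 2^-1 ^+ n.
Proof.
have [M M0 cau] := picard_cauchy; exists M => //.
exists (fun r => lim (w n r @[n --> \oo])) => r r1 n.
have cv : cvg (w n r @[n --> \oo]).
  apply/cauchy_cvgP; apply: cauchy_exP => e e0.
  have [N hN] := half_small M0 e0; exists (w N r); exists N => // k /= Nk.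
  rewrite -ball_normE /ball_ /=; apply: le_lt_trans hN.
  by rewrite distrC -(subnKC Nk); exact: cau.
apply/ler_addgt0Pl => e e0.
have [N _ hN] := (cvgrPdist_lt _ _).1 cv e e0.
have := hN (n + N)%N (leq_addl _ _) => /= /ltW L1.
have -> : w n r - lim (w n r @[n --> \oo]) =
   - (w (n + N)%N r - w n r) - (lim (w n r @[n --> \oo]) - w (n + N)%N r).
  by rewrite opprB opprB addrA subrK.
apply: (le_trans (ler_normB _ _)); rewrite normrN addrC lerD //.
exact: cau.
Qed.

(** On an interval of radius 1 the Lipschitz constant 1/2 makes the integral
    operator a contraction with factor 1/2.  The iterates converge uniformly to
    a limit u, and the sought solution is the primitive of H r (u r), which
    coincides with u. *)
Theorem picard : exists v : R -> 'rV[R]_m, v r0 = w0 /\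
  forall r, `|r - r0| <= 1 -> is_derive r (1 : R) v (H r (v r)).
Proof.
have [M M0 [u uw]] := picard_limit.
pose ut r := u (clamp r0 1 r).
have cut : continuous ut.
  move=> r; apply/cvgrPdist_lt => e e0.
  have e3 : 0 < e / 3 by rewrite divr_gt0.
  have [n hn] := half_small M0 e3.
  have cwc : {for r, continuous (fun y => w n (clamp r0 1 y))}.
    apply: (@continuous_comp _ _ _ (clamp r0 1) (w n)); first exact: clamp_continuous.
    exact: picard_iter_continuous.
  move/cvgrPdist_lt : cwc => /(_ _ e3); apply: filterS => y L.
  have L1 := le_lt_trans (uw _ (clamp_in r0 ler01 r) n) hn.
  have L2 := le_lt_trans (uw _ (clamp_in r0 ler01 y) n) hn.
  rewrite /ut; set a := u _; set b := u _.
  have -> : a - b = - (w n (clamp r0 1 r) - a) + ((w n (clamp r0 1 r) - w n (clamp r0 1 y))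
      + (w n (clamp r0 1 y) - b)).
    by mx_linear.
  apply: (le_lt_trans (ler_normD _ _)); rewrite normrN.
  apply: (le_lt_trans (lerD (lexx _) (ler_normD _ _))).
  move: L L1 L2; rewrite -/a -/b; set p := `| _ |; set q := `| _ |; set s := `| _ |; lra.
pose v := prim (fun r => H r (ut r)).
have vu r : `|r - r0| <= 1 -> v r = u r.
  move=> r1; apply/eqP; rewrite -subr_eq0 -normr_le0; apply/ler_addgt0Pl => e e0.
  rewrite addr0; have e2 : 0 < e / 2 by rewrite divr_gt0.
  have [n hn] := half_small M0 e2.
  have L1 : `|v r - w n.+1 r| <= e / 2.
    apply: (prim_dist (cH cut) (cH (@picard_iter_continuous n)) (ltW e2) _ r1).
    move=> y y1; apply: (le_trans (lipH _ _ y1)); rewrite /ut (clamp_id ler01) //.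
    rewrite distrC; have := uw y y1 n; have := normr_ge0 (w n y - u y).
    by move: (`|_|) => q; lra.
  have L2 : `|w n.+1 r - u r| <= e / 2.
    apply: (le_trans (uw r r1 n.+1)); rewrite exprS mulrCA.
    have : 0 <= M * 2^-1 ^+ n by rewrite mulr_ge0 // exprn_ge0 // invr_ge0.
    by move: hn; move: (M * _) => q; lra.
  rewrite -(subrK (w n.+1 r) (v r)) -addrA.
  by apply: (le_trans (ler_normD _ _)); rewrite (splitr e) lerD.
exists v; split; first exact: prim0.
move=> r r1; have := prim_derive r (cH cut); rewrite -/v /ut (clamp_id ler01) // vu //.
Qed.

End Picard.

(** * Global solutions near the three-Sasakian metric *)

Section BoundedLipschitz.
Variable R : realType.
Implicit Types b l p q D : R.

(** A bound and a Lipschitz estimate for the values p and q of one function at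
    two points at distance D, kept together because the estimate for a product
    needs the bounds on the factors. *)
Definition blip D b l p q : Prop := [/\ `|p| <= b, `|q| <= b & `|p - q| <= l * D].

Lemma blip_mul D b1 l1 p1 q1 b2 l2 p2 q2 : 0 <= D -> 0 <= l1 -> 0 <= l2 ->
  blip D b1 l1 p1 q1 -> blip D b2 l2 p2 q2 ->
  blip D (b1 * b2) (b1 * l2 + b2 * l1) (p1 * p2) (q1 * q2).
Proof.
move=> D0 l10 l20 [hp1 hq1 h1] [hp2 hq2 h2]; split.
- by rewrite normrM ler_pM.
- by rewrite normrM ler_pM.
have -> : p1 * p2 - q1 * q2 = p1 * (p2 - q2) + q2 * (p1 - q1) by ring.
apply: (le_trans (ler_normD _ _)); rewrite !normrM mulrDl -!mulrA.
by apply: lerD; apply: ler_pM.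
Qed.

Lemma blip_add D b1 l1 p1 q1 b2 l2 p2 q2 :
  blip D b1 l1 p1 q1 -> blip D b2 l2 p2 q2 ->
  blip D (b1 + b2) (l1 + l2) (p1 + p2) (q1 + q2).
Proof.
move=> [hp1 hq1 h1] [hp2 hq2 h2]; split.
- by apply: (le_trans (ler_normD _ _)); exact: lerD.
- by apply: (le_trans (ler_normD _ _)); exact: lerD.
have -> : p1 + p2 - (q1 + q2) = (p1 - q1) + (p2 - q2) by ring.
by apply: (le_trans (ler_normD _ _)); rewrite mulrDl; exact: lerD.
Qed.

Lemma blip_same D b c : 0 <= D -> `|c| <= b -> blip D b 0 c c.
Proof. by move=> D0 cb; split => //; rewrite subrr normr0 mul0r. Qed.

Lemma blip_inv1 D b l p q : 0 <= D -> 0 <= l -> b <= 1 / 2 -> blip D b l p q ->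
  blip D 2 (4 * l) (1 + p)^-1 (1 + q)^-1.
Proof.
move=> D0 l0 b2 [hp hq h].
have pos x : `|x| <= b -> 1 / 2 <= 1 + x.
  by rewrite ler_norml => /andP[]; lra.
have inv x : `|x| <= b -> `|(1 + x)^-1| <= 2.
  move=> xb; have x2 := pos x xb; have x0 : 0 < 1 + x by lra.
  rewrite ger0_norm ?invr_ge0 ?(ltW x0) //.
  by rewrite -[2]invrK lef_pV2 ?posrE ?invr_gt0 //; move: x2; rewrite div1r.
split; [exact: inv|exact: inv|].
have p0 : 1 + p != 0 by have := pos p hp; case: eqP => // ->; lra.
have q0 : 1 + q != 0 by have := pos q hq; case: eqP => // ->; lra.
have -> : (1 + p)^-1 - (1 + q)^-1 = (1 + p)^-1 * (1 + q)^-1 * (q - p).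
  by field; rewrite q0 p0.
rewrite !normrM [`|q - p|]distrC -mulrA.
have -> : 4 * l * D = 2 * 2 * (l * D) by ring.
rewrite -[2 * 2 * _]mulrA; apply: ler_pM; [by []|by rewrite mulr_ge0|exact: inv|].
by apply: ler_pM => //; exact: inv.
Qed.

Lemma blip_le D b l b' l' p q : 0 <= D -> b <= b' -> l <= l' ->
  blip D b l p q -> blip D b' l' p q.
Proof.
move=> D0 bb ll [hp hq h]; split; [exact: le_trans bb|exact: le_trans bb|].
by apply: (le_trans h); exact: ler_wpM2r.
Qed.

End BoundedLipschitz.

(** The size of the neighbourhood in which all estimates are made. *)
Definition lin_radius (R : realType) : R := 1 / 100.
Arguments lin_radius {R}.

Section Linearised.
Variable R : realType.

(** The right-hand side of the equations for X = x/r and V = y/r as functions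
    of r = exp (- 16 s), where x = A - 1 and y = B/A - 1: the linear terms
    - 16 x and - 16 y have been absorbed by the substitution. *)
Definition lin_X (r X V : R) : R :=
  (20 * (X * X) + 8 * (V * X) + 4 * (r * (V * (X * X)))) * 16^-1.
Definition lin_V (r X V : R) : R :=
  V * V + 2^-1 * (r * (V * (1 + r * V) * (X * X) * (1 + r * X)^-1)).

(** Every term is at least quadratic in X and V, hence small with a small
    Lipschitz constant.  The bound lin_radius / 2 keeps the solution inside the
    neighbourhood over a parameter interval of length 1. *)
Lemma lin_blip D r X X' V V' : 0 <= D -> `|r - 1| <= 1 ->
  blip D lin_radius 1 X X' -> blip D lin_radius 1 V V' ->
  blip D (lin_radius / 2) 2^-1 (lin_X r X V) (lin_X r X' V') /\
  blip D (lin_radius / 2) 2^-1 (lin_V r X V) (lin_V r X' V').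
Proof.
move=> D0 r1 hX hV.
have cst (c : R) : 0 <= c -> blip D c 0 c c.
  by move=> c0; apply: blip_same => //; rewrite ger0_norm.
have hr : blip D 2 0 r r.
  by apply: blip_same => //; move: r1; rewrite !ler_norml => /andP[]; lra.
have rad : lin_radius = 1 / 100 :> R by [].
have hXX := blip_mul D0 ler01 ler01 hX hX.
have l1 : 0 <= lin_radius * 1 + lin_radius * 1 :> R by rewrite rad; lra.
have hVX := blip_mul D0 ler01 ler01 hV hX.
have hVXX := blip_mul D0 ler01 l1 hV hXX.
split.
- have l2 : 0 <= lin_radius * (lin_radius * 1 + lin_radius * 1) + lin_radius * lin_radius * 1 :> R.
    by rewrite rad; lra.
  have hrVXX := blip_mul D0 (lexx _) l2 hr hVXX.
  have l3 : 0 <= 2 * (lin_radius * (lin_radius * 1 + lin_radius * 1) + lin_radius * lin_radius * 1)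
      + lin_radius * (lin_radius * lin_radius) * 0 :> R by rewrite rad; lra.
  have h20 := blip_mul D0 (lexx _) l1 (cst 20 (ler0n _ 20)) hXX.
  have h8 := blip_mul D0 (lexx _) l1 (cst 8 (ler0n _ 8)) hVX.
  have h4 := blip_mul D0 (lexx _) l3 (cst 4 (ler0n _ 4)) hrVXX.
  have hs := blip_add (blip_add h20 h8) h4.
  have i16 : 0 <= 16^-1 :> R by rewrite invr_ge0.
  have := blip_mul D0 _ (lexx _) hs (cst _ i16).
  move=> /(_ ltac:(rewrite rad; lra)); apply: blip_le => //; rewrite rad; lra.
- have hVV := blip_mul D0 ler01 ler01 hV hV.
  have hrV := blip_mul D0 (lexx _) ler01 hr hV.
  have hrX := blip_mul D0 (lexx _) ler01 hr hX.
  have l2 : 0 <= 2 * 1 + lin_radius * 0 :> R by lra.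
  have h1rV := blip_add (cst 1 ler01) hrV.
  have l3 : 0 <= 0 + (2 * 1 + lin_radius * 0) :> R by lra.
  have hVV1 := blip_mul D0 ler01 l3 hV h1rV.
  have {}hVV1 : blip D (1 / 90) 2 (V * (1 + r * V)) (V' * (1 + r * V')).
    by move: hVV1; apply: blip_le => //; rewrite rad; lra.
  have hVVXX := blip_mul D0 (ler0n _ 2) l1 hVV1 hXX.
  have {}hVVXX : blip D (1 / 1000) (1 / 500) (V * (1 + r * V) * (X * X))
      (V' * (1 + r * V') * (X' * X')).
    by move: hVVXX; apply: blip_le => //; rewrite rad; lra.
  have l2' : 2 * lin_radius <= 1 / 2 :> R by rewrite rad; lra.
  have hinv := blip_inv1 D0 l2 l2' hrX.
  have l5 : 0 <= 1 / 500 :> R by lra.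
  have l6 : 0 <= 4 * (2 * 1 + lin_radius * 0) :> R by lra.
  have hall := blip_mul D0 l5 l6 hVVXX hinv.
  have l7 : 0 <= 1 / 1000 * (4 * (2 * 1 + lin_radius * 0)) + 2 * (1 / 500) :> R by lra.
  have hrall := blip_mul D0 (lexx _) l7 hr hall.
  have {}hrall : blip D (1 / 200) (1 / 10) (r * (V * (1 + r * V) * (X * X) * (1 + r * X)^-1))
      (r * (V' * (1 + r * V') * (X' * X') * (1 + r * X')^-1)).
    by move: hrall; apply: blip_le => //; lra.
  have i2 : 0 <= 2^-1 :> R by rewrite invr_ge0.
  have l8 : 0 <= 1 / 10 :> R by lra.
  have h2 := blip_mul D0 (lexx _) l8 (cst _ i2) hrall.
  have := blip_add hVV h2; apply: blip_le => //; rewrite rad; lra.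
Qed.

End Linearised.

Section Existence.
Variable R : realType.

Let rad : lin_radius = 1 / 100 :> R. Proof. by []. Qed.
Let rad0 : 0 <= lin_radius :> R. Proof. by rewrite rad; lra. Qed.

(** Clamping X, V and the parameter r makes the equation globally Lipschitz and
    continuous; it is unchanged where the solution turns out to live. *)
Definition lin_field (r : R) (w : 'rV[R]_2) : 'rV[R]_2 :=
  let X := clamp 0 lin_radius (w 0 0) in let V := clamp 0 lin_radius (w 0 1) in
  \row_(j < 2) (if j == 0 then lin_X (clamp 1 1 r) X V else lin_V (clamp 1 1 r) X V).

Lemma clamp0_in (t : R) : `|clamp 0 lin_radius t| <= lin_radius :> R.
Proof. by have := clamp_in 0 rad0 t; rewrite subr0. Qed.

Lemma lin_field_lipschitz r x y : `|lin_field r x - lin_field r y| <= 2^-1 * `|x - y|.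
Proof.
have D0 : 0 <= `|x - y| by [].
have b (k : 'I_2) : blip `|x - y| lin_radius 1 (clamp 0 lin_radius (x 0 k))
    (clamp 0 lin_radius (y 0 k)).
  split; [exact: clamp0_in|exact: clamp0_in|].
  rewrite mul1r; apply: (le_trans (clamp_lip 0 rad0 _ _)).
  by have := coord_le_norm (x - y) k; rewrite !mxE.
have [[_ _ lX] [_ _ lV]] := lin_blip D0 (clamp_in 1 ler01 r) (b 0) (b 1).
apply/norm_rV_le => [|j]; first by rewrite mulr_ge0 ?invr_ge0.
by case: (ord2_cases j) => ->; rewrite !mxE.
Qed.

Lemma lin_field_le r w j : `|lin_field r w 0 j| <= lin_radius / 2 :> R.
Proof.
have b (k : 'I_2) : blip 0 lin_radius 1 (clamp 0 lin_radius (w 0 k))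
    (clamp 0 lin_radius (w 0 k)).
  by split; [exact: clamp0_in|exact: clamp0_in|rewrite subrr normr0 mulr0].
have [[lX _ _] [lV _ _]] := lin_blip (lexx 0) (clamp_in 1 ler01 r) (b 0) (b 1).
by case: (ord2_cases j) => ->; rewrite !mxE.
Qed.

Lemma lin_field_continuous (w : R -> 'rV[R]_2) :
  continuous w -> continuous (fun r => lin_field r (w r)).
Proof.
move=> cw r.
have cc (c : R) : {for r, continuous (fun _ : R => c)} by exact: cst_continuous.
have cr : {for r, continuous (clamp 1 (1 : R))} by exact: clamp_continuous.
have ck (k : 'I_2) : {for r, continuous (fun u => clamp 0 lin_radius (w u 0 k))}.
  apply: (@continuous_comp _ _ _ (fun u => w u 0 k) (clamp 0 lin_radius)).
    apply: (@continuous_comp _ _ _ w (fun N : 'rV[R]_2 => N 0 k) r (cw r)).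
    exact: coord_continuous.
  exact: clamp_continuous.
have c0 := ck 0; have c1 := ck 1.
have nz : 1 + clamp 1 1 r * clamp 0 lin_radius (w r 0 0) != 0.
  have := clamp_in 1 ler01 r; have := clamp0_in (w r 0 0).
  move: (clamp 1 1 r) (clamp 0 lin_radius (w r 0 0)) => q X; rewrite rad => hX hq.
  have q2 : `|q| <= 2.
    by move: hq; rewrite !ler_norml => /andP[? ?]; apply/andP; split; lra.
  have : `|q * X| <= 2 * (1 / 100) by rewrite normrM ler_pM.
  by case: eqP => //; rewrite ler_norml => + /andP[]; lra.
suff cj (j : 'I_2) : {for r, continuous (fun u => lin_field u (w u) 0 j)}.
  by apply: cvg_row.
move: ck => _; case: (ord2_cases j) => ->.
- have -> : (fun u => lin_field u (w u) 0 0) = (fun u =>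
      lin_X (clamp 1 1 u) (clamp 0 lin_radius (w u 0 0)) (clamp 0 lin_radius (w u 0 1))).
    by apply/funext => u; rewrite mxE.
  by rewrite /lin_X; do ?[apply: continuousM => //|apply: continuousD => //].
- have -> : (fun u => lin_field u (w u) 0 1) = (fun u =>
      lin_V (clamp 1 1 u) (clamp 0 lin_radius (w u 0 0)) (clamp 0 lin_radius (w u 0 1))).
    by apply/funext => u; rewrite mxE.
  rewrite /lin_V; do ?[apply: continuousM => //|apply: continuousD => //].
  apply: continuousV => //.
  by apply: continuousD => //; apply: continuousM.
Qed.

End Existence.

Section GlobalSolution.
Variable R : realType.

Lemma lin_solution (X0 V0 : R) : `|X0| <= lin_radius / 2 -> `|V0| <= lin_radius / 2 ->
  exists X V : R -> R, [/\ X 1 = X0, V 1 = V0 & forall r, `|r - 1| <= 1 ->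
    [/\ `|X r| <= lin_radius, `|V r| <= lin_radius,
        is_derive r (1 : R) X (lin_X r (X r) (V r))
      & is_derive r (1 : R) V (lin_V r (X r) (V r))]].
Proof.
move=> hX hV; pose w0 : 'rV[R]_2 := \row_(j < 2) (if j == 0 then X0 else V0).
have lip (r : R) (x y : 'rV[R]_2) : `|r - 1| <= 1 -> `|lin_field r x - lin_field r y| <= 2^-1 * `|x - y|.
  by move=> _; exact: lin_field_lipschitz.
have [v [v1 dv]] := picard w0 (@lin_field_continuous R) lip.
have vb (j : 'I_2) (r : R) : `|r - 1| <= 1 -> `|v r 0 j| <= lin_radius.
  move=> r1; have : `|v r 0 j - w0 0 j| <= lin_radius / 2.
    apply: (@mean_value_bound _ 1 (fun u => v u 0 j - w0 0 j)
      (fun u => lin_field u (v u) 0 j)) => // [u u1|||u _].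
    - rewrite -[lin_field _ _ _ _]subr0; apply: is_deriveB.
      by have /is_derive_mxP := dv u u1; exact.
    - by rewrite v1 subrr.
    - by rewrite /lin_radius; lra.
    - exact: lin_field_le.
  have : `|w0 0 j| <= lin_radius / 2 by case: (ord2_cases j) => ->; rewrite mxE.
  rewrite !ler_norml /lin_radius => /andP[? ?] /andP[? ?].
  by apply/andP; split; lra.
exists (fun r => v r 0 0), (fun r => v r 0 1); split; [by rewrite v1 mxE|by rewrite v1 mxE|].
move=> r r1; have b0 := vb 0 r r1; have b1 := vb 1 r r1.
have rad0 : 0 <= lin_radius :> R by rewrite /lin_radius; lra.
have [d0 d1] := (is_derive_row2 _ _ _).1 (dv r r1).
have cl (j : 'I_2) : clamp 0 lin_radius (v r 0 j) = v r 0 j.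
  by apply: clamp_id => //; rewrite subr0; exact: vb.
split => //.
- by move: d0; rewrite /lin_field mxE /= !cl clamp_id.
- by move: d1; rewrite /lin_field mxE /= !cl clamp_id.
Qed.

(** The planar system in the unknowns x = A - 1 and y = B/A - 1; the two linear
    parts are - 16 x and - 16 y. *)
Definition dev_x (x y : R) : R := - (16 * x + 20 * x ^+ 2 + 8 * y * x + 4 * y * x ^+ 2).
Definition dev_y (x y : R) : R :=
  - (16 * y + 16 * y ^+ 2 + 8 * y * (1 + y) * x ^+ 2 / (1 + x)).

Lemma flow_A_dev (x y : R) : 1 + x != 0 ->
  flow_A (1 + x) ((1 + x) * (1 + y)) = dev_x x y.
Proof. by move=> x0; rewrite /flow_A /dev_x; field. Qed.

Lemma flow_B_dev (x y : R) : 1 + x != 0 ->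
  flow_B (1 + x) ((1 + x) * (1 + y)) = (1 + y) * dev_x x y + (1 + x) * dev_y x y.
Proof. by move=> x0; rewrite /flow_B /dev_x /dev_y; field. Qed.

Lemma flow_solution (x0 y0 : R) : `|x0| <= lin_radius / 2 -> `|y0| <= lin_radius / 2 ->
  exists z : R -> 'rV[R]_2,
    [/\ z 0 0 0 = 1 + x0, z 0 0 1 = (1 + x0) * (1 + y0) & forall s, 0 <= s ->
      quadrant (z s) /\ is_derive s (1 : R) z (flow_field (z s))].
Proof.
move=> hx hy; have [X [V [X1 V1 sol]]] := lin_solution hx hy.
pose rho (s : R) := expR (- 16 * s).
have drho s : is_derive s (1 : R) rho (- 16 * rho s).
  have dl : is_derive s (1 : R) (fun u => - 16 * u) (- 16).
    by apply: is_derive_eq; rewrite /GRing.scale/=; ring.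
  by rewrite mulrC; apply: is_derive1_comp dl.
have rho0 : rho 0 = 1 by rewrite /rho mulr0 expR0.
pose x s := rho s * X (rho s); pose y s := rho s * V (rho s).
pose z s : 'rV[R]_2 :=
  \row_(j < 2) (if j == 0 then 1 + x s else (1 + x s) * (1 + y s)).
have z0 s : z s 0 0 = 1 + x s by rewrite mxE.
have z1 s : z s 0 1 = (1 + x s) * (1 + y s) by rewrite mxE.
exists z; split; [by rewrite z0 /x rho0 mul1r X1|by rewrite z1 /x /y rho0 !mul1r X1 V1|].
move=> s s0; have r0 : 0 < rho s by exact: expR_gt0.
have r1 : rho s <= 1 by rewrite /rho -[leRHS]expR0 ler_expR; lra.
have rr : `|rho s - 1| <= 1 by rewrite ler_norml; apply/andP; split; lra.
have [bX bV dX dV] := sol _ rr.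
have bd t : `|t| <= lin_radius -> `|rho s * t| <= 1 / 100.
  by move=> bt; rewrite normrM -[1 / 100]mul1r ler_pM // ger0_norm // ltW.
have bx : `|x s| <= 1 / 100 by exact: bd.
have by_ : `|y s| <= 1 / 100 by exact: bd.
have px : 0 < 1 + x s by move: bx; rewrite ler_norml => /andP[]; lra.
have py : 0 < 1 + y s by move: by_; rewrite ler_norml => /andP[]; lra.
split; first by rewrite /quadrant /= z0 z1; split=> //; exact: mulr_gt0.
have xn : 1 + rho s * X (rho s) != 0 by rewrite gt_eqF.
have dx : is_derive s (1 : R) x (dev_x (x s) (y s)).
  have dXr := is_derive1_comp dX (drho s).
  have dp := is_derive_product (drho s) dXr.
  by apply: (is_derive_eq dp); rewrite /dev_x /x /y /lin_X /GRing.scale/=; field.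
have dy : is_derive s (1 : R) y (dev_y (x s) (y s)).
  have dVr := is_derive1_comp dV (drho s).
  have dp := is_derive_product (drho s) dVr.
  by apply: (is_derive_eq dp); rewrite /dev_y /x /y /lin_V /GRing.scale/=; field.
have dc (d : R) (f : R -> R) : is_derive s (1 : R) f d -> is_derive s (1 : R) (fun u => 1 + f u) d.
  by move=> df; rewrite -[d]add0r; apply: is_deriveD.
apply/is_derive_row2; rewrite flow_field0 flow_field1 z0 z1.
rewrite flow_A_dev // flow_B_dev //.
have -> : (fun u => z u 0 0) = (fun u => 1 + x u) by apply/funext => u; exact: z0.
have -> : (fun u => z u 0 1) = (fun u => (1 + x u) * (1 + y u)) by apply/funext => u; exact: z1.
split; first exact: dc.
rewrite addrC; exact: (is_derive_product (dc _ _ dx) (dc _ _ dy)).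
Qed.

End GlobalSolution.

(** * Attraction by the three-Sasakian metric *)

Section Decay.
Variable R : realType.

(** At the first time m at which Q reaches the level e, the mean value theorem
    contradicts the fact that Q does not increase below that level. *)
Lemma below_barrier (Q dQ : R -> R) (Q0 e : R) :
  (forall s : R, 0 < s -> is_derive s (1 : R) Q (dQ s)) ->
  Q s @[s --> 0^'+] --> Q0 -> Q0 < e ->
  (forall s : R, 0 < s -> Q s < e -> dQ s <= 0) -> forall s : R, 0 < s -> Q s < e.
Proof.
move=> dQs Q00 Qe dle s1 s10; rewrite ltNge; apply/negP => Qs1.
have [s2 [s20 s21 Qs2]] : exists s2, [/\ 0 < s2, s2 < s1 & Q s2 < e].
  have near1 : \forall s \near 0^'+, 0 < s /\ (s < s1 /\ Q s < e).
    near=> s; split; first by near: s; exact: nbhs_right_gt.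
    split; first by near: s; exact: nbhs_right_lt.
    by near: s; exact: (cvgr_lt _ Q00 _ Qe).
  have [s [? [? ?]]] := @filter_ex _ (0^'+) _ _ near1; by exists s.
pose S := [set s | s2 <= s <= s1 /\ e <= Q s].
have hS : has_inf S.
  split; first by exists s1; split=> //; rewrite (ltW s21) lexx.
  by exists s2 => s [/andP[]].
pose m := inf S.
have s2m : s2 <= m by apply: lb_le_inf; [exact: hS.1|move=> s [/andP[]]].
have m0 : 0 < m by exact: lt_le_trans s2m.
have ms1 : m <= s1 by apply: ge_inf; [exact: hS.2|split=> //; rewrite (ltW s21) lexx].
have cQ s : 0 < s -> {for s, continuous Q} by move=> s0; exact: is_derive_continuous (dQs s s0).
have Qm : e <= Q m.
  rewrite leNgt; apply/negP => Qm.
  have /nbhs_ballP [d /= d0 dP] : \forall s \near m, Q s < e by exact: (cvgr_lt _ (cQ m m0)).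
  have [s [[ss Qs]]] := inf_adherent d0 hS; rewrite -/m => sm.
  have ms : m <= s by apply: ge_inf; [exact: hS.2|split].
  have : Q s < e.
    by apply: dP; rewrite /ball /= distrC ger0_norm ?subr_ge0 //; lra.
  by rewrite ltNge Qs.
have before s : s2 <= s -> s < m -> Q s < e.
  move=> ss sm; rewrite ltNge; apply/negP => Qs.
  have : m <= s.
    by apply: ge_inf; [exact: hS.2|split=> //; rewrite ss (le_trans (ltW sm))].
  by rewrite leNgt sm.
have s2m' : s2 < m by rewrite lt_neqAle s2m andbT; apply/eqP => E; move: Qm; rewrite -E leNgt Qs2.
have [||c] := @MVT _ Q dQ s2 m s2m'.
- by move=> s; rewrite in_itv /= => /andP[ss _]; apply: dQs; exact: lt_trans ss.
- apply: continuous_in_subspaceT => s; rewrite inE /= in_itv /= => /andP[ss _].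
  by apply: cQ; exact: lt_le_trans ss.
rewrite in_itv /= => /andP[sc cm] E.
have : dQ c * (m - s2) <= 0.
  apply: mulr_le0_ge0; last by rewrite subr_ge0.
  by apply: dle; [exact: lt_trans sc|apply: before => //; exact: ltW].
by rewrite -E; move: Qm Qs2; lra.
Unshelve. all: by end_near. Qed.

(** Below the level e, s Q(s) does not increase for s >= 1, since its derivative
    is at most (1 - s) Q(s); so Q(s) <= Q(1) / s. *)
Lemma decay (Q dQ : R -> R) (Q0 e : R) :
  (forall s : R, 0 < s -> is_derive s (1 : R) Q (dQ s)) -> (forall s, 0 <= Q s) ->
  Q s @[s --> 0^'+] --> Q0 -> Q0 < e ->
  (forall s : R, 0 < s -> Q s < e -> dQ s <= - Q s) -> Q s @[s --> +oo] --> 0.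
Proof.
move=> dQs Qpos Q00 Qe dle.
have Qlt : forall s : R, 0 < s -> Q s < e.
  apply: (below_barrier dQs Q00 Qe) => s s0 /(dle s s0) h.
  by apply: (le_trans h); rewrite oppr_le0.
have bound s : 1 < s -> s * Q s <= Q 1.
  move=> s1; have dP (u : R) : 0 < u -> is_derive u (1 : R) (fun u => u * Q u) (u * dQ u + Q u).
    move=> u0; have := is_derive_product (is_derive_id u (1 : R)) (dQs u u0).
    by rewrite mulr1.
  have [||c] := @MVT _ (fun u => u * Q u) (fun u => u * dQ u + Q u) 1 s s1.
  - by move=> u; rewrite in_itv /= => /andP[u1 _]; apply: dP; exact: lt_trans u1.
  - apply: continuous_in_subspaceT => u; rewrite inE /= in_itv /= => /andP[u1 _].
    by apply: is_derive_continuous; apply: dP; exact: lt_le_trans u1.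
  rewrite in_itv /= => /andP[c1 _] E.
  have c0 : 0 < c by exact: lt_trans c1.
  have : (c * dQ c + Q c) * (s - 1) <= 0.
    apply: mulr_le0_ge0; last by rewrite subr_ge0 ltW.
    have h := dle c c0 (Qlt c c0); have p := Qpos c.
    have : c * dQ c <= c * - Q c by rewrite ler_wpM2l // ltW.
    have : 1 * Q c <= c * Q c by rewrite ler_wpM2r // ltW.
    by rewrite mulrN; lra.
  by rewrite -E mul1r; lra.
apply/cvgrPdist_lt => d d0; near=> s.
have s1 : 1 < s by near: s; exact: nbhs_pinfty_gt.
have sd : Q 1 / d < s by near: s; apply: nbhs_pinfty_gt; exact: num_real.
have s0 : 0 < s by exact: lt_trans s1.
rewrite sub0r normrN ger0_norm // -(ltr_pM2l s0).
by apply: (le_lt_trans (bound s s1)); rewrite -ltr_pdivrMr.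
Unshelve. all: by end_near. Qed.

End Decay.

Section Stability.
Variable R : realType.

Lemma sqr_le_abs (c x : R) : 0 <= c -> x ^+ 2 <= c ^+ 2 -> `|x| <= c.
Proof. by move=> c0; rewrite -[x ^+ 2]real_normK ?num_real // ler_sqr ?nnegrE. Qed.

Lemma cvg0_of_sqr (F : set_system R) {FF : ProperFilter F} (f Q : R -> R) :
  (forall s, f s ^+ 2 <= Q s) -> Q s @[s --> F] --> 0 -> f s @[s --> F] --> 0.
Proof.
move=> fQ Q0; apply/cvgrPdist_le => e e0.
have e2 : 0 < e ^+ 2 by exact: exprn_gt0.
move/cvgrPdist_le : Q0 => /(_ _ e2); apply: filterS => s.
rewrite !sub0r !normrN => h; apply: sqr_le_abs; first exact: ltW.
by apply: (le_trans (fQ s)); apply: le_trans h; exact: ler_norm.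
Qed.

(** The radius 1/1000 leaves room for the passage from B - 1 to B/A - 1. *)
Lemma start_bounds (z0 : 'rV[R]_2) : `|z0 - const_mx 1| < 1 / 1000 ->
  [/\ 0 < z0 0 0, `|z0 0 0 - 1| <= lin_radius / 2
    & `|z0 0 1 / z0 0 0 - 1| <= lin_radius / 2].
Proof.
move=> h; have c (j : 'I_2) : `|z0 0 j - 1| <= 1 / 1000.
  apply: (le_trans _ (ltW h)).
  by have := coord_le_norm (z0 - const_mx 1) j; rewrite !mxE.
have := c 0; have := c 1; move: (z0 0 0) (z0 0 1) => a b.
rewrite /lin_radius !ler_norml => /andP[b1 b2] /andP[a1 a2].
have a0 : 0 < a by move: a1 a2; lra.
split => //; first by apply/andP; split; move: a1 a2; lra.
apply/andP; split.
- by rewrite lerBrDl ler_pdivlMr //; move: a1 a2 b1 b2; lra.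
- by rewrite lerBlDl ler_pdivrMr //; move: a1 a2 b1 b2; lra.
Qed.

(** In the small disk the linear terms dominate the others, apart from a term
    in x^2 y^2 (1 + y) / (1 + x) that has the favourable sign. *)
Lemma dev_dissipative (x y : R) : x ^+ 2 + y ^+ 2 < (1 / 100) ^+ 2 ->
  2 * (x * dev_x x y + y * dev_y x y) <= - (x ^+ 2 + y ^+ 2).
Proof.
move=> h; have px := sqr_ge0 x; have py := sqr_ge0 y.
have hx : `|x| <= 1 / 100.
  by apply: sqr_le_abs => //; apply: ltW; apply: le_lt_trans h; rewrite lerDl.
have hy : `|y| <= 1 / 100.
  by apply: sqr_le_abs => //; apply: ltW; apply: le_lt_trans h; rewrite lerDr.
move: hx hy; rewrite !ler_norml => /andP[x1 x2] /andP[y1 y2].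
have xy : `|y * x| <= 1.
  rewrite normrM -[1]mulr1; apply: ler_pM => //; rewrite ler_norml; apply/andP; split; lra.
have k1 : 0 <= 16 + 20 * x + 8 * y + 4 * (y * x) - 1.
  by move: xy; rewrite ler_norml => /andP[]; lra.
have k2 : 0 <= 16 + 16 * y - 1 by lra.
have k3 : 0 <= y ^+ 2 * (1 + y) * x ^+ 2 / (1 + x).
  by apply: divr_ge0; [do 2?apply: mulr_ge0 => //; lra|lra].
have m1 := mulr_ge0 px k1; have m2 := mulr_ge0 py k2.
rewrite -subr_ge0.
have -> : - (x ^+ 2 + y ^+ 2) - 2 * (x * dev_x x y + y * dev_y x y) =
   2 * (x ^+ 2 * (16 + 20 * x + 8 * y + 4 * (y * x) - 1)) + 2 * (y ^+ 2 * (16 + 16 * y - 1))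
   + 16 * (y ^+ 2 * (1 + y) * x ^+ 2 / (1 + x)) + x ^+ 2 + y ^+ 2.
  by rewrite /dev_x /dev_y; field; rewrite gt_eqF //; lra.
by move: m1 m2 k3 px py; lra.
Qed.

Lemma flow_attracted (z : R -> 'rV[R]_2) (z0 : 'rV[R]_2) :
  (forall s : R, 0 < s -> quadrant (z s) /\ is_derive s (1 : R) z (flow_field (z s))) ->
  z s @[s --> 0^'+] --> z0 -> `|z0 - const_mx 1| < 1 / 1000 ->
  z s @[s --> +oo] --> (const_mx 1 : 'rV[R]_2).
Proof.
move=> sol zz0 /start_bounds[a0 hx hy].
pose x s := z s 0 0 - 1; pose y s := z s 0 1 / z s 0 0 - 1.
pose Q s := x s ^+ 2 + y s ^+ 2.
pose dQ s := 2 * (x s * dev_x (x s) (y s) + y s * dev_y (x s) (y s)).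
have zE (s : R) : 0 < s -> z s 0 0 = 1 + x s /\ z s 0 1 = (1 + x s) * (1 + y s).
  move=> /sol[[A0 B0] _]; rewrite /x /y; split; first by ring.
  by field; rewrite gt_eqF.
have dxy (s : R) : 0 < s -> is_derive s (1 : R) x (dev_x (x s) (y s)) /\
    is_derive s (1 : R) y (dev_y (x s) (y s)).
  move=> s0; have [[A0 B0] /is_derive_row2[]] := sol s s0.
  have An : z s 0 0 != 0 by rewrite gt_eqF.
  have [E0 E1] := zE s s0; have xn : 1 + x s != 0 by rewrite -E0.
  have sub1 (f : R -> R) (d : R) : is_derive s (1 : R) f d ->
      is_derive s (1 : R) (fun u => f u - 1) d.
    by move=> df; rewrite -[d]subr0; apply: is_deriveB.
  rewrite flow_field0 flow_field1 E0 E1 flow_A_dev // flow_B_dev // => d0 d1.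
  split; first exact: sub1.
  apply: sub1; apply: (is_derive_eq (is_derive_quotient An d1 d0)).
  by rewrite E0 E1; field.
have dQs (s : R) : 0 < s -> is_derive s (1 : R) Q (dQ s).
  move=> /dxy[dx dy].
  have dp := is_deriveD (is_derive_product dx dx) (is_derive_product dy dy).
  have -> : Q = (fun u => x u * x u) + (fun u => y u * y u).
    by apply/funext => u; rewrite /Q !expr2.
  by apply: (is_derive_eq dp); rewrite /dQ; ring.
have Q0 (s : R) : 0 <= Q s by rewrite addr_ge0 // sqr_ge0.
have cz (j : 'I_2) : z s 0 j @[s --> 0^'+] --> z0 0 j.
  exact: (continuous_cvg _ (@coord_continuous _ _ _ 0 j z0) zz0).
have cx : x s @[s --> 0^'+] --> z0 0 0 - 1 by apply: cvgB; [exact: cz|exact: cvg_cst].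
have cy : y s @[s --> 0^'+] --> z0 0 1 / z0 0 0 - 1.
  apply: cvgB; last exact: cvg_cst.
  by apply: cvgM; [exact: cz|apply: cvgV; [rewrite gt_eqF|exact: cz]].
have cQ : Q s @[s --> 0^'+] --> (z0 0 0 - 1) ^+ 2 + (z0 0 1 / z0 0 0 - 1) ^+ 2.
  by apply: cvgD; rewrite expr2; under eq_cvg do rewrite expr2; apply: cvgM.
have small : (z0 0 0 - 1) ^+ 2 + (z0 0 1 / z0 0 0 - 1) ^+ 2 < (1 / 100) ^+ 2.
  have sq (t : R) : `|t| <= lin_radius / 2 -> t ^+ 2 <= (1 / 200) ^+ 2.
    move=> ht; rewrite -[t ^+ 2]real_normK ?num_real // ler_sqr ?nnegrE //.
    by move: ht; rewrite /lin_radius; lra.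
  by have := sq _ hx; have := sq _ hy; lra.
have Qoo : Q s @[s --> +oo] --> 0.
  apply: (decay dQs Q0 cQ small) => s s0; exact: dev_dissipative.
have xoo : x s @[s --> +oo] --> 0 by apply: (cvg0_of_sqr _ Qoo) => s; rewrite lerDl sqr_ge0.
have yoo : y s @[s --> +oo] --> 0 by apply: (cvg0_of_sqr _ Qoo) => s; rewrite lerDr sqr_ge0.
have x1 : 1 + x s @[s --> +oo] --> (1 : R).
  by rewrite -[X in _ --> X]addr0; apply: cvgD => //; exact: cvg_cst.
have y1 : 1 + y s @[s --> +oo] --> (1 : R).
  by rewrite -[X in _ --> X]addr0; apply: cvgD => //; exact: cvg_cst.
have pos : \forall s \near +oo, (0 : R) < s by exact: nbhs_pinfty_gt.
apply: cvg_row => j; rewrite mxE; case: (ord2_cases j) => ->.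
- apply: cvg_trans x1; apply: near_eq_cvg.
  by apply: filterS pos => s /zE[-> _].
- have xy : (1 + x s) * (1 + y s) @[s --> +oo] --> (1 : R).
    by rewrite -[X in _ --> X]mulr1; apply: cvgM.
  apply: cvg_trans xy; apply: near_eq_cvg.
  by apply: filterS pos => s /zE[_ ->].
Qed.

End Stability.

(** * Instability of the squashed metric and conclusion *)

Section Diagonal.
Variable R : realType.

Lemma flow_field_diagonal (x : R) : x != 0 ->
  flow_field (const_mx x) = const_mx (- 4 + 24 * x - 20 * x ^+ 2).
Proof.
move=> x0; apply/matrixP => i j; rewrite ord1 [RHS]mxE; case: (ord2_cases j) => ->.
- by rewrite flow_field0 !mxE /flow_A; field.
- by rewrite flow_field1 !mxE /flow_B; field.
Qed.

(** On the diagonal the system is x' = - 4 (1 - x) (1 - 5 x); these are its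
    solutions that tend to 1/5 at - infinity and to 1 at + infinity. *)
Definition escape (k s : R) : R := (1 + k * expR (16 * s)) / (5 + k * expR (16 * s)).

Lemma is_derive_escape (k s : R) : 0 < k ->
  is_derive s (1 : R) (escape k) (- 4 + 24 * escape k s - 20 * escape k s ^+ 2).
Proof.
move=> k0; have E0 := expR_gt0 (16 * s).
have dl : is_derive s (1 : R) (fun u => 16 * u) 16.
  by apply: is_derive_eq; rewrite /GRing.scale/=; ring.
have dE := is_derive1_comp (is_derive_expR (16 * s)) dl.
have dc (c : R) : is_derive s (1 : R) (fun u => c + k * expR (16 * u)) (16 * (k * expR (16 * s))).
  have dk := is_deriveD (is_derive_cst c s (1 : R)) (is_deriveZ k dE).
  by apply: (is_derive_eq dk); rewrite /GRing.scale/=; ring.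
have den : 5 + k * expR (16 * s) != 0.
  by rewrite gt_eqF // addr_gt0 // mulr_gt0.
pose affine (c u : R) := c + k * expR (16 * u).
apply: (is_derive_eq (@is_derive_quotient _ (affine 1) (affine 5) s _ _ den (dc 1) (dc 5))).
by rewrite /affine /escape; field.
Qed.

Lemma escape_gap (k s : R) : 0 < k -> 0 <= s -> 
  0 < escape k 0 - 1 / 5 <= escape k s - 1 / 5.
Proof.
move=> k0 s0; have E1 : 1 <= expR (16 * s) by rewrite -[leLHS]expR0 ler_expR mulr_ge0.
have kE : k <= k * expR (16 * s) by rewrite ler_pMr.
rewrite lerD2r subr_gt0 /escape mulr0 expR0 mulr1.
move: (k * _) kE => q kq.
have a0 : 0 < 5 + k by lra.
have b0 : 0 < 5 + q by lra.
apply/andP; split; first by rewrite ltr_pdivlMr //; lra.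
rewrite ler_pdivrMr // mulrAC ler_pdivlMr //.
by rewrite -subr_ge0 (_ : _ - _ = 4 * (q - k)); [lra|ring].
Qed.

Lemma is_derive_const_mx (f : R -> R) (s d : R) : is_derive s (1 : R) f d ->
  is_derive s (1 : R) (fun u => const_mx (f u) : 'rV[R]_2) (const_mx d).
Proof.
move=> df; apply/is_derive_row2; rewrite !mxE.
have E (j : 'I_2) : (fun u => (const_mx (f u) : 'rV[R]_2) 0 j) = f.
  by apply/funext => u; rewrite mxE.
by rewrite !E.
Qed.

End Diagonal.

Section Conclusion.
Variables (R : realType) (M : topologicalType) (A : atlas R 7 M).
Variables (g : tensor2_components A) (E1 E2 E3 : vector_components A).
Hypotheses (gm : riemannian_metric g) (ts : three_sasakian g E1 E2 E3).
Hypothesis M0 : [set: M] !=set0.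

Let oK : open (`]0, +oo[%classic : set R). Proof. exact: rray_open. Qed.
Let iK : is_interval (`]0, +oo[%classic : set R). Proof. exact: interval_is_interval. Qed.

(** A solution on the closed half line takes its initial value as a limit. *)
Lemma solution_flow (z : R -> 'rV[R]_2) :
  (forall s, 0 <= s -> quadrant (z s) /\ is_derive s (1 : R) z (flow_field (z s))) ->
  rescaled_ricci_flow g E1 E2 E3 `]0, +oo[%classic z /\ z s @[s --> 0^'+] --> z 0.
Proof.
move=> sol.
refine (conj _ _).
  apply: (ode_rescaled_flow gm ts M0 oK iK) => s; rewrite /= in_itv /= andbT => s0.
  by apply: sol; exact: ltW.
apply: cvg_at_right_filter; exact: is_derive_continuous (proj2 (sol 0 (lexx 0))).
Qed.

Lemma three_sasakian_stable : stable_point g E1 E2 E3 (const_mx 1).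
Proof.
exists (1 / 1000); first by lra.
move=> z0 hz0 starts.
split.
- have [A0 hx hy] := start_bounds hz0.
  have [z [z00 z01 sol]] := flow_solution hx hy.
  exists z; rewrite /starts; have -> : z0 = z 0; last exact: solution_flow.
  apply/matrixP => i j; rewrite ord1; case: (ord2_cases j) => ->.
  + by rewrite z00 addrC subrK.
  + by rewrite z01 [1 + _]addrC subrK [1 + _]addrC subrK mulrC divfK // gt_eqF.
- move=> z [fl cz]; apply: (flow_attracted _ cz hz0) => s s0.
  apply: (rescaled_flow_ode gm ts M0 oK iK fl).
  by rewrite /= in_itv /= andbT.
Qed.

Lemma squashed_unstable : ~ stable_point g E1 E2 E3 (const_mx (1 / 5)).
Proof.
case=> e e0 st; pose z (s : R) : 'rV[R]_2 := const_mx (escape e s).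
have near0 : `|z 0 - const_mx (1 / 5)| < e.
  have /andP[g0 _] := escape_gap e0 (lexx 0).
  have lt : escape e 0 - 1 / 5 < e.
    rewrite ltrBlDr /escape mulr0 expR0 mulr1 ltr_pdivrMr; last by lra.
    have ee := mulr_gt0 e0 e0.
    by rewrite -subr_gt0 (_ : _ - _ = e * e + e * (21 / 5)); [lra|field].
  apply: le_lt_trans lt; apply/norm_rV_le => [|j]; first exact: ltW.
  by rewrite !mxE ger0_norm // ltW.
have sol s : 0 <= s -> quadrant (z s) /\ is_derive s (1 : R) z (flow_field (z s)).
  move=> s0; have /andP[g0 gs] := escape_gap e0 s0.
  have p : 0 < escape e s by lra.
  split; first exact: quadrant_const.
  rewrite flow_field_diagonal ?gt_eqF //.
  by apply: is_derive_const_mx; exact: is_derive_escape.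
have [_ /(_ z (solution_flow sol)) zoo] := st _ near0.
have /andP[g0 _] := escape_gap e0 (lexx 0).
have [N [_ hN]] := (cvgrPdist_lt _ _).1 zoo _ g0.
pose s := Num.max (N + 1) 0.
have sN : N < s by rewrite lt_max; apply/orP; left; lra.
have s0 : 0 <= s by rewrite le_max lexx orbT.
have /andP[_ gs] := escape_gap e0 s0.
have := hN s sN; rewrite /= ltNge => /negP; apply.
apply: (le_trans gs); have := coord_le_norm (const_mx (1 / 5) - z s) 0.
by rewrite !mxE distrC; apply: le_trans; exact: ler_norm.
Qed.

End Conclusion.

Theorem theorem1p3 (R : realType) (M : topologicalType) (A : atlas R 7 M)
    (g : tensor2_components A) (E1 E2 E3 : vector_components A) :
  [set: M] !=set0 -> hausdorff_space M -> @second_countable M ->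
  riemannian_metric g -> complete_metric g -> three_sasakian g E1 E2 E3 ->
  let g_M : 'rV[R]_2 := ratios 1 1 1 in
  let g_squashed : 'rV[R]_2 :=
    ratios (Num.sqrt (1 / 5)) (Num.sqrt (1 / 5)) 1 in
  exists F : 'rV[R]_2 -> 'rV[R]_2,
    [/\ rescaled_flow_system g E1 E2 E3 F,
        F g_M = 0 /\ stable_point g E1 E2 E3 g_M,
        saddle_point F g_squashed
      & ~ stable_point g E1 E2 E3 g_squashed].
Proof.
move=> M0 _ _ gm _ ts g_M g_squashed; exists (@flow_field R).
rewrite /g_M /g_squashed ratios_M ratios_squashed; split.
- split; first exact: flow_field_differentiable.
  move=> K z oK iK; split; first exact: (rescaled_flow_ode gm ts M0 oK iK).
  exact: (ode_rescaled_flow gm ts M0 oK iK).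
- by split; [exact: flow_field_M|exact: three_sasakian_stable].
- exact: squashed_saddle.
- exact: squashed_unstable.
Qed.
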